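(* Fix an integer $p\ge 2$, $\boldsymbol\theta\in\mathcal{S}^{p-1}$ and $f\in\mathcal{F}$. Let $(\kappa_n)$ be a positive real sequence that diverges to infinity. Then, under ${\rm P}^{(n)}_{\boldsymbol\theta,\kappa_n,f}$, $$2n\kappa_n\varphi_f(\kappa_n)(1-\boldsymbol\theta'\hat{\boldsymbol\theta}_n)\stackrel{\mathcal{D}}{\to}\chi^2_{p-1}$$ as $n\to\infty$.
   Context: $\mathcal{S}^{p-1}$ is the unit sphere of $\mathbb{R}^p$, a prime denotes transposition, and $\stackrel{\mathcal{D}}{\to}$ denotes convergence in distribution. For a function $f$, $\varphi_f:=f'/f$ wherever $f$ is differentiable. The class $\mathcal{F}$ is the collection of functions $f:\mathbb{R}\to\mathbb{R}^+$ that (i) are monotone non-decreasing on $(-\infty,0]$ and monotone increasing on $[0,\infty)$; (ii) are differentiable in a neighborhood of $\infty$ (i.e., over $(M,\infty)$ for some $M$); (iii) are such that $\kappa\varphi_f(\kappa)$ diverges to infinity as $\kappa\to\infty$ and $\kappa\mapsto\kappa\varphi_f(\kappa)$ is monotone non-decreasing over $(M,\infty)$ for some $M$; and (iv) satisfy, for any $\xi,\zeta>-1$, $$\int_{-1}^1(1-s)^\xi(1+s)^\zeta\,\big|e^{\log f(\kappa s)-\log f(\kappa)}-e^{(s-1)\kappa\varphi_f(\kappa)}\big|\,ds=o\bigg(\frac{1}{(\kappa\varphi_f(\kappa))^{\xi+1}}\bigg)\quad\text{as }\kappa\to\infty.$$ ${\rm P}^{(n)}_{\boldsymbol\theta,\kappa_n,f}$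 is the hypothesis under which $\mathbf{X}_{n1},\ldots,\mathbf{X}_{nn}$ are mutually independent random vectors on $\mathcal{S}^{p-1}$ with common density, with respect to the surface area measure, $\mathbf{x}\mapsto\frac{c_{p,\kappa_n,f}\Gamma((p-1)/2)}{2\pi^{(p-1)/2}}f(\kappa_n\mathbf{x}'\boldsymbol\theta)$, where $c_{p,\kappa,f}:=1\big/\int_{-1}^1(1-s^2)^{(p-3)/2}f(\kappa s)\,ds$. The spherical mean is $\hat{\boldsymbol\theta}_n:=\bar{\mathbf{X}}_n/\|\bar{\mathbf{X}}_n\|$, with $\bar{\mathbf{X}}_n:=\frac1n\sum_{i=1}^n\mathbf{X}_{ni}$ (well defined almost surely). The quantity $\varphi_f(\kappa_n)$ is well defined for all $n$ large enough. *)

(* Defs.v *)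
From HB Require Import structures.
From mathcomp Require Import all_boot all_order all_algebra.
From mathcomp Require Import all_classical all_reals all_analysis.
From mathcomp Require Import measurable_realfun.

Set Implicit Arguments.
Unset Strict Implicit.
Unset Printing Implicit Defensive.

Import Order.TTheory GRing.Theory Num.Theory.
Import numFieldNormedType.Exports.

Local Open Scope classical_set_scope.
Local Open Scope ring_scope.

(* The product sigma-algebra on R^p, i.e., the one generated by the
   coordinates; it is the Borel sigma-algebra of R^p. *)
Definition measure_rV_display : measure_display -> measure_display.
Proof. exact. Qed.

Section measurable_rV.
Context {R : realType}.
Variable p : nat.

Let coors : 'I_p -> 'rV[R]_p -> R := fun i x => x 0 i.

Let rV_set0 : g_sigma_preimage coors set0.
Proof. exact: sigma_algebra0. Qed.

Let rV_setC A : g_sigma_preimage coors A -> g_sigma_preimage coors (~` A).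
Proof. exact: sigma_algebraC. Qed.

Let rV_bigcup (F : _^nat) : (forall i, g_sigma_preimage coors (F i)) ->
  g_sigma_preimage coors (\bigcup_i (F i)).
Proof. exact: sigma_algebra_bigcup. Qed.

HB.instance Definition _ := @isMeasurable.Build
  (measure_rV_display default_measure_display) 'rV[R]_p
  (g_sigma_preimage coors) rV_set0 rV_setC rV_bigcup.

End measurable_rV.

Section measurable_rV_theory.
Context {R : realType}.

Lemma measurable_coord p (i : 'I_p) :
  measurable_fun [set: 'rV[R]_p] (fun x : 'rV[R]_p => x 0 i).
Proof.
move=> _ Y mY; rewrite setTI; apply: sub_sigma_algebra => /=.
rewrite -bigcup_seq/=; exists i => /=; first by rewrite mem_index_enum.
by exists Y => //; rewrite setTI.
Qed.

Lemma measurable_fun_coordP d (T : measurableType d) p (f : T -> 'rV[R]_p) :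
  measurable_fun [set: T] f <->
  forall i, measurable_fun [set: T] (fun w => f w 0 i).
Proof.
apply: (@iff_trans _ (g_sigma_preimage
    (fun i => (fun x : 'rV[R]_p => x 0 i) \o f) `<=` measurable)).
  rewrite g_sigma_preimage_comp; split=> [mf A [/= C preC <-]|prefS].
    exact: mf.
  by move=> _ A mA; apply: prefS; exists A.
split=> [cS i|mf].
- move=> _ A mA.
  apply: cS; apply: sub_sigma_algebra.
  case: p i => [[] []//|p i] in f *.
  rewrite -bigcup_mkord_ord.
  exists i; first exact: ltn_ord.
  by exists A => //; rewrite inord_val.
- apply: smallest_sub; first exact: sigma_algebra_measurable.
  case: p => [|p] in f mf *; first by rewrite big_ord0.
  rewrite -bigcup_mkord_ord; apply: bigcup_sub => i Ii.
  by move=> A [B mB <-]; exact: mf.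
Qed.

End measurable_rV_theory.

Section power_measure.
Context {R : realType}.

Definition rV_cons n (xv : measurableTypeR R * 'rV[R]_n) : 'rV[R]_n.+1 :=
  \row_i if unlift ord0 i is Some j then xv.2 0 j else xv.1.

Definition rV_uncons n (x : 'rV[R]_n.+1) : measurableTypeR R * 'rV[R]_n :=
  (x 0 ord0, \row_j x 0 (lift ord0 j)).

Lemma rV_consK n : cancel (@rV_cons n) (@rV_uncons n).
Proof.
move=> [a v]; rewrite /rV_uncons /rV_cons !mxE unlift_none; congr pair.
by apply/rowP => j; rewrite !mxE liftK.
Qed.

Lemma measurable_rV_cons n : measurable_fun [set: _] (@rV_cons n).
Proof.
apply/measurable_fun_coordP => i; rewrite /rV_cons.
case: (unliftP ord0 i) => [j ->|->].
- rewrite (_ : (fun _ => _) = (fun x : 'rV[R]_n => x 0 j) \o snd); last first.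
    by apply/funext => xv; rewrite /= mxE liftK.
  by apply: measurableT_comp => //; exact: measurable_coord.
- rewrite (_ : (fun _ => _) = fst) //.
  by apply/funext => xv; rewrite mxE unlift_none.
Qed.

Lemma measurable_rV_uncons n : measurable_fun [set: _] (@rV_uncons n).
Proof.
apply: measurable_fun_pair; first exact: measurable_coord.
apply/measurable_fun_coordP => j.
rewrite (_ : (fun _ => _) = (fun x : 'rV[R]_n.+1 => x 0 (lift ord0 j))).
  exact: measurable_coord.
by apply/funext => x; rewrite mxE.
Qed.

Section cons_measure.
Variables (n : nat) (mu : {sigma_finite_measure set (measurableTypeR R) -> \bar R}).
Variable nu : {sigma_finite_measure set 'rV[R]_n -> \bar R}.

Definition cons_measure : set 'rV[R]_n.+1 -> \bar R :=
  pushforward (mu \x nu)%E (@rV_cons n).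

Let cons_measure0 : cons_measure set0 = 0%E.
Proof. by rewrite /cons_measure /pushforward preimage_set0 measure0. Qed.

Let cons_measure_ge0 A : (0 <= cons_measure A)%E.
Proof. exact: (measure_ge0 (mu \x nu)%E). Qed.

Let cons_measure_sigma_additive : semi_sigma_additive cons_measure.
Proof.
move=> F mF tF mUF; rewrite /cons_measure /pushforward preimage_bigcup.
have mc A : measurable A -> measurable (@rV_cons n @^-1` A).
  by move=> mA; rewrite -[X in measurable X]setTI; exact: measurable_rV_cons.
apply: measure_semi_sigma_additive.
- by move=> k; exact: mc.
- apply/trivIsetP => /= i j _ _ ij; rewrite -preimage_setI.
  by move/trivIsetP : tF => /(_ _ _ _ _ ij) ->//; rewrite preimage_set0.
- by rewrite -preimage_bigcup; exact: mc.
Qed.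

HB.instance Definition _ := isMeasure.Build _ _ _ cons_measure
  cons_measure0 cons_measure_ge0 cons_measure_sigma_additive.

Let cons_measure_sigma_finite : sigma_finite setT cons_measure.
Proof.
have /sigma_finiteP[F [TF ndF Foo]] := sigma_finiteT mu.
have /sigma_finiteP[G [TG ndG Goo]] := sigma_finiteT nu.
exists (fun k => @rV_uncons n @^-1` (F k `*` G k)).
  rewrite -preimage_bigcup (_ : \bigcup_k _ = setT) ?preimage_setT//.
  rewrite -subTset => -[x y] _.
  have [i _ Fix] : (\bigcup_k F k) x by rewrite -TF.
  have [j _ Gjy] : (\bigcup_k G k) y by rewrite -TG.
  exists (maxn i j) => //; split.
  - by move: x Fix; exact/subsetPset/ndF/leq_maxl.
  - by move: y Gjy; exact/subsetPset/ndG/leq_maxr.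
move=> k; have [mFk Fkoo] := Foo k; have [mGk Gkoo] := Goo k; split.
  rewrite -[X in measurable X]setTI; apply: measurable_rV_uncons => //.
  exact: measurableX.
rewrite /cons_measure /pushforward -comp_preimage.
rewrite (_ : _ \o _ = id); last by apply/funext => xv /=; rewrite rV_consK.
by rewrite preimage_id product_measure1E// lte_mul_pinfty// ge0_fin_numE.
Qed.

HB.instance Definition _ := Measure_isSigmaFinite.Build _ _ _ cons_measure
  cons_measure_sigma_finite.

End cons_measure.

(* The n-fold product measure mu x ... x mu on R^n. *)
Fixpoint power_measure (mu : {sigma_finite_measure set (measurableTypeR R) -> \bar R})
    n : {sigma_finite_measure set 'rV[R]_n -> \bar R} :=
  if n is n'.+1 then cons_measure mu (power_measure mu n')
  else \d_(0 : 'rV[R]_0).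

End power_measure.

Section euclidean.
Context {R : realType}.
Variable p : nat.
Implicit Types x y : 'rV[R]_p.

Definition dotr x y : R := (x *m y^T) 0 0.

(* Not [`|x|], which is the sup norm on matrices. *)
Definition enorm x : R := Num.sqrt (dotr x x).

Definition unit_sphere : set 'rV[R]_p := [set x | enorm x = 1].

(* Equal to 0 at 0. *)
Definition normalize x : 'rV[R]_p := (enorm x)^-1 *: x.

Definition punctured_ball : set 'rV[R]_p := [set x | 0 < enorm x <= 1].

Lemma dotrE x y : dotr x y = \sum_(i < p) x 0 i * y 0 i.
Proof. by rewrite /dotr mxE; apply: eq_bigr => i _; rewrite mxE. Qed.

Lemma dotr_ge0 x : 0 <= dotr x x.
Proof. by rewrite dotrE sumr_ge0// => i _; rewrite -expr2 sqr_ge0. Qed.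

Lemma measurable_dotr d (T : measurableType d) (f g : T -> 'rV[R]_p) :
  measurable_fun [set: T] f -> measurable_fun [set: T] g ->
  measurable_fun [set: T] (fun w => dotr (f w) (g w)).
Proof.
move=> /measurable_fun_coordP mf /measurable_fun_coordP mg.
rewrite (_ : (fun _ => _) = fun w => \sum_(i < p) f w 0 i * g w 0 i).
  by apply: measurable_sum => i; apply: measurable_funM.
by apply/funext => w; rewrite dotrE.
Qed.

Lemma measurable_enorm d (T : measurableType d) (f : T -> 'rV[R]_p) :
  measurable_fun [set: T] f -> measurable_fun [set: T] (fun w => enorm (f w)).
Proof.
move=> mf; rewrite (_ : (fun _ => _) = (@Num.sqrt R) \o (fun w => dotr (f w) (f w))) //.
apply: measurableT_comp; last exact: measurable_dotr.
by apply: continuous_measurable_fun; exact: sqrt_continuous.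
Qed.

Lemma measurable_normalize d (T : measurableType d) (f : T -> 'rV[R]_p) :
  measurable_fun [set: T] f -> measurable_fun [set: T] (fun w => normalize (f w)).
Proof.
move=> mf; apply/measurable_fun_coordP => i.
rewrite (_ : (fun _ => _) = fun w => enorm (f w) `^ (- 1) * f w 0 i).
  apply: measurable_funM; last by move/measurable_fun_coordP : mf; apply.
  have := measurableT_comp (measurable_powR (R := R) (- 1)) (measurable_enorm mf).
  exact.
by apply/funext => w; rewrite mxE powR_inv1// sqrtr_ge0.
Qed.

Lemma measurable_punctured_ball : measurable punctured_ball.
Proof.
rewrite (_ : punctured_ball = enorm @^-1` `]0, 1]).
  by rewrite -[X in measurable X]setTI; apply: measurable_enorm.
by apply/seteqP; split => x; rewrite /punctured_ball /= in_itv.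
Qed.

End euclidean.
Arguments normalize {R p} x.
Arguments unit_sphere {R} p.
Arguments punctured_ball {R} p.

Section surface_measure.
Context {R : realType}.
Variable p : nat.

Definition lebesgue_rV : set 'rV[R]_p -> \bar R := power_measure lebesgue_measure p.

HB.instance Definition _ := SigmaFiniteMeasure.on lebesgue_rV.

(* Surface area measure of the unit sphere, through polar coordinates: the
   area of A is p times the volume of the cone {r x | 0 < r <= 1, x in A}. It
   is a measure on R^p that charges only the sphere. *)
Definition surface_measure (A : set 'rV[R]_p) : \bar R :=
  (p%:R%:E * lebesgue_rV (normalize @^-1` A `&` punctured_ball p))%E.

Let mnormalize (A : set 'rV[R]_p) : measurable A -> measurable (normalize @^-1` A).
Proof.
by move=> mA; rewrite -[X in measurable X]setTI; apply: measurable_normalize.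
Qed.

Let surface_measure0 : surface_measure set0 = 0%E.
Proof. by rewrite /surface_measure preimage_set0 set0I measure0 mule0. Qed.

Let surface_measure_ge0 A : (0 <= surface_measure A)%E.
Proof. by rewrite mule_ge0// lee_fin. Qed.

Let surface_measure_sigma_additive : semi_sigma_additive surface_measure.
Proof.
move=> F mF tF mUF; rewrite /surface_measure.
pose m := mscale (NngNum (ler0n R p)) (mrestr lebesgue_rV (@measurable_punctured_ball R p)).
have := @measure_semi_sigma_additive _ _ _ m (fun k => normalize @^-1` F k).
rewrite -preimage_bigcup; apply.
- by move=> k; exact: mnormalize.
- apply/trivIsetP => /= i j _ _ ij; rewrite -preimage_setI.
  by move/trivIsetP : tF => /(_ _ _ _ _ ij) ->//; rewrite preimage_set0.
- exact: mnormalize.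
Qed.

HB.instance Definition _ := isMeasure.Build _ _ _ surface_measure
  surface_measure0 surface_measure_ge0 surface_measure_sigma_additive.

End surface_measure.

Section chi_square.
Context {R : realType}.

(* Law of n independent standard normal variables. *)
Definition std_gaussian_rV n : set 'rV[R]_n -> \bar R :=
  power_measure (normal_prob 0 1) n.

HB.instance Definition _ n := SigmaFiniteMeasure.on (@std_gaussian_rV n).

Lemma std_gaussian_rVT n : std_gaussian_rV [set: 'rV[R]_n] = 1%E.
Proof.
rewrite /std_gaussian_rV; elim: n => [|n IH] /=; first by rewrite diracT.
rewrite /cons_measure /pushforward preimage_setT -setXTT product_measure1E//.
by rewrite IH mule1; exact: (probability_setT (normal_prob 0 1)).
Qed.

HB.instance Definition _ n := Measure_isProbability.Build _ _ _
  (@std_gaussian_rV n) (@std_gaussian_rVT n).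

Definition sqnorm n (z : 'rV[R]_n) : R := dotr z z.

Lemma measurable_sqnorm n : measurable_fun [set: 'rV[R]_n] (@sqnorm n).
Proof. exact: measurable_dotr. Qed.

HB.instance Definition _ n := isMeasurableFun.Build _ _ _ _
  (@sqnorm n) (@measurable_sqnorm n).

(* Law of Z_1^2 + ... + Z_k^2 for independent standard normal Z_i. *)
Definition chi_square k : probability R R :=
  distribution (@std_gaussian_rV k) (@sqnorm k).

End chi_square.

Canonical pinfty_filter_on (R : realType) := FilterType (pinfty_nbhs R) _.

Section class_F.
Context {R : realType}.
Local Notation mu := (@lebesgue_measure R).

Definition phi (f : R -> R) (x : R) : R := (f^`()%classic x) / f x.

(* Here [e^(log f(k s) - log f(k))] is computed with the conventions
   log 0 = -oo and e^-oo = 0, since f may vanish on ]-oo, 0]. *)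
Definition expratio (f : R -> R) (k s : R) : R :=
  fine (expeR (lne (f (k * s))%:E - lne (f k)%:E)).

Record class_F (f : R -> R) : Prop := {
  class_F_ge0 : forall x, 0 <= f x ;
  class_F_nondecreasing : {in `]-oo, 0] &, {homo f : x y / x <= y}} ;
  class_F_increasing : {in `[0, +oo[ &, {homo f : x y / x < y}} ;
  class_F_derivable : exists M, {in `]M, +oo[, forall x, derivable f x 1} ;
  class_F_dvg : k * phi f k @[k --> +oo] --> +oo ;
  class_F_phi_nondecreasing : exists M,
    {in `]M, +oo[ &, {homo (fun k => k * phi f k) : x y / x <= y}} ;
  class_F_laplace : forall xi zeta : R, -1 < xi -> -1 < zeta ->
    (fun k => \int[mu]_(s in `[-1, 1])
       ((1 - s) `^ xi * (1 + s) `^ zeta *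
        `|expratio f k s - expR ((s - 1) * (k * phi f k))|))
    =o_ (pinfty_nbhs R)
    (fun k => ((k * phi f k) `^ (xi + 1))^-1)
}.

End class_F.

Section rotationally_symmetric.
Context {R : realType}.
Local Notation mu := (@lebesgue_measure R).

Definition Gamma (z : R) : R :=
  \int[mu]_(t in `]0, +oo[) (t `^ (z - 1) * expR (- t)).

Definition norm_const (p : nat) (kappa : R) (f : R -> R) : R :=
  (\int[mu]_(s in `[-1, 1]) ((1 - s ^+ 2) `^ ((p%:R - 3) / 2) * f (kappa * s)))^-1.

Definition sphere_density p (theta : 'rV[R]_p) (kappa : R) (f : R -> R)
    (x : 'rV[R]_p) : R :=
  norm_const p kappa f * Gamma ((p%:R - 1) / 2) / (2 * pi `^ ((p%:R - 1) / 2))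
  * f (kappa * dotr x theta).

Definition mutually_independent d (T : measurableType d) (P : probability T R)
    d' (U : measurableType d') (I : finType) (X : I -> {RV P >-> U}) : Prop :=
  forall (J : {set I}) (B : I -> set U), (forall i, measurable (B i)) ->
  P (\bigcap_(i in [set` J]) (X i @^-1` B i)) =
  (\prod_(i in J) P (X i @^-1` B i))%E.

(* The X_i form a sample from P^(n)_{theta, kappa, f}. *)
Record sphere_sample p (theta : 'rV[R]_p) (kappa : R) (f : R -> R)
    d (T : measurableType d) (P : probability T R) n
    (X : 'I_n -> {RV P >-> 'rV[R]_p}) : Prop := {
  sphere_sample_sphere : forall i w, unit_sphere p (X i w) ;
  sphere_sample_independent : mutually_independent X ;
  sphere_sample_density : forall i B, measurable B ->
    distribution P (X i) B =
    (\int[surface_measure (p:=p)]_(x in B) (sphere_density theta kappa f x)%:E)%E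
}.

End rotationally_symmetric.

Section spherical_mean.
Context {R : realType} {d} {T : measurableType d} {P : probability T R}.
Variables (p n : nat).
Implicit Type X : 'I_n -> {RV P >-> 'rV[R]_p}.

Definition sample_mean X (w : T) : 'rV[R]_p := n%:R^-1 *: \sum_(i < n) X i w.

Definition spherical_mean X (w : T) : 'rV[R]_p := normalize (sample_mean X w).

Lemma measurable_sample_mean X : measurable_fun [set: T] (sample_mean X).
Proof.
apply/measurable_fun_coordP => j.
rewrite (_ : (fun _ => _) = fun w => n%:R^-1 * \sum_(i < n) X i w 0 j).
  apply: measurable_funM => //; apply: measurable_sum => i.
  by have /measurable_fun_coordP := @measurable_funPT _ _ _ _ (X i); apply.
by apply/funext => w; rewrite mxE summxE.
Qed.

Lemma measurable_spherical_mean X : measurable_fun [set: T] (spherical_mean X).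
Proof. exact/measurable_normalize/measurable_sample_mean. Qed.

HB.instance Definition _ X := isMeasurableFun.Build _ _ _ _
  (spherical_mean X) (measurable_spherical_mean X).

Definition mean_direction_stat (theta : 'rV[R]_p) (kappa : R) (f : R -> R) X
    (w : T) : R :=
  2 * n%:R * kappa * phi f kappa * (1 - dotr theta (spherical_mean X w)).

Lemma measurable_mean_direction_stat theta kappa f X :
  measurable_fun [set: T] (mean_direction_stat theta kappa f X).
Proof.
apply: measurable_funM => //; apply: measurable_realfun.measurable_funB => //.
by apply: measurable_dotr => //; exact: measurable_spherical_mean.
Qed.

HB.instance Definition _ theta kappa f X := isMeasurableFun.Build _ _ _ _
  (mean_direction_stat theta kappa f X)
  (measurable_mean_direction_stat theta kappa f X).

End spherical_mean.

(* The random variables may live on different probability spaces. *)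
Definition cvg_in_distribution {R : realType} (d : nat -> measure_display)
    (T : forall n, measurableType (d n)) (P : forall n, probability (T n) R)
    (Z : forall n, {RV (P n) >-> R}) (mu : probability R R) : Prop :=
  forall x : R, {for x, continuous (fun y => mu `]-oo, y]%classic)} ->
  cdf (Z n) x @[n --> \oo] --> mu `]-oo, x]%classic.

(* Main.v *)
(* Write tau = kappa_n phi_f (kappa_n) and V_i = theta' X_i. Condition (iv) replaces the
   density of V_i by that of an exponential tilt of (1 - s^2)^((p - 3) / 2), whence
   tau E (1 - V_i^2) -> p - 1 while tau^2 E (1 - V_i^2)^2 stays bounded. Reflections fixing
   theta preserve the law of X_i, so the tangent part X_i - V_i theta is centred and its
   covariance is a multiple of the identity of the orthogonal of theta.

   Let S = sqrt (tau / n) sum_i (X_i - V_i theta). Exchanging the summands one by one with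
   Gaussian vectors (Lindeberg), for which E exp (- lambda |x + sqrt s Z|^2) is explicit,
   gives E exp (- lambda |S|^2) -> (1 + 2 lambda)^(- (p - 1) / 2), the Laplace transform of
   chi^2_(p - 1). The statistic differs from |S|^2 by a relative error at most
   8 (1 - theta' Xbar), whose mean tends to 0, so it has the same limiting Laplace
   transform; indicators of half-lines are approximated by polynomials in e^(- a u).

   Surface measure is defined by volumes of cones; its invariance under a reflection comes
   from the uniqueness of translation-invariant measures. *)
Require Import Defs.
From HB Require Import structures.
From mathcomp Require Import all_boot all_order all_algebra.
From mathcomp Require Import all_classical all_reals all_analysis.
From mathcomp Require Import measurable_realfun.
From mathcomp Require Import ring lra.

Set Implicit Arguments.
Unset Strict Implicit.
Unset Printing Implicit Defensive.

Import Order.TTheory GRing.Theory Num.Theory.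
Import numFieldNormedType.Exports.

Local Open Scope classical_set_scope.
Local Open Scope ring_scope.

(** * Translations and dilations of Lebesgue measure *)

(** The limit is the law of a squared length, so only E exp(- lambda |S|^2) is followed, never the
    joint law of S. Gaussian convolution keeps this function in the family [heat]; the Lindeberg
    exchange therefore runs without constructing any Gaussian vector: replacing one summand amounts
    to one time step of the heat equation, and expectations of bounded real functions suffice. The
    obstacle is that the law of X_i changes with n while condition (iv) is only asymptotic. An extra
    factor (1 - s)^j in its weight gains exactly tau^(-j), and the total mass is at least a constant
    times tau^(-(p - 1) / 2), so relative errors are o(tau^(-j)). The moments of the tilted density
    come from an integration by parts. Third moments are interpolated between second and fourth ones
    with parameter n^(-1/2), which makes the n exchange errors add up to O(n^(-1/2)). Reflections
    alone supply all the symmetry: two vectors of equal length are exchanged by one of them, and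
    each is its own inverse. *)

Section density.
Local Open Scope ereal_scope.
Context d (T : measurableType d) (R : realType).
Variables (mu : {measure set T -> \bar R}) (h : T -> R).
Hypotheses (mh : measurable_fun setT h) (h0 : forall x, (0 <= h x)%R).

Import HBNNSimple.

Lemma ge0_integral_density (nu : {measure set T -> \bar R}) (g : T -> \bar R) :
  (forall A, measurable A -> nu A = \int[mu]_(x in A) (h x)%:E) ->
  measurable_fun setT g -> (forall x, 0 <= g x) ->
  \int[nu]_x g x = \int[mu]_x ((h x)%:E * g x).
Proof.
move=> nuE mg g0.
pose f_ := nnsfun_approx measurableT mg.
have cf x : (EFin \o f_^~ x) n @[n --> \oo] --> g x.
  by apply: cvg_nnsfun_approx => // y _; exact: g0.
have nd x : {homo (fun n => (f_ n x)%:E) : m n / (m <= n)%N >-> m <= n}.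
  by move=> m n mn; rewrite lee_fin; exact/lefP/nd_nnsfun_approx.
transitivity (limn (fun n => \int[nu]_x (f_ n x)%:E)).
  rewrite -monotone_convergence//.
  - by apply: eq_integral => y _; apply/esym/cvg_lim => //; exact: cf.
  - by move=> n; exact/measurable_EFinP/measurable_funP.
  - by move=> n y _; rewrite lee_fin.
rewrite [X in limn X](_ : _ = (fun n => \int[mu]_x ((h x)%:E * (f_ n x)%:E))).
  rewrite -monotone_convergence//.
  - apply: eq_integral => y _; apply/cvg_lim => //.
    by apply: cvgeZl => //; exact: cf.
  - move=> n; apply: emeasurable_funM; first exact/measurable_EFinP.
    exact/measurable_EFinP/measurable_funP.
  - by move=> n y _; rewrite mule_ge0// lee_fin.
  - by move=> x _ m n mn; apply: lee_wpmul2l; [rewrite lee_fin|exact: nd].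
apply/funext => n.
transitivity (\sum_(k \in range (f_ n)) \int[nu]_x (k * \1_(f_ n @^-1` [set k]) x)%:E).
  under eq_integral do rewrite fimfunE -fsumEFin//.
  rewrite ge0_integral_fsum//.
  - by move=> y; exact/measurable_EFinP/measurable_funM.
  - by move=> y x _; rewrite nnfun_muleindic_ge0.
transitivity (\sum_(k \in range (f_ n)) \int[mu]_x ((h x)%:E * (k * \1_(f_ n @^-1` [set k]) x)%:E)).
  apply: eq_fsbigr => r _; rewrite integralZl_indic_nnsfun// integral_indic// setIT.
  rewrite nuE//.
  have [r0|r0] := leP 0%R r.
    transitivity (\int[mu]_x (r%:E * ((EFin \o h) \_ (f_ n @^-1` [set r])) x)).
      rewrite ge0_integralZl_EFin//; first by rewrite -integral_mkcond.
      - by move=> x _; apply: erestrict_ge0 => y _; rewrite lee_fin.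
      - by apply/(measurable_restrictT (EFin \o h)) => //; exact/measurable_EFinP/measurable_funTS.
    apply: eq_integral => x _; rewrite patchE indicE EFinM; case: ifPn => _.
      by rewrite mule1 muleC.
    by rewrite !mule0.
  (* A nonnegative simple function never takes a value [r < 0]: both sides vanish. *)
  rewrite preimage_nnfun0// integral_set0 mule0.
  by rewrite integral0_eq// => x _; rewrite indic0 /= mulr0 mule0.
rewrite -ge0_integral_fsum//.
- apply: eq_integral => x _; rewrite [in RHS]fimfunE -fsumEFin//.
  by rewrite ge0_mule_fsumr// => k; rewrite nnfun_muleindic_ge0.
- move=> r; apply: emeasurable_funM; first exact/measurable_EFinP.
  exact/measurable_EFinP/measurable_funM.
- by move=> r x _; rewrite mule_ge0 ?lee_fin// -lee_fin EFinM nnfun_muleindic_ge0.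
Qed.

(** Gives the set function its measure structure, so that uniqueness theorems for measures apply to
    it. *)
Lemma density_measureP : exists nu : {measure set T -> \bar R},
  forall A, nu A = \int[mu]_(x in A) (h x)%:E.
Proof.
pose nu (A : set T) := \int[mu]_(x in A) (h x)%:E.
have nu0 : nu set0 = 0 by rewrite /nu integral_set0.
have nu_ge0 A : 0 <= nu A by apply: integral_ge0 => x _; rewrite lee_fin.
have nu_sigma_additive : semi_sigma_additive nu.
  move=> F mF tF mUF; rewrite /nu ge0_integral_bigcup//.
  - by apply: is_cvg_ereal_nneg_natsum_cond => n _ _; exact: nu_ge0.
  - exact/measurable_EFinP/measurable_funTS.
  - by move=> x _; rewrite lee_fin.
pose mx := isMeasure.Build _ _ _ nu nu0 nu_ge0 nu_sigma_additive.
pose nu_ : {measure set T -> \bar R} := HB.pack nu mx.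
by exists nu_.
Qed.

End density.

(** The existential keeps only the two equations through which an image measure is used below. *)
Lemma pushforwardP d d' (T1 : measurableType d) (T2 : measurableType d')
    (R : realType) (m : {measure set T1 -> \bar R}) (f : T1 -> T2) :
  measurable_fun setT f ->
  exists nu : {measure set T2 -> \bar R}, (forall A, nu A = m (f @^-1` A)) /\
    forall g : T2 -> \bar R, measurable_fun setT g -> (forall x, 0 <= g x)%E ->
    (\int[nu]_x g x = \int[m]_x g (f x))%E.
Proof.
move=> mf.
unshelve refine (ex_intro _ [the measure _ _ of pushforward m f] _) => //.
split => // g mg g0.
by rewrite -[RHS](ge0_integral_pushforward mf m measurableT).
Qed.

Section lebesgue_rV_theory.
Local Open Scope ereal_scope.
Context {R : realType}.
Local Notation mu := (@lebesgue_measure R).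
Implicit Types m : {sigma_finite_measure set (measurableTypeR R) -> \bar R}.

Lemma measurable_funD_rV d (T : measurableType d) n (f g : T -> 'rV[R]_n) :
  measurable_fun setT f -> measurable_fun setT g ->
  measurable_fun setT (fun w => f w + g w)%R.
Proof.
move=> /measurable_fun_coordP mf /measurable_fun_coordP mg.
apply/measurable_fun_coordP => i; under eq_fun do rewrite mxE.
exact: measurable_funD.
Qed.

Lemma measurable_funZ_rV d (T : measurableType d) n (k : T -> R) (f : T -> 'rV[R]_n) :
  measurable_fun setT k -> measurable_fun setT f ->
  measurable_fun setT (fun w => k w *: f w)%R.
Proof.
move=> mk /measurable_fun_coordP mf.
apply/measurable_fun_coordP => i; under eq_fun do rewrite mxE.
exact: measurable_funM.
Qed.

Lemma ge0_integral_power_measureS m n (g : 'rV[R]_n.+1 -> \bar R) :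
  measurable_fun setT g -> (forall x, 0 <= g x) ->
  \int[power_measure m n.+1]_x g x =
  \int[m]_a \int[power_measure m n]_v g (rV_cons (a, v)).
Proof.
move=> mg g0.
rewrite (ge0_integral_pushforward (@measurable_rV_cons R n))//.
rewrite preimage_setT fubini_tonelli1//; last by move=> x; exact: g0.
by apply: measurableT_comp => //; exact: measurable_rV_cons.
Qed.

(** Tonelli in the other order: the first coordinate is innermost, so that it can be substituted
    while the others are fixed. *)
Lemma ge0_integral_power_measureS2 m n (g : 'rV[R]_n.+1 -> \bar R) :
  measurable_fun setT g -> (forall x, 0 <= g x) ->
  \int[power_measure m n.+1]_x g x =
  \int[power_measure m n]_v \int[m]_a g (rV_cons (a, v)).
Proof.
move=> mg g0; rewrite ge0_integral_power_measureS//.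
rewrite (fubini_tonelli (m1 := m) (m2 := power_measure m n) (fun z => g (rV_cons z)))//.
by apply: measurableT_comp => //; exact: measurable_rV_cons.
Qed.

(** The image of Lebesgue measure under the affine map, multiplied by [r], gives every half-open
    interval its length; uniqueness of Lebesgue measure concludes. *)
Lemma ge0_integral_lebesgue_affine (r c : R) (g : R -> \bar R) : (0 < r)%R ->
  measurable_fun setT g -> (forall x, 0 <= g x) ->
  r%:E * \int[mu]_x g (r * x + c)%R = \int[mu]_x g x.
Proof.
move=> r0 mg g0.
pose phi : measurableTypeR R -> measurableTypeR R := (fun x => r * x + c)%R.
have mphi : measurable_fun setT phi.
  by apply: measurable_funD => //; exact: measurable_funM.
pose rn := NngNum (ltW r0).
have [nu [nuE nuI]] := pushforwardP mu mphi.
transitivity (\int[mscale rn nu]_x g x).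
  by rewrite ge0_integral_mscale//= nuI.
apply: eq_measure_integral => A mA _.
apply/esym/lebesgue_measure_unique => // _ [[a b] _ <-].
transitivity (r%:E * (@lebesgue_measure R (phi @^-1` `]a, b]%classic))).
  2: by rewrite -[RHS]/(r%:E * nu _) nuE.
rewrite (_ : phi @^-1` `]a, b] = `](a - c) / r, (b - c) / r]%classic)%R; last first.
  apply/seteqP; split => x /=; rewrite !in_itv/= /phi ltr_pdivrMr// ler_pdivlMr//;
    by rewrite ltrBlDr lerBrDr mulrC.
rewrite !lebesgue_measure_itv/= !lte_fin ltr_pM2r ?invr_gt0// ltrD2r.
case: ifPn => // _; last by rewrite mule0.
by rewrite -!EFinD -EFinM; congr EFin; field; rewrite gt_eqF.
Qed.

(* Translations ([r = 1]) and dilations of R^n in one induction. *)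
Lemma ge0_integral_lebesgue_rV_affine n (r : R) (t : 'rV[R]_n)
    (g : 'rV[R]_n -> \bar R) : (0 < r)%R ->
  measurable_fun setT g -> (forall x, 0 <= g x) ->
  (r ^+ n)%:E * \int[@lebesgue_rV R n]_x g (r *: x + t)%R = \int[@lebesgue_rV R n]_x g x.
Proof.
move=> r0; rewrite /lebesgue_rV.
elim: n t g => [|n IH] t g mg g0.
  rewrite expr0 mul1e; apply: eq_integral => x _.
  by congr g; apply/rowP; case.
have maff k (s : 'rV[R]_k) : measurable_fun setT (fun x : 'rV[R]_k => r *: x + s)%R.
  by apply: measurable_funD_rV => //; exact: measurable_funZ_rV.
have mc := @measurable_rV_cons R n.
rewrite ge0_integral_power_measureS//; last first.
  by apply: measurableT_comp => //; exact: maff.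
rewrite [RHS]ge0_integral_power_measureS//.
pose t0 := t ord0 ord0; pose t' : 'rV[R]_n := \row_j t ord0 (lift ord0 j).
have E a (v : 'rV[R]_n) : (r *: rV_cons (a, v) + t =
    rV_cons ((r * a + t0, r *: v + t') : measurableTypeR R * 'rV[R]_n))%R.
  apply/rowP => i; rewrite !mxE/=; case: unliftP => [j ->|->]; by rewrite ?mxE.
under eq_integral do under eq_integral do rewrite E.
have mg2 : measurable_fun setT (fun z : measurableTypeR R * 'rV[R]_n => g (rV_cons z)).
  exact: measurableT_comp.
have r0n : 0 <= (r ^+ n)%:E by rewrite lee_fin exprn_ge0// ltW.
pose F (a : R) := \int[power_measure mu n]_v g (rV_cons ((a, v) : measurableTypeR R * 'rV[R]_n)).
have mF : measurable_fun setT F.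
  exact: (measurable_fun_fubini_tonelli_F (m2 := power_measure mu n)
    (fun z : measurableTypeR R * 'rV[R]_n => g (rV_cons z)) mg2).
have F0 a : 0 <= F a by exact: integral_ge0.
have := ge0_integral_lebesgue_affine t0 r0 mF F0; rewrite -/mu => <-.
(* One factor [r] is spent on the first coordinate, the other [n] on the induction hypothesis. *)
rewrite exprS EFinM -muleA.
congr (_ * _); rewrite -ge0_integralZl_EFin//.
- apply: eq_integral => a _.
  have := IH t' (fun v => g (rV_cons ((r * a + t0, v)%R : measurableTypeR R * 'rV[R]_n))).
  apply => //.
  by apply: (measurableT_comp mg2); exact: measurable_pair1.
- by move=> x _; exact: integral_ge0.
- apply: (measurable_fun_fubini_tonelli_F (m2 := power_measure mu n)
    (fun z : measurableTypeR R * 'rV[R]_n =>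
      g (rV_cons ((r * z.1 + t0, r *: z.2 + t')%R : measurableTypeR R * 'rV[R]_n)))) => //.
  apply: (measurableT_comp mg2) => //.
  apply: measurable_fun_pair => /=.
    by apply: measurable_funD => //; exact: measurable_funM.
  exact: (measurableT_comp (maff _ _)).
Qed.

End lebesgue_rV_theory.

(** * Euclidean norm and reflections *)

Section euclidean_theory.
Context {R : realType}.
Variable n : nat.
Implicit Types x y z : 'rV[R]_n.

Lemma dotrC x y : dotr x y = dotr y x.
Proof. by rewrite !dotrE; apply: eq_bigr => i _; rewrite mulrC. Qed.

Lemma dotrDl x y z : dotr (x + y) z = dotr x z + dotr y z.
Proof. by rewrite /dotr mulmxDl mxE. Qed.

Lemma dotrDr x y z : dotr z (x + y) = dotr z x + dotr z y.
Proof. by rewrite dotrC dotrDl !(dotrC z). Qed.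

Lemma dotrZl (a : R) x y : dotr (a *: x) y = a * dotr x y.
Proof. by rewrite /dotr -scalemxAl mxE. Qed.

Lemma dotrZr (a : R) x y : dotr x (a *: y) = a * dotr x y.
Proof. by rewrite dotrC dotrZl dotrC. Qed.

Lemma dotrNl x y : dotr (- x) y = - dotr x y.
Proof. by rewrite -scaleN1r dotrZl mulN1r. Qed.

Lemma dotrNr x y : dotr x (- y) = - dotr x y.
Proof. by rewrite dotrC dotrNl dotrC. Qed.

Lemma dotrBl x y z : dotr (x - y) z = dotr x z - dotr y z.
Proof. by rewrite dotrDl dotrNl. Qed.

Lemma dotrBr x y z : dotr z (x - y) = dotr z x - dotr z y.
Proof. by rewrite dotrDr dotrNr. Qed.

Lemma dot0r x : dotr 0 x = 0.
Proof. by rewrite /dotr mul0mx mxE. Qed.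

Lemma dotr_suml (I : Type) (s : seq I) (P : pred I) (F : I -> 'rV[R]_n) x :
  dotr (\sum_(i <- s | P i) F i) x = \sum_(i <- s | P i) dotr (F i) x.
Proof.
by elim/big_rec2 : _ => [|i y z _ <-]; rewrite ?dot0r// dotrDl.
Qed.

Lemma enorm_ge0 x : 0 <= enorm x. Proof. exact: sqrtr_ge0. Qed.

Lemma sqr_enorm x : enorm x ^+ 2 = dotr x x.
Proof. by rewrite sqr_sqrtr// dotr_ge0. Qed.

Lemma dotr_eq0 x : (dotr x x == 0) = (x == 0).
Proof.
apply/eqP/eqP => [|->]; last by rewrite dot0r.
rewrite dotrE => /eqP; rewrite psumr_eq0; last by move=> i _; rewrite -expr2 sqr_ge0.
move=> /allP x0; apply/rowP => i; rewrite mxE; apply/eqP.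
by have := x0 i (mem_index_enum _); rewrite /= mulf_eq0 orbb.
Qed.

Lemma enorm_eq0 x : (enorm x == 0) = (x == 0).
Proof. by rewrite -sqrf_eq0 sqr_enorm dotr_eq0. Qed.

Lemma enorm_gt0 x : (0 < enorm x) = (x != 0).
Proof. by rewrite lt_neqAle enorm_ge0 andbT eq_sym enorm_eq0. Qed.

Lemma enormZ (a : R) x : enorm (a *: x) = `|a| * enorm x.
Proof.
by rewrite /enorm dotrZl dotrZr mulrA -expr2 sqrtrM ?sqr_ge0// sqrtr_sqr.
Qed.

Lemma enormN x : enorm (- x) = enorm x.
Proof. by rewrite -scaleN1r enormZ normrN1 mul1r. Qed.

Lemma ler_dotr_enorm x y : dotr x y <= enorm x * enorm y.
Proof.
have [->|x0] := eqVneq x 0.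
  by rewrite dot0r mulr_ge0// enorm_ge0.
have [->|y0] := eqVneq y 0.
  by rewrite dotrC dot0r mulr_ge0// enorm_ge0.
have nx : 0 < enorm x by rewrite enorm_gt0.
have ny : 0 < enorm y by rewrite enorm_gt0.
(* The squared length of |y| x - |x| y equals 2 |x| |y| (|x| |y| - x'y). *)
have := dotr_ge0 (enorm y *: x - enorm x *: y).
rewrite dotrBl !dotrBr !dotrZl !dotrZr -!sqr_enorm (dotrC y x).
have nxy := mulr_gt0 nx ny.
rewrite (_ : _ - _ = 2 * (enorm x * enorm y) * (enorm x * enorm y - dotr x y)).
  by rewrite pmulr_rge0 ?mulr_gt0// subr_ge0.
ring.
Qed.

Lemma ler_norm_dotr x y : `|dotr x y| <= enorm x * enorm y.
Proof.
rewrite ler_norml ler_dotr_enorm andbT lerNl -dotrNl -(enormN x).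
exact: ler_dotr_enorm.
Qed.

Lemma enormD x y : enorm (x + y) <= enorm x + enorm y.
Proof.
rewrite -(@ler_pXn2r _ 2) ?nnegrE ?addr_ge0 ?enorm_ge0//.
rewrite sqr_enorm dotrDl !dotrDr (dotrC y x) sqrrD !sqr_enorm.
have := ler_dotr_enorm x y; lra.
Qed.

Lemma enorm_sum (I : Type) (s : seq I) (P : pred I) (F : I -> 'rV[R]_n) :
  enorm (\sum_(i <- s | P i) F i) <= \sum_(i <- s | P i) enorm (F i).
Proof.
elim/big_ind2 : _ => [||//]; first by rewrite /enorm dot0r sqrtr0.
by move=> x a y b xa yb; rewrite (le_trans (enormD _ _))// lerD.
Qed.

(* Equal to the identity if u = 0. *)
Definition reflect u x : 'rV[R]_n := x - (2 * dotr x u / dotr u u) *: u.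

Lemma reflectD u x y : reflect u (x + y) = reflect u x + reflect u y.
Proof. by rewrite /reflect dotrDl mulrDr mulrDl scalerDl opprD addrACA. Qed.

Lemma reflectZ u a x : reflect u (a *: x) = a *: reflect u x.
Proof. by rewrite /reflect dotrZl scalerBr scalerA; congr (_ - _ *: _); ring. Qed.

Lemma dotr_reflect u x y : dotr (reflect u x) (reflect u y) = dotr x y.
Proof.
have [->|u0] := eqVneq u 0; first by rewrite /reflect !scaler0 !subr0.
rewrite /reflect dotrBl !dotrBr !dotrZl !dotrZr (dotrC u y).
by field; rewrite dotr_eq0.
Qed.

Lemma reflectK u : involutive (reflect u).
Proof.
have [->|u0] := eqVneq u 0; first by move=> x; rewrite /reflect !scaler0 !subr0.
move=> x; rewrite {1}/reflect; set c := 2 * _ / _.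
rewrite /reflect -addrA -opprD -scalerDl (_ : _ + c = 0) ?scale0r ?subr0//.
by rewrite /c /reflect dotrBl dotrZl; field; rewrite dotr_eq0.
Qed.

Lemma dotr_reflectl u x y : dotr (reflect u x) y = dotr x (reflect u y).
Proof. by rewrite -{1}(reflectK u y) dotr_reflect. Qed.

Lemma enorm_reflect u x : enorm (reflect u x) = enorm x.
Proof. by rewrite /enorm dotr_reflect. Qed.

Lemma reflect_orth u x : dotr x u = 0 -> reflect u x = x.
Proof. by move=> xu; rewrite /reflect xu mulr0 mul0r scale0r subr0. Qed.

Lemma reflect_self u : reflect u u = - u.
Proof.
have [->|u0] := eqVneq u 0; first by rewrite /reflect scaler0 subr0 oppr0.
rewrite /reflect mulfK ?dotr_eq0//.
by rewrite scaler_nat mulr2n opprD addrA subrr sub0r.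
Qed.

(** Equal norms give 2 x'(x - y) = |x - y|^2, so the reflection subtracts exactly x - y. Every
    exchange of directions below goes through this lemma. *)
Lemma reflect_swap x y : enorm x = enorm y -> reflect (x - y) x = y.
Proof.
move=> xy; have [->|u0] := eqVneq x y.
  by rewrite /reflect subrr scaler0 subr0.
have {}u0 : dotr (x - y) (x - y) != 0 by rewrite dotr_eq0 subr_eq0.
have E : 2 * dotr x (x - y) = dotr (x - y) (x - y).
  rewrite !dotrBl !dotrBr (dotrC y x).
  have : dotr x x = dotr y y by rewrite -!sqr_enorm xy.
  lra.
by rewrite /reflect E divff// scale1r opprB addrC subrK.
Qed.

Lemma measurable_reflect u : measurable_fun setT (reflect u).
Proof.
apply: measurable_funD_rV => //.
rewrite (_ : (fun _ => _) = fun x => ((- (2 / dotr u u)) * dotr x u) *: u).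
  apply: measurable_funZ_rV => //; apply: measurable_funM => //.
  exact: measurable_dotr.
by apply/funext => x; rewrite -scaleNr; congr (_ *: _); ring.
Qed.

End euclidean_theory.

(** * Invariance under reflections *)

Section reflection_invariance.
Local Open Scope ereal_scope.
Context {R : realType}.
Local Notation mu := (@lebesgue_measure R).

Lemma ge0_integral_lebesgue_rVD n (t : 'rV[R]_n) (g : 'rV[R]_n -> \bar R) :
  measurable_fun setT g -> (forall x, 0 <= g x) ->
  \int[@lebesgue_rV R n]_x g (x + t)%R = \int[@lebesgue_rV R n]_x g x.
Proof.
move=> mg g0; rewrite -[RHS](ge0_integral_lebesgue_rV_affine t ltr01)//.
by rewrite expr1n mul1e; apply: eq_integral => x _; rewrite scale1r.
Qed.

(** The ball of the sup norm: its volume is a product, and comparison with it shows that the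
    Euclidean ball has positive finite volume. *)
Definition cube n (r : R) : set 'rV[R]_n := [set x | forall i, (`|x ord0 i| <= r)%R].

Lemma cubeS n r : @cube n.+1 r =
  (@rV_uncons R n) @^-1` (`[(- r)%R, r]%classic `*` @cube n r).
Proof.
apply/seteqP; split => x /=.
  move=> xr; split => /=; first by rewrite in_itv/= -ler_norml.
  by move=> i; rewrite mxE.
rewrite in_itv/= -ler_norml => -[x0 xr] i.
by have [j ->|->//] := unliftP ord0 i; have := xr j; rewrite mxE.
Qed.

Lemma measurable_cube n r : measurable (@cube n r).
Proof.
elim: n => [|n IH].
  rewrite (_ : @cube 0 r = setT)//.
  by apply/seteqP; split => x _ // -[].
rewrite cubeS -[X in measurable X]setTI.
by apply: measurable_rV_uncons => //; exact: measurableX.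
Qed.

Lemma lebesgue_rV_cube n r : (0 <= r)%R ->
  @lebesgue_rV R n (@cube n r) = ((r *+ 2) ^+ n)%:E.
Proof.
move=> r0; rewrite /lebesgue_rV; elim: n => [|n IH].
  by rewrite expr0 /= diracE mem_set// => -[].
rewrite cubeS /= /cons_measure /pushforward -comp_preimage.
rewrite (_ : _ \o _ = id); last by apply/funext => xv /=; rewrite rV_consK.
rewrite preimage_id product_measure1E//; last exact: measurable_cube.
rewrite IH exprS EFinM; congr (_ * _).
rewrite -[LHS]/(@lebesgue_measure R `[(- r)%R, r]%classic).
rewrite lebesgue_measure_itv/= lte_fin opprK -mulr2n.
case: ifPn => //; rewrite -leNgt => rr; congr EFin.
have : r = 0%R by lra.
by move=> ->; rewrite mul0rn.
Qed.

Definition unit_ball n : set 'rV[R]_n := [set x | (enorm x <= 1)%R].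

Lemma measurable_unit_ball n : measurable (@unit_ball n).
Proof.
rewrite (_ : @unit_ball n = (@enorm R n) @^-1` `]-oo, 1%R]%classic).
  by rewrite -[X in measurable X]setTI; apply: measurable_enorm.
by apply/seteqP; split => x; rewrite /unit_ball /= in_itv.
Qed.

Lemma ler_coord_enorm n (x : 'rV[R]_n) i : (`|x ord0 i| <= enorm x)%R.
Proof.
rewrite -(@ler_pXn2r _ 2) ?nnegrE ?enorm_ge0//.
rewrite sqr_enorm dotrE (bigD1 i)//= real_normK ?num_real// expr2 lerDl.
by rewrite sumr_ge0// => j _; rewrite -expr2 sqr_ge0.
Qed.

Lemma lebesgue_rV_unit_ball_lty n : @lebesgue_rV R n (@unit_ball n) < +oo.
Proof.
apply: (@le_lt_trans _ _ (@lebesgue_rV R n (@cube n 1))).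
  apply: le_measure; rewrite ?inE.
  - exact: measurable_unit_ball.
  - exact: measurable_cube.
  - by move=> x xb i; rewrite (le_trans (ler_coord_enorm _ _)).
by rewrite lebesgue_rV_cube ?ltry.
Qed.

Lemma lebesgue_rV_unit_ball_gt0 n : 0 < @lebesgue_rV R n (@unit_ball n).
Proof.
(* The n squares are at most 1/(n + 1) each, so they sum to at most 1; [n.+1] keeps the radius
   positive when n = 0. *)
have r0 : (0 < (n.+1%:R)^-1 :> R)%R by rewrite invr_gt0.
apply: (@lt_le_trans _ _ (@lebesgue_rV R n (@cube n (n.+1%:R^-1)))).
  by rewrite lebesgue_rV_cube 1?ltW// lte_fin exprn_gt0// pmulrn_lgt0.
apply: le_measure; rewrite ?inE.
- exact: measurable_cube.
- exact: measurable_unit_ball.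
- move=> x xr; rewrite /unit_ball /=.
  rewrite -(@ler_pXn2r _ 2) ?nnegrE ?enorm_ge0// sqr_enorm dotrE expr1n.
  apply: (@le_trans _ _ (\sum_(i < n) n.+1%:R^-1)%R).
    apply: ler_sum => i _; rewrite -expr2 -real_normK ?num_real//.
    apply: (@le_trans _ _ (n.+1%:R^-1 ^+ 2)%R).
      by rewrite ler_pXn2r ?nnegrE ?xr// ltW.
    by rewrite expr2 ler_piMr// invf_le1 ?ler1n.
  rewrite sumr_const card_ord -[leLHS]mulr_natl ler_pdivrMr// mul1r ler_nat.
  exact: leqnSn.
Qed.

(* Uniqueness of Haar measure: H transports Lebesgue measure to a translation
   invariant measure, and both give the same mass to the unit ball. *)
Lemma ge0_integral_lebesgue_rV_isometry_opp n (H : 'rV[R]_n -> 'rV[R]_n)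
    (g : 'rV[R]_n -> \bar R) :
  measurable_fun setT H -> {morph H : x y / (x + y)%R} -> involutive H ->
  (forall x, enorm (H x) = enorm x) ->
  measurable_fun setT g -> (forall x, 0 <= g x) ->
  \int[@lebesgue_rV R n]_x g (H x) = \int[@lebesgue_rV R n]_x g (- x)%R.
Proof.
move=> mH HD HK eH mg g0.
pose b (x : 'rV[R]_n) : \bar R := (\1_(@unit_ball n) x)%:E.
have bE : \int[@lebesgue_rV R n]_x b x = @lebesgue_rV R n (@unit_ball n).
  by rewrite integral_indic ?setIT//; exact: measurable_unit_ball.
have b0 x : 0 <= b x by rewrite lee_fin.
have mb : measurable_fun setT b.
  by apply/measurable_EFinP; apply: measurable_indic; exact: measurable_unit_ball.
have bH x : b (H x) = b x.
  rewrite /b !indicE; congr (_%:R)%:E; apply: congr1.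
  by apply/idP/idP; rewrite !inE /unit_ball /= eH.
have lgt0 := lebesgue_rV_unit_ball_gt0 n.
have llty := lebesgue_rV_unit_ball_lty n.
have lfin : @lebesgue_rV R n (@unit_ball n) \is a fin_num by rewrite ge0_fin_numE// ltW.
have mN : measurable_fun setT (fun y : 'rV[R]_n => (- y)%R).
  apply/measurable_fun_coordP => i; under eq_fun do rewrite mxE.
  by apply: measurable_funN => //; exact: measurable_coord.
have mgH : measurable_fun setT (g \o H) by exact: measurableT_comp.
have HB x y : (H (x - y) = H x - H y)%R.
  have H0 : (H 0 = 0)%R by apply: (addrI (H 0%R)); rewrite -HD !addr0.
  have HN z : (H (- z) = - H z)%R.
    by apply/eqP; rewrite -addr_eq0 -HD addNr H0.
  by rewrite HD HN.
(* The volume of the unit ball is positive and finite, so it can be cancelled at the end. *)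
suff : (\int[@lebesgue_rV R n]_x g (H x)) * @lebesgue_rV R n (@unit_ball n) =
       (\int[@lebesgue_rV R n]_x g (- x)%R) * @lebesgue_rV R n (@unit_ball n).
  move/(congr1 (fun z => z * (@lebesgue_rV R n (@unit_ball n))^-1)).
  by rewrite -!muleA divee ?gt_eqF// !mule1.
rewrite -!bE.
have ig0 (h : 'rV[R]_n -> 'rV[R]_n) : 0 <= \int[@lebesgue_rV R n]_x g (h x).
  by apply: integral_ge0.
(* By translation invariance the inner integral of [b (y + H x)] is the volume of the ball for every
   x. *)
transitivity (\int[@lebesgue_rV R n]_x \int[@lebesgue_rV R n]_y (g (H x) * b (y + H x)%R)).
  rewrite -ge0_integralZr//; last by apply: integral_ge0.
  apply: eq_integral => x _.
  have mbH : measurable_fun setT (fun y : 'rV[R]_n => b (y + H x)%R).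
    by apply: measurableT_comp => //; exact: measurable_funD_rV.
  rewrite (ge0_integralZl (@lebesgue_rV R n) measurableT mbH); [|by []|exact: g0].
  by rewrite ge0_integral_lebesgue_rVD.
rewrite (fubini_tonelli (m1 := @lebesgue_rV R n) (m2 := @lebesgue_rV R n)
  (fun z : 'rV[R]_n * 'rV[R]_n => g (H z.1) * b (z.2 + H z.1)%R))/=; first last.
- by move=> z; rewrite mule_ge0.
- apply: emeasurable_funM.
    by apply: (measurableT_comp mgH); exact: measurable_fst.
  apply: measurableT_comp => //; apply: measurable_funD_rV => //.
  by apply: measurableT_comp => //; exact: measurable_fst.
(* Translate x by [- H y]: as [H] is an additive involution, [H x] becomes [H x - y], and [b] is
   left with [H x], hence with x since norms are preserved. *)
transitivity (\int[@lebesgue_rV R n]_y \int[@lebesgue_rV R n]_x (g (H x - y)%R * b x)).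
  apply: eq_integral => y _.
  rewrite -[LHS](ge0_integral_lebesgue_rVD (- H y)).
  - by apply: eq_integral => x _; rewrite HB HK subrKC bH.
  - apply: emeasurable_funM => //.
    apply: measurableT_comp => //; exact: measurable_funD_rV.
  - by move=> x; rewrite mule_ge0.
rewrite (fubini_tonelli (m1 := @lebesgue_rV R n) (m2 := @lebesgue_rV R n)
  (fun z : 'rV[R]_n * 'rV[R]_n => g (H z.2 - z.1)%R * b z.2))/=; first last.
- by move=> z; rewrite mule_ge0.
- apply: emeasurable_funM.
    apply: measurableT_comp => //; apply: measurable_funD_rV.
      by apply: measurableT_comp => //; exact: measurable_snd.
    by apply: measurableT_comp => //; exact: measurable_fst.
  by apply: measurableT_comp => //; exact: measurable_snd.
rewrite -ge0_integralZl//.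
apply: eq_integral => x _.
have mgN : measurable_fun setT (fun y : 'rV[R]_n => g (- y)%R) by exact: measurableT_comp.
(* Translating y by [- H x] turns [g (- y)] into [g (H x - y)]. *)
rewrite -[in RHS](ge0_integral_lebesgue_rVD (- H x)) => [||//]; last exact: mgN.
rewrite -ge0_integralZr//.
- by apply: eq_integral => y _; rewrite opprB.
- by apply: (measurableT_comp mgN); exact: measurable_funD_rV.
Qed.

(** The reflection and the identity both satisfy the preceding lemma, so both integrals equal that
    of [g (- x)]. *)
Lemma ge0_integral_lebesgue_rV_reflect n (u : 'rV[R]_n) (g : 'rV[R]_n -> \bar R) :
  measurable_fun setT g -> (forall x, 0 <= g x) ->
  \int[@lebesgue_rV R n]_x g (reflect u x) = \int[@lebesgue_rV R n]_x g x.
Proof.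
move=> mg g0.
rewrite (ge0_integral_lebesgue_rV_isometry_opp (measurable_reflect u)
  (reflectD u) (reflectK u) (enorm_reflect u))//.
by rewrite -(@ge0_integral_lebesgue_rV_isometry_opp _ id).
Qed.

Lemma lebesgue_rV_reflect n (u : 'rV[R]_n) (A : set 'rV[R]_n) : measurable A ->
  @lebesgue_rV R n (reflect u @^-1` A) = @lebesgue_rV R n A.
Proof.
move=> mA.
have mrA : measurable (reflect u @^-1` A).
  by rewrite -[X in measurable X]setTI; apply: measurable_reflect.
have E (B : set 'rV[R]_n) : measurable B ->
    @lebesgue_rV R n B = \int[@lebesgue_rV R n]_x (\1_B x)%:E.
  by move=> mB; rewrite integral_indic// setIT.
rewrite !E//.
by rewrite -[RHS](ge0_integral_lebesgue_rV_reflect u)//; apply/measurable_EFinP.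
Qed.

Lemma surface_measure_reflect n (u : 'rV[R]_n) (A : set 'rV[R]_n) : measurable A ->
  @surface_measure R n (reflect u @^-1` A) = @surface_measure R n A.
Proof.
move=> mA; rewrite /surface_measure -[in RHS](lebesgue_rV_reflect u)//; last first.
  apply: measurableI; last exact: measurable_punctured_ball.
  rewrite -[X in measurable X]setTI; exact: measurable_normalize.
congr (_ * lebesgue_rV _); apply/seteqP; split => x;
  by rewrite /punctured_ball/= /normalize enorm_reflect reflectZ.
Qed.

End reflection_invariance.

(** * The law of one coordinate under the surface measure *)

Section slope_substitution.
Context {R : realType}.
Local Notation mu := (@lebesgue_measure R).

Lemma continuous_FTC2_is_derive (F f : R -> R) (a b : R) : a <= b ->
  (forall x, a <= x <= b -> is_derive x 1 F (f x)) ->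
  (forall x, a <= x <= b -> {for x, continuous f}) ->
  (\int[mu]_(x in `[a, b]) (f x)%:E = (F b)%:E - (F a)%:E)%E.
Proof.
rewrite le_eqVlt => /predU1P[<- _ _|ab dF cf].
  by rewrite set_itv1 integral_set1 subee.
have cF x : a <= x <= b -> {for x, continuous F}.
  move=> /dF dFx; apply: differentiable_continuous.
  exact/derivable1_diffP/ex_derive.
apply: continuous_FTC2 => //.
- apply: continuous_in_subspaceT => x; rewrite inE/= in_itv/= => xab.
  exact: cf.
- split.
  + by move=> x; rewrite in_itv/= => /andP[ax xb]; have [] := dF x; rewrite ?ltW.
  + by apply: cvg_at_right_filter; apply: cF; rewrite lexx ltW.
  + by apply: cvg_at_left_filter; apply: cF; rewrite lexx ltW.
- move=> x; rewrite in_itv/= => /andP[ax xb]; rewrite derive1E.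
  by have [] := dF x; rewrite ?ltW.
Qed.

Lemma is_derive_onem_sqr_powR (c s : R) : 0 < 1 - s ^+ 2 ->
  is_derive s 1 (fun s => (1 - s ^+ 2) `^ c) (c * (1 - s ^+ 2) `^ (c - 1) * (- (2 * s))).
Proof.
move=> s1.
have h : is_derive s 1 (fun s : R => 1 - s ^+ 2) (- (2 * s)).
  by apply: is_derive_eq; rewrite /GRing.scale /=; ring.
exact: (@is_derive1_comp R (fun z => z `^ c) (fun s => 1 - s ^+ 2) s _ _ (is_derive1_powR c s1) h).
Qed.

Lemma continuous_onem_sqr_powR (c s : R) : 0 < 1 - s ^+ 2 ->
  {for s, continuous (fun s : R => (1 - s ^+ 2) `^ c)}.
Proof.
move=> /(is_derive_onem_sqr_powR c) h; apply: differentiable_continuous.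
exact/derivable1_diffP/ex_derive.
Qed.

Lemma measurable_onem_sqr_powR (c : R) :
  measurable_fun setT (fun s : R => (1 - s ^+ 2) `^ c).
Proof.
apply: (@measurableT_comp _ _ _ _ _ _ (fun z : R => z `^ c) _ (fun s : R => 1 - s ^+ 2)) => //.
apply: measurable_funB => //; exact: measurable_funX.
Qed.

(* a = r s / sqrt (1 - s^2), the inverse of s = a / sqrt (a^2 + r^2). *)
Definition slope (r s : R) : R := r * (s * (1 - s ^+ 2) `^ (- 2^-1)).

Lemma onem_sqr_gt0 (s : R) : (0 < 1 - s ^+ 2) = (-1 < s < 1).
Proof. by rewrite subr_gt0 -real_normK ?num_real// expr_lt1// ltr_norml. Qed.

Lemma is_derive_slope (r s : R) : 0 < 1 - s ^+ 2 ->
  is_derive s 1 (slope r) (r * (1 - s ^+ 2) `^ (- 3 / 2)).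
Proof.
move=> s1; have h := is_derive_onem_sqr_powR (- 2^-1) s1.
rewrite /slope; apply: is_derive_eq; rewrite /GRing.scale /=.
have E : (1 - s ^+ 2) `^ (- 2^-1) = (1 - s ^+ 2) * (1 - s ^+ 2) `^ (- 3 / 2).
  rewrite -{2}(powRr1 (ltW s1)) -powRD; first by congr powR; lra.
  by rewrite (gt_eqF s1) implybT.
have -> : - 2^-1 - 1 = - 3 / 2 :> R by lra.
by rewrite E; field.
Qed.

Lemma measurable_slope (r : R) : measurable_fun setT (slope r).
Proof.
apply: measurable_funM => //; apply: measurable_funM => //.
exact: measurable_onem_sqr_powR.
Qed.

Lemma slopeK (r s : R) : 0 < r -> 0 < 1 - s ^+ 2 ->
  (slope r s) ^+ 2 + r ^+ 2 = r ^+ 2 / (1 - s ^+ 2).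
Proof.
move=> r0 s1; rewrite /slope !exprMn powRN exprVn powR12_sqrt ?ltW//.
by rewrite sqr_sqrtr ?ltW//; field; rewrite gt_eqF.
Qed.

Lemma slope_norm (r s : R) : 0 < r -> 0 < 1 - s ^+ 2 ->
  Num.sqrt ((slope r s) ^+ 2 + r ^+ 2) = r * (1 - s ^+ 2) `^ (- 2^-1).
Proof.
move=> r0 s1; rewrite slopeK// sqrtrM ?sqr_ge0// sqrtr_sqr gtr0_norm//.
by rewrite powRN powR12_sqrt ?ltW// sqrtrV ?ltW.
Qed.

Lemma slope_direction (r s : R) : 0 < r -> 0 < 1 - s ^+ 2 ->
  slope r s / Num.sqrt ((slope r s) ^+ 2 + r ^+ 2) = s.
Proof.
move=> r0 s1; rewrite slope_norm// /slope.
have : 0 < (1 - s ^+ 2) `^ (- 2^-1) by exact: powR_gt0.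
by move=> h; field; rewrite !gt_eqF.
Qed.

Definition inv_slope (r a : R) : R := a / Num.sqrt (a ^+ 2 + r ^+ 2).

Lemma inv_slope_onem (r a : R) : 0 < r ->
  1 - inv_slope r a ^+ 2 = r ^+ 2 / (a ^+ 2 + r ^+ 2).
Proof.
move=> r0; have h : 0 < a ^+ 2 + r ^+ 2 by rewrite ltr_wpDl ?sqr_ge0// exprn_gt0.
rewrite /inv_slope exprMn exprVn sqr_sqrtr ?ltW//; field.
by rewrite gt_eqF.
Qed.

Lemma inv_slope_lt1 (r a : R) : 0 < r -> 0 < 1 - inv_slope r a ^+ 2.
Proof.
move=> r0; rewrite inv_slope_onem// divr_gt0 ?exprn_gt0//.
by rewrite ltr_wpDl ?sqr_ge0// exprn_gt0.
Qed.

Lemma inv_slopeK (r a : R) : 0 < r -> slope r (inv_slope r a) = a.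
Proof.
move=> r0; have h : 0 < a ^+ 2 + r ^+ 2 by rewrite ltr_wpDl ?sqr_ge0// exprn_gt0.
rewrite /slope inv_slope_onem// powRN powR12_sqrt ?divr_ge0 ?sqr_ge0 ?ltW//.
rewrite sqrtrM ?sqr_ge0// sqrtr_sqr gtr0_norm// sqrtrV ?ltW// /inv_slope.
by field; rewrite !gt_eqF ?sqrtr_gt0.
Qed.

Lemma slope_mono (r s t : R) : 0 < r -> 0 < 1 - s ^+ 2 -> 0 < 1 - t ^+ 2 ->
  (slope r s <= slope r t) = (s <= t).
Proof.
move=> r0.
suff h : forall s t, 0 < 1 - s ^+ 2 -> 0 < 1 - t ^+ 2 -> s < t -> slope r s < slope r t.
  move=> s1 t1; case: (leP s t) => [|/(h _ _ t1 s1)]; last by rewrite leNgt => ->.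
  by rewrite le_eqVlt => /predU1P[->|/(h _ _ s1 t1)/ltW->//]; rewrite lexx.
move=> {}s {}t; rewrite !onem_sqr_gt0 => /andP[s1 s2] /andP[t1 t2] st.
have dP x : s <= x <= t -> 0 < 1 - x ^+ 2.
  by rewrite onem_sqr_gt0 => /andP[sx xt]; rewrite (lt_le_trans s1)//= (le_lt_trans xt).
have [x| |z zI E] := @MVT _ (slope r) (fun s => r * (1 - s ^+ 2) `^ (- 3 / 2)) s t st.
- rewrite in_itv/= => /andP[sx xt]; apply: is_derive_slope; apply: dP.
  by rewrite !ltW.
- apply: continuous_in_subspaceT => x; rewrite inE/= in_itv/= => /dP/(is_derive_slope r) h.
  by apply: differentiable_continuous; exact/derivable1_diffP/ex_derive.
rewrite -subr_gt0 E mulr_gt0 ?subr_gt0// mulr_gt0//.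
move: zI; rewrite in_itv/= => /andP[sz zt].
by apply: powR_gt0; apply: dP; rewrite !ltW.
Qed.

(** [slope r] increases from ]-1, 1[ onto the line and is a primitive of the density on the right.
    The image of that density therefore gives ]a, b] the mass b - a, and must be Lebesgue
    measure. *)
Lemma ge0_integral_slope (r : R) (g : R -> \bar R) : 0 < r ->
  measurable_fun setT g -> (forall x, 0 <= g x)%E ->
  (\int[mu]_a g a =
   \int[mu]_(s in `](- 1)%R, 1%R[) (g (slope r s) * (r * (1 - s ^+ 2) `^ (- 3 / 2))%:E))%E.
Proof.
move=> r0 mg g0.
pose h (s : R) := r * (1 - s ^+ 2) `^ (- 3 / 2).
have h0 s : 0 <= h s by rewrite mulr_ge0 ?powR_ge0// ltW.
have mh : measurable_fun setT h.
  by apply: measurable_funM => //; exact: measurable_onem_sqr_powR.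
(* The indicator discards the points where [1 - s ^+ 2] is not positive and the real power only has
   a default value. *)
pose k (s : R) := h s * \1_(`](- 1)%R, 1%R[%classic) s.
have k0 s : 0 <= k s by rewrite mulr_ge0.
have mk : measurable_fun setT k by apply: measurable_funM.
have [nu nuE] := density_measureP mu mk k0.
have [la [laE laI]] := @pushforwardP _ _ (measurableTypeR R) (measurableTypeR R)
  R nu (slope r) (measurable_slope r).
transitivity (\int[la]_a g a)%E; last first.
  rewrite laI//.
  have mgs : measurable_fun setT (g \o slope r).
    by apply: measurableT_comp => //; exact: measurable_slope.
  rewrite [LHS](@ge0_integral_density _ (measurableTypeR R) R mu k mk k0 nu
    (g \o slope r) (fun A _ => nuE A) mgs)//; last by move=> x; exact: g0.
  rewrite [RHS]integral_mkcond; apply: eq_integral => s _.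
  rewrite patchE /k indicE; case: ifPn => _; first by rewrite mulr1 muleC.
  by rewrite mulr0 mul0e.
apply/esym/eq_measure_integral => A mA _.
apply/esym/lebesgue_measure_unique => // _ [[a b] _ <-].
rewrite laE nuE.
have [ba|ab] := leP b a.
  rewrite lebesgue_measure_itv/= lte_fin ltNge ba/=.
  rewrite (_ : slope r @^-1` _ = set0) ?integral_set0//.
  apply/seteqP; split => s //=; rewrite in_itv/= => /andP[].
  by move=> /lt_le_trans/[apply]; rewrite ltNge ba.
(* The compact interval between the two preimages stays inside ]-1, 1[, where the fundamental
   theorem of calculus applies. *)
have iP s : inv_slope r a <= s <= inv_slope r b -> 0 < 1 - s ^+ 2.
    have := inv_slope_lt1 a r0; have := inv_slope_lt1 b r0.
    rewrite !onem_sqr_gt0 => /andP[b1 b2] /andP[a1 a2] /andP[sa sb].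
    by rewrite (lt_le_trans a1)//= (le_lt_trans sb).
transitivity (\int[mu]_(s in `[inv_slope r a, inv_slope r b]) (h s)%:E)%E; last first.
  rewrite -integral_itv_obnd_cbnd; last first.
    by apply/measurable_EFinP; exact: measurable_funTS.
  rewrite [LHS]integral_mkcond [RHS]integral_mkcond; apply: eq_integral => s _.
  rewrite !patchE /k indicE.
  have [s1|s1] := boolP (s \in `](- 1)%R, 1%R[%classic); last first.
    rewrite mulr0 [RHS](_ : _ = 0%E); last by case: ifP.
    case: ifPn => // /[1!inE]/= /[1!in_itv]/= /andP[s2 s3].
    by move: s1; rewrite notin_setE/= in_itv/= -onem_sqr_gt0 iP// s3 ltW.
  rewrite (mulr1 (h s)); congr (if _ then _ else _).
  move: s1; rewrite inE/= in_itv/= -onem_sqr_gt0 => s1.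
  apply/idP/idP; rewrite !inE/= !in_itv/= => /andP[sa sb]; apply/andP; split.
  - by rewrite ltNge -{1}(inv_slopeK a r0) slope_mono ?inv_slope_lt1// -ltNge.
  - by rewrite -{1}(inv_slopeK b r0) slope_mono ?inv_slope_lt1.
  - by rewrite ltNge -(slope_mono r0) ?inv_slope_lt1// inv_slopeK// -ltNge.
  - by rewrite -(slope_mono r0) ?inv_slope_lt1// inv_slopeK.
transitivity ((slope r (inv_slope r b))%:E - (slope r (inv_slope r a))%:E)%E; last first.
  apply/esym/continuous_FTC2_is_derive.
  - by rewrite -(slope_mono r0) ?inv_slope_lt1// !inv_slopeK// ltW.
  - by move=> s /iP; exact: is_derive_slope.
  - move=> s /iP s1; apply: cvgM; first exact: cvg_cst.
    exact: continuous_onem_sqr_powR.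
by rewrite !inv_slopeK// lebesgue_measure_itv/= lte_fin ab.
Qed.

End slope_substitution.

Lemma integral_indicT d (T : measurableType d) (R : realType)
    (m : {measure set T -> \bar R}) (B : set T) : measurable B ->
  (\int[m]_x (\1_B x)%:E = m B)%E.
Proof. by move=> mB; rewrite integral_indic// setIT. Qed.

Section surface_dotr.
Local Open Scope ereal_scope.
Context {R : realType}.
Local Notation mu := (@lebesgue_measure R).

Definition first_basis n : 'rV[R]_n.+1 := delta_mx ord0 ord0.

Lemma dotr_first_basis n (x : 'rV[R]_n.+1) : dotr x (first_basis n) = x ord0 ord0.
Proof.
rewrite dotrE (bigD1 ord0)//= mxE !eqxx mulr1 big1 ?addr0// => i i0.
by rewrite mxE (negbTE i0) andbF mulr0.
Qed.

Lemma enorm_first_basis n : enorm (first_basis n) = 1%R.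
Proof. by rewrite /enorm dotr_first_basis mxE !eqxx sqrtr1. Qed.

Lemma rV_cons0 n (a : measurableTypeR R) (v : 'rV[R]_n) :
  rV_cons (a, v) ord0 ord0 = a.
Proof. by rewrite mxE unlift_none. Qed.

Lemma enorm_rV_cons n (a : measurableTypeR R) (v : 'rV[R]_n) :
  enorm (rV_cons (a, v)) = Num.sqrt (a ^+ 2 + enorm v ^+ 2).
Proof.
rewrite sqr_enorm /enorm !dotrE big_ord_recl rV_cons0 -expr2.
by congr (Num.sqrt (_ + _)); apply: eq_bigr => i _; rewrite mxE liftK.
Qed.

(** For positive n, [n.+1] times this integral is the area of the unit sphere of R^n, the expected
    constant in front of the density of one coordinate. The factor [enorm y] is the one produced by
    the slope substitution. *)
Definition radial_moment n : \bar R :=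
  \int[@lebesgue_rV R n]_y (enorm y * \1_(@unit_ball R n) y)%:E.

Lemma measurable_enorm_id n : measurable_fun [set: 'rV[R]_n] (@enorm R n).
Proof. exact: measurable_enorm. Qed.

(** A dilation contributes n powers of [rho] through the volume and one more through the norm. *)
Lemma radial_moment_scale n (rho : R) : (0 < rho)%R ->
  \int[@lebesgue_rV R n]_y (enorm y * (enorm y <= rho)%R%:R)%:E =
  (rho ^+ n.+1)%:E * radial_moment n.
Proof.
move=> rho0.
have mf : measurable_fun setT (fun y : 'rV[R]_n => (enorm y * \1_(`]-oo, rho]%classic) (enorm y))%:E).
  apply/measurable_EFinP; apply: measurable_funM; first exact: measurable_enorm_id.
  by apply: measurableT_comp => //; exact: measurable_enorm_id.
have E (y : 'rV[R]_n) : (enorm y * (enorm y <= rho)%R%:R)%:E =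
    (enorm y * \1_(`]-oo, rho]%classic) (enorm y))%:E.
  by rewrite indicE; congr (_ * (nat_of_bool _)%:R)%:E; apply/idP/idP; rewrite inE/= in_itv.
under eq_integral do rewrite E.
rewrite -(ge0_integral_lebesgue_rV_affine 0%R rho0) => [|//|y]; last first.
  by rewrite lee_fin mulr_ge0 ?enorm_ge0.
rewrite exprSr EFinM -muleA; congr (_ * _).
rewrite -ge0_integralZl_EFin ?ltW//.
- apply: eq_integral => y _; rewrite addr0 enormZ gtr0_norm// -EFinM mulrA.
  rewrite !indicE; congr (_ * (nat_of_bool _)%:R)%:E; apply/idP/idP.
    by rewrite !inE/= in_itv/= /unit_ball/= ger_pMr.
  by rewrite !inE/= in_itv/= /unit_ball/= ger_pMr.
- by move=> y _; rewrite lee_fin mulr_ge0 ?enorm_ge0.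
- apply/measurable_EFinP; apply: measurable_funM; first exact: measurable_enorm_id.
  by apply: measurable_indic; exact: measurable_unit_ball.
Qed.

Lemma radial_moment_fin n : radial_moment n \is a fin_num.
Proof.
rewrite ge0_fin_numE; last first.
  by apply: integral_ge0 => y _; rewrite lee_fin mulr_ge0 ?enorm_ge0.
apply: le_lt_trans (lebesgue_rV_unit_ball_lty n).
rewrite -integral_indicT; last exact: measurable_unit_ball.
apply: ge0_le_integral => //.
- by move=> y _; rewrite lee_fin mulr_ge0 ?enorm_ge0.
- apply/measurable_EFinP; apply: measurable_funM; first exact: measurable_enorm_id.
  by apply: measurable_indic; exact: measurable_unit_ball.
- by apply/measurable_EFinP; apply: measurable_indic; exact: measurable_unit_ball.
- move=> y _; rewrite lee_fin indicE; case: (boolP (y \in _)) => [|_].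
    by rewrite inE /unit_ball/= mulr1.
  by rewrite mulr0.
Qed.

(** In dimension 0 the origin is the whole space and has mass 1. *)
Lemma lebesgue_rV_set0 n : (0 < n)%N -> @lebesgue_rV R n [set 0%R] = 0.
Proof.
move=> n0; rewrite (_ : [set 0%R] = @cube R n 0).
  by rewrite lebesgue_rV_cube// mul0rn expr0n gtn_eqF.
apply/seteqP; split => x /=; first by move=> -> i; rewrite mxE normr0.
by move=> x0; apply/rowP => i; apply/eqP; rewrite mxE -normr_le0 x0.
Qed.

(** Write a point of the cone as (a, v) and substitute a = [slope (enorm v) s], where s is the first
    coordinate of its direction. The cone becomes s in A and |v| <= (1 - s^2)^(1/2). Integrating |v|
    over that ball gives (1 - s^2)^((n + 1)/2), and the Jacobian (1 - s^2)^(-3/2) brings the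
    exponent to (n - 2)/2. *)
Lemma surface_measure_first_coord n (A : set R) : (0 < n)%N -> measurable A ->
  @surface_measure R n.+1 [set x | A (x ord0 ord0)] =
  \int[mu]_(s in `](- 1)%R, 1%R[)
    ((n.+1%:R * fine (radial_moment n)) * ((1 - s ^+ 2) `^ ((n.+1%:R - 3) / 2) * \1_A s))%:E.
Proof.
move=> n0 mA.
pose D : set 'rV[R]_n.+1 := normalize @^-1` [set x | A (x ord0 ord0)] `&` punctured_ball n.+1.
have mD : measurable D.
  apply: measurableI; last exact: measurable_punctured_ball.
  rewrite -[X in measurable X]setTI.
  have := @measurable_normalize R _ _ _ _ (@measurable_id _ 'rV[R]_n.+1 setT).
  apply => //; rewrite -[X in measurable X]setTI.
  by apply: (@measurable_coord R n.+1 ord0).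
rewrite /surface_measure -/D.
have -> : lebesgue_rV D = \int[@lebesgue_rV R n.+1]_x (\1_D x)%:E.
  by rewrite integral_indicT.
rewrite /lebesgue_rV ge0_integral_power_measureS2//; last first.
  by apply/measurable_EFinP; exact: measurable_indic.
(* The integrand after the substitution, Jacobian included. *)
pose B (v : 'rV[R]_n) (s : R) :=
  (\1_A s * (1 - s ^+ 2) `^ (- 3 / 2) * \1_(`](- 1)%R, 1%R[%classic) s *
   (enorm v * (enorm v <= (1 - s ^+ 2) `^ 2^-1)%R%:R))%R.
have B0 v s : (0 <= B v s)%R by rewrite !mulr_ge0 ?powR_ge0 ?enorm_ge0.
have mB : measurable_fun setT (fun z : measurableTypeR R * 'rV[R]_n => (B z.2 z.1)%:E).
  apply/measurable_EFinP; apply: measurable_funM; last apply: measurable_funM.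
  - apply: (@measurableT_comp _ _ _ _ _ _
      (fun s : R => \1_A s * (1 - s ^+ 2) `^ (- 3 / 2) * \1_(`](- 1)%R, 1%R[%classic) s)%R _
      (@fst (measurableTypeR R) 'rV[R]_n)) => //.
    apply: measurable_funM => //; apply: measurable_funM => //.
    exact: measurable_onem_sqr_powR.
  - by apply: measurable_enorm; exact: measurable_snd.
  - apply: (@measurableT_comp _ _ _ _ _ _ (fun b : bool => (b%:R : R)) _
      (fun z : measurableTypeR R * 'rV[R]_n => (enorm z.2 <= (1 - z.1 ^+ 2) `^ 2^-1)%R)) => //.
    apply: measurable_fun_ler; first by apply: measurable_enorm; exact: measurable_snd.
    apply: (@measurableT_comp _ _ _ _ _ _ (fun s : R => (1 - s ^+ 2) `^ 2^-1)%R _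
      (@fst (measurableTypeR R) 'rV[R]_n)) => //.
    exact: measurable_onem_sqr_powR.
have mDc : measurable_fun setT (fun z : measurableTypeR R * 'rV[R]_n => (\1_D (rV_cons z))%:E : \bar R).
  apply/measurable_EFinP; apply: measurableT_comp => //.
  exact: measurable_rV_cons.
transitivity (n.+1%:R%:E * \int[@lebesgue_rV R n]_v \int[mu]_s (B v s)%:E).
  congr (_ * _); apply: ge0_ae_eq_integral => //.
  - exact: (measurable_fun_fubini_tonelli_G (m1 := mu) _ mDc).
  - by apply: (measurable_fun_fubini_tonelli_G (m1 := mu) _ mB) => z; rewrite lee_fin.
  - by move=> v _; apply: integral_ge0 => a _; rewrite lee_fin.
  - by move=> v _; apply: integral_ge0 => a _; rewrite lee_fin.
  (* The substitution degenerates at v = 0, a null set because n is positive. *)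
  exists [set 0%R]; split.
  - rewrite (_ : [set 0%R] = @cube R n 0); first exact: measurable_cube.
    apply/seteqP; split => x /=; first by move=> -> i; rewrite mxE normr0.
    by move=> x0; apply/rowP => i; apply/eqP; rewrite mxE -normr_le0 x0.
  - exact: lebesgue_rV_set0.
  move=> v /=; apply: contra_notP => /eqP v0 _.
  have r0 : (0 < enorm v)%R by rewrite enorm_gt0.
  rewrite (@ge0_integral_slope _ (enorm v) 
    (fun a => (\1_D (rV_cons ((a : measurableTypeR R), v)))%:E))//; last first.
    by apply: (measurableT_comp mDc); exact: measurable_pair2.
  rewrite integral_mkcond; apply: eq_integral => s _.
  rewrite patchE /B [\1_(`]_, _[%classic) s]indicE.
  case: ifPn => s1; last by rewrite mulr0 mul0r.
  rewrite mulr1 -EFinM; congr EFin.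
  move: s1; rewrite inE/= in_itv/= -onem_sqr_gt0 => s1.
  have -> : \1_D (rV_cons ((slope (enorm v) s : measurableTypeR R), v)) =
      (\1_A s * (enorm v <= (1 - s ^+ 2) `^ 2^-1)%R%:R)%R :> R.
    rewrite !indicE -natrM mulnb; congr (nat_of_bool _)%:R.
    have E : (enorm (rV_cons ((slope (enorm v) s : measurableTypeR R), v)) =
        enorm v * (1 - s ^+ 2) `^ (- 2^-1))%R by rewrite enorm_rV_cons slope_norm.
    have F : (normalize (rV_cons ((slope (enorm v) s : measurableTypeR R), v)) ord0 ord0 = s)%R.
      by rewrite mxE rV_cons0 enorm_rV_cons mulrC slope_direction.
    (* The point has norm |v| (1 - s^2)^(-1/2), so membership in the punctured ball is a bound on
       |v|. *)
    have G : (0 < enorm v * (1 - s ^+ 2) `^ (- 2^-1) <= 1)%R =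
        (enorm v <= (1 - s ^+ 2) `^ 2^-1)%R.
      rewrite mulr_gt0 ?powR_gt0//= powRN ler_pdivrMr ?mul1r//.
      exact: powR_gt0.
    apply/idP/idP.
      by rewrite inE /D /punctured_ball/= E F G => -[As ->]; rewrite andbT inE.
    by move=> /andP[]; rewrite !inE /D /punctured_ball/= E F G.
  ring.
rewrite -(fubini_tonelli (m1 := mu) (m2 := @lebesgue_rV R n)
  (fun z : measurableTypeR R * 'rV[R]_n => (B z.2 z.1)%:E))//; last first.
  by move=> z; rewrite lee_fin.
rewrite -ge0_integralZl_EFin//; last 2 first.
- by move=> s _; apply: integral_ge0 => v _; rewrite lee_fin.
- by apply: (measurable_fun_fubini_tonelli_F (m2 := @lebesgue_rV R n) _ mB) => z; rewrite lee_fin.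
rewrite [RHS]integral_mkcond; apply: eq_integral => s _.
rewrite patchE /B /=; case: ifPn => s1; last first.
  rewrite integral0_eq ?mule0// => v _.
  by rewrite [\1_(`]_, _[%classic) s]indicE (negbTE s1) mulr0 mul0r.
rewrite [\1_(`]_, _[%classic) s]indicE s1.
move: s1; rewrite inE/= in_itv/= -onem_sqr_gt0 => s1.
under eq_integral do rewrite EFinM.
rewrite ge0_integralZl_EFin//; last 3 first.
- by move=> v _; rewrite lee_fin mulr_ge0 ?enorm_ge0.
- apply/measurable_EFinP; apply: measurable_funM; first exact: measurable_enorm_id.
  apply: (@measurableT_comp _ _ _ _ _ _ (fun b : bool => (b%:R : R)) _
      (fun z : 'rV[R]_n => (enorm z <= (1 - s ^+ 2) `^ 2^-1)%R)) => //.
  by apply: measurable_fun_ler => //; exact: measurable_enorm_id.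
- by rewrite !mulr_ge0 ?powR_ge0.
rewrite radial_moment_scale ?powR_gt0//.
rewrite -(fineK (radial_moment_fin n)) -!EFinM; congr EFin.
rewrite -[(_ `^ _ ^+ n.+1)%R]powR_mulrn ?powR_ge0// -powRrM.
have -> : ((1 - s ^+ 2) `^ ((n.+1%:R - 3) / 2) =
  (1 - s ^+ 2) `^ (- 3 / 2) * (1 - s ^+ 2) `^ (2^-1 * n.+1%:R))%R.
  rewrite -powRD; first by congr powR; lra.
  by rewrite (gt_eqF s1) implybT.
ring.
Qed.

(** A reflection carries [theta] to the first basis vector. The constant stays abstract because it
    cancels against the normalization of the density. *)
Lemma surface_measure_dotr n (theta : 'rV[R]_n) : (1 < n)%N -> enorm theta = 1%R ->
  exists2 J : R, (0 <= J)%R & forall A : set R, measurable A ->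
  @surface_measure R n [set x | A (dotr x theta)] =
  \int[mu]_(s in `](- 1)%R, 1%R[)
    (J * ((1 - s ^+ 2) `^ ((n%:R - 3) / 2) * \1_A s))%:E.
Proof.
case: n theta => [|n] theta //; rewrite ltnS => n0 theta1.
exists (n.+1%:R * fine (radial_moment n))%R.
  rewrite mulr_ge0// fine_ge0//.
  by apply: integral_ge0 => y _; rewrite lee_fin mulr_ge0 ?enorm_ge0.
move=> A mA; rewrite -surface_measure_first_coord//.
have mS : measurable [set x : 'rV[R]_n.+1 | A (dotr x theta)].
  have := @measurable_dotr R n.+1 _ _ id (cst theta) (@measurable_id _ _ _) (@measurable_cst _ _ _ _ _ _).
  move=> /(_ measurableT _ mA); rewrite setTI; exact.
rewrite -(surface_measure_reflect (theta - first_basis n))//.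
congr surface_measure; apply/seteqP; split => x /=;
  by rewrite dotr_reflectl reflect_swap ?enorm_first_basis// dotr_first_basis.
Qed.

End surface_dotr.

(** * Rotationally symmetric laws *)

Section rotationally_symmetric_law.
Context {R : realType}.
Local Notation mu := (@lebesgue_measure R).
Variables (p : nat) (theta : 'rV[R]_p) (kappa : R) (f : R -> R).
Hypotheses (p2 : (1 < p)%N) (theta1 : enorm theta = 1).
Hypotheses (f0 : forall x, 0 <= f x) (mf : measurable_fun setT f).
Context d (T : measurableType d) (P : probability T R).
Variable X : {RV P >-> 'rV[R]_p}.
Hypothesis X1 : forall w, enorm (X w) = 1.
Hypothesis lawX : forall B, measurable B -> distribution P X B =
  (\int[surface_measure (p:=p)]_(x in B) (sphere_density theta kappa f x)%:E)%E.

(** Only the sign of the normalizing constant is retained; total mass 1 later determines every ratio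
    in which it enters. *)
Let density_coef : exists2 c, 0 <= c &
  forall x, sphere_density theta kappa f x = c * f (kappa * dotr x theta).
Proof.
eexists; last by move=> x; reflexivity.
rewrite !mulr_ge0//.
- rewrite /norm_const invr_ge0; apply: Rintegral_ge0 => s _.
  by rewrite mulr_ge0 ?powR_ge0.
- by apply: Rintegral_ge0 => s _; rewrite mulr_ge0 ?powR_ge0 ?expR_ge0.
- by rewrite invr_ge0 mulr_ge0 ?powR_ge0.
Qed.

Let density_ge0 x : 0 <= sphere_density theta kappa f x.
Proof. by have [c c0 ->] := density_coef; rewrite mulr_ge0. Qed.

Let measurable_dotr_theta : measurable_fun setT (fun x : 'rV[R]_p => dotr x theta).
Proof. exact: (@measurable_dotr R p _ _ id (cst theta)). Qed.

Let measurable_density : measurable_fun setT (sphere_density theta kappa f).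
Proof.
have [c _ cE] := density_coef.
have -> : sphere_density theta kappa f = fun x => c * f (kappa * dotr x theta).
  exact/funext.
apply: measurable_funM => //; apply: measurableT_comp => //.
exact: measurable_funM.
Qed.

Let ge0_expectation (g : 'rV[R]_p -> \bar R) : measurable_fun setT g ->
  (forall x, 0 <= g x)%E ->
  (\int[P]_w g (X w) =
   \int[surface_measure (p:=p)]_x ((sphere_density theta kappa f x)%:E * g x))%E.
Proof.
move=> mg g0; rewrite -[LHS](ge0_integral_distribution X mg g0).
exact: (ge0_integral_density measurable_density density_ge0).
Qed.

Lemma ge0_integral_surface_reflect (u : 'rV[R]_p) (g : 'rV[R]_p -> \bar R) :
  measurable_fun setT g -> (forall x, 0 <= g x)%E ->
  (\int[surface_measure (p:=p)]_x g (reflect u x) = \int[surface_measure (p:=p)]_x g x)%E.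
Proof.
move=> mg g0.
have [nu [nuE nuI]] := pushforwardP (surface_measure (p:=p)) (measurable_reflect u).
rewrite -nuI//; apply: eq_measure_integral => A mA _.
by rewrite [LHS]nuE; exact: surface_measure_reflect.
Qed.

Lemma ge0_expectation_reflect (u : 'rV[R]_p) (g : 'rV[R]_p -> \bar R) :
  dotr u theta = 0 -> measurable_fun setT g -> (forall x, 0 <= g x)%E ->
  (\int[P]_w g (reflect u (X w)) = \int[P]_w g (X w))%E.
Proof.
move=> utheta mg g0; rewrite [RHS]ge0_expectation//.
rewrite -(ge0_integral_surface_reflect u); last 2 first.
- by apply: emeasurable_funM => //; exact/measurable_EFinP.
- by move=> x; rewrite mule_ge0// lee_fin.
rewrite (@ge0_expectation (g \o reflect u))//; last 2 first.
- by apply: measurableT_comp => //; exact: measurable_reflect.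
- by move=> x; exact: g0.
apply: eq_integral => x _; congr (_%:E * _)%E.
by rewrite /sphere_density dotr_reflectl (@reflect_orth _ _ u theta) 1?dotrC.
Qed.

Lemma expectation_dotr_theta : exists C : R, forall g : R -> R,
  measurable_fun setT g -> (forall x, 0 <= g x) ->
  (\int[P]_w (g (dotr (X w) theta))%:E =
   \int[mu]_(s in `[(- 1)%R, 1%R])
     (C * ((1 - s ^+ 2) `^ ((p%:R - 3) / 2) * f (kappa * s) * g s))%:E)%E.
Proof.
have [c c0 cE] := density_coef.
have [J J0 JE] := surface_measure_dotr p2 theta1.
exists (c * J) => g mg g0.
have mgt : measurable_fun setT (fun x : 'rV[R]_p => (g (dotr x theta))%:E).
  by apply/measurable_EFinP; apply: measurableT_comp.
rewrite (ge0_expectation mgt); last by move=> x; rewrite lee_fin.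
have mfk : measurable_fun setT (fun s => f (kappa * s)).
  by apply: measurableT_comp => //; exact: measurable_funM.
pose G (t : R) := (c * f (kappa * t) * g t)%:E.
have mG : measurable_fun setT G.
  apply/measurable_EFinP; apply: measurable_funM => //.
  exact: (measurable_funM (measurable_cst _) mfk).
have G0 t : (0 <= G t)%E by rewrite lee_fin !mulr_ge0.
have [nu [nuE nuI]] := @pushforwardP _ _ _ (measurableTypeR R) R
  (surface_measure (p:=p)) _ measurable_dotr_theta.
transitivity (\int[nu]_t G t)%E; first by rewrite nuI//; apply: eq_integral => x _; rewrite cE -EFinM.
pose h (s : R) := J * (1 - s ^+ 2) `^ ((p%:R - 3) / 2) * \1_(`](- 1)%R, 1%R[%classic) s.
have mh : measurable_fun setT h.
  apply: measurable_funM => //; apply: measurable_funM => //.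
  exact: measurable_onem_sqr_powR.
have h0 s : 0 <= h s by rewrite !mulr_ge0 ?powR_ge0.
rewrite (@ge0_integral_density _ (measurableTypeR R) R mu h mh h0 nu G)//; last first.
  move=> A mA; rewrite nuE [LHS]JE// [LHS]integral_mkcond [RHS]integral_mkcond.
  apply: eq_integral => s _; rewrite !patchE /h !indicE.
  case: (s \in A); case: (s \in _); congr EFin; rewrite /=; ring.
rewrite [RHS]integral_itv_bndoo; last first.
  apply/measurable_EFinP/measurable_funTS; apply: measurable_funM => //.
  apply: measurable_funM => //; apply: measurable_funM.
    exact: measurable_onem_sqr_powR.
  by apply: measurableT_comp => //; exact: measurable_funM.
rewrite [RHS]integral_mkcond; apply: eq_integral => s _.
rewrite patchE /h /G indicE -EFinM.
by case: (s \in _); congr EFin; rewrite /=; ring.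
Qed.

Let measurable_dotrX (y : 'rV[R]_p) : measurable_fun setT (fun w => dotr y (X w)).
Proof. exact: (@measurable_dotr R p _ _ (cst y) X). Qed.

(** The reflection along y fixes [theta] and sends y to - y, hence exchanges the positive and
    negative parts of y'X. *)
Lemma expectation_dotr_eq0 (y : 'rV[R]_p) : dotr y theta = 0 ->
  \int[P]_w dotr y (X w) = 0.
Proof.
move=> ytheta; rewrite /Rintegral integralE.
suff -> : (\int[P]_w ((fun w => (dotr y (X w))%:E)^\+ w) =
    \int[P]_w ((fun w => (dotr y (X w))%:E)^\- w))%E.
  (* Equal parts cancel even if infinite, since [fine] sends the resulting infinite value to 0. *)
  by set I := (\int[P]_x _)%E; case: I => [r| |]//=; rewrite subrr.
pose g (x : 'rV[R]_p) := (Num.max (dotr y x) 0)%:E.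
have mg : measurable_fun setT g.
  apply/measurable_EFinP; apply: measurable_maxr => //.
  exact: (@measurable_dotr R p _ _ (cst y) id).
have g0 x : (0 <= g x)%E by rewrite lee_fin le_max lexx orbT.
transitivity (\int[P]_w g (X w))%E; first by apply: eq_integral => w _; rewrite funeposE /g EFin_max.
rewrite -(ge0_expectation_reflect ytheta mg g0).
apply: eq_integral => w _; rewrite funenegE /g -dotr_reflectl reflect_self dotrNl.
by rewrite EFin_max.
Qed.

Let measurable_dotr_sqr (y : 'rV[R]_p) : measurable_fun setT (fun w => dotr y (X w) ^+ 2).
Proof. exact: measurable_funX. Qed.

(** The reflection along z - |z| y fixes [theta] and exchanges z with |z| y, so this second moment
    depends only on the length. *)
Let expectation_dotr_sqr_unit (y z : 'rV[R]_p) :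
  dotr y theta = 0 -> dotr z theta = 0 -> enorm y = 1 ->
  (\int[P]_w (dotr z (X w) ^+ 2)%:E =
   (enorm z ^+ 2)%:E * \int[P]_w (dotr y (X w) ^+ 2)%:E)%E.
Proof.
move=> yt zt y1.
pose y' := enorm z *: y.
have y't : dotr y' theta = 0 by rewrite dotrZl yt mulr0.
have zy' : enorm z = enorm y' by rewrite enormZ y1 mulr1 ger0_norm ?enorm_ge0.
rewrite -ge0_integralZl_EFin//; last 3 first.
- by move=> w _; rewrite lee_fin sqr_ge0.
- exact/measurable_EFinP.
- by rewrite sqr_ge0.
have mg : measurable_fun setT (fun x : 'rV[R]_p => (dotr z x ^+ 2)%:E).
  by apply/measurable_EFinP; apply: measurable_funX; exact: (@measurable_dotr R p _ _ (cst z) id).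
have g0 x : (0 <= (dotr z x ^+ 2)%:E)%E by rewrite lee_fin sqr_ge0.
have zyt : dotr (z - y') theta = 0 by rewrite dotrBl zt y't subrr.
rewrite -[LHS](ge0_expectation_reflect zyt mg g0).
apply: eq_integral => w _; rewrite -dotr_reflectl reflect_swap//.
by rewrite dotrZl exprMn EFinM.
Qed.

Definition tangent (x : 'rV[R]_p) := x - dotr x theta *: theta.

Lemma tangent_orth x : dotr (tangent x) theta = 0.
Proof. by rewrite dotrBl dotrZl -sqr_enorm theta1 expr1n mulr1 subrr. Qed.

Lemma tangent_sym x y : dotr (tangent x) y = dotr x (tangent y).
Proof.
by rewrite dotrBl dotrBr dotrZl dotrZr (dotrC theta y) (mulrC (dotr x _)).
Qed.

Lemma sqr_enorm_tangent x : enorm (tangent x) ^+ 2 = enorm x ^+ 2 - dotr x theta ^+ 2.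
Proof.
by rewrite !sqr_enorm -{2}[tangent x]/(x - _) dotrBr dotrZr tangent_orth mulr0 subr0
  dotrBl dotrZl (dotrC theta) expr2.
Qed.

(** In place of an orthonormal basis of the orthogonal of [theta], the projections of the canonical
    basis are used: their squared lengths sum to p - 1, and the squares of their products with X sum
    to |tangent X|^2 = 1 - (X'theta)^2. *)
Lemma expectation_dotr_sqr (y : 'rV[R]_p) : dotr y theta = 0 ->
  ((p.-1%:R)%:E * \int[P]_w (dotr y (X w) ^+ 2)%:E =
  (enorm y ^+ 2)%:E * \int[P]_w (1 - dotr (X w) theta ^+ 2)%:E)%E.
Proof.
move=> yt; have [->|y0] := eqVneq y 0.
  under eq_integral do rewrite dot0r expr0n/=.
  by rewrite integral0 mule0 sqr_enorm dot0r mul0e.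
pose u := (enorm y)^-1 *: y.
have u1 : enorm u = 1 by rewrite enormZ gtr0_norm ?invr_gt0 ?enorm_gt0// mulVf// enorm_eq0.
have ut : dotr u theta = 0 by rewrite dotrZl yt mulr0.
rewrite (expectation_dotr_sqr_unit ut yt u1) muleCA; congr (_ * _)%E.
pose e (i : 'I_p) : 'rV[R]_p := delta_mx ord0 i.
have dote (i : 'I_p) (x : 'rV[R]_p) : dotr x (e i) = x ord0 i.
  rewrite dotrE (bigD1 i)//= mxE !eqxx mulr1 big1 ?addr0// => j ji.
  by rewrite mxE (negbTE ji) andbF mulr0.
have sume (x : 'rV[R]_p) : \sum_(i < p) dotr x (e i) ^+ 2 = enorm x ^+ 2.
  by rewrite sqr_enorm dotrE; apply: eq_bigr => i _; rewrite dote expr2.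
transitivity (\int[P]_w (\sum_(i < p) (dotr (tangent (e i)) (X w) ^+ 2)%:E))%E; last first.
  apply: eq_integral => w _; rewrite sumEFin; congr EFin.
  rewrite -[1](expr1n _ 2) -(X1 w) -sqr_enorm_tangent -sume; apply: eq_bigr => i _.
  by rewrite tangent_sym dotrC.
rewrite ge0_integral_sum//; last 2 first.
- by move=> i; exact/measurable_EFinP.
- by move=> i w _; rewrite lee_fin sqr_ge0.
have tt i : dotr (tangent (e i)) theta = 0 by rewrite tangent_orth.
under eq_bigr => i _ do rewrite (expectation_dotr_sqr_unit ut (tt i) u1).
rewrite -ge0_sume_distrl; last by move=> i _; rewrite lee_fin sqr_ge0.
congr (_ * _)%E; rewrite sumEFin; congr EFin.
under eq_bigr => i _ do rewrite sqr_enorm_tangent.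
rewrite sumrB; under [X in _ - X]eq_bigr => i _ do rewrite dotrC.
rewrite sume theta1 expr1n.
under eq_bigr => i _ do rewrite sqr_enorm dote mxE !eqxx.
rewrite sumr_const card_ord; apply/esym; rewrite -subn1 natrB//.
exact: ltnW.
Qed.

End rotationally_symmetric_law.

(** * Partial sums of independent vectors *)

Section independence.
Local Open Scope ereal_scope.
Context {R : realType} d (T : measurableType d) (P : probability T R).
Variables (n p : nat) (X : 'I_n -> {RV P >-> 'rV[R]_p}).
Hypothesis indepX : mutually_independent X.
Variable phi : 'rV[R]_p -> 'rV[R]_p.
Hypothesis mphi : measurable_fun setT phi.

Definition partial_sum (k : nat) (w : T) : 'rV[R]_p :=
  (\sum_(i < n | (i < k)%N) phi (X i w))%R.

Lemma measurable_partial_sum k : measurable_fun setT (partial_sum k).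
Proof.
apply/measurable_fun_coordP => j.
under eq_fun do rewrite /partial_sum summxE -big_filter.
apply: measurable_sum => i.
have /measurable_fun_coordP := measurableT_comp mphi (@measurable_funPT _ _ _ _ (X i)).
exact.
Qed.

Lemma partial_sum0 w : partial_sum 0 w = 0%R.
Proof. by rewrite /partial_sum big1. Qed.

Lemma partial_sumS (k : 'I_n) w :
  partial_sum k.+1 w = (partial_sum k w + phi (X k w))%R.
Proof.
rewrite /partial_sum (bigD1 k)//= addrC; congr +%R.
by apply: eq_bigl => i; rewrite ltnS ltn_neqAle andbC.
Qed.

Let event (J : {set 'I_n}) (B : 'I_n -> set 'rV[R]_p) : set T :=
  \bigcap_(i in [set` J]) (X i @^-1` B i).

Let measurable_event J B : (forall i, measurable (B i)) -> measurable (event J B).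
Proof.
move=> mB; apply: fin_bigcap_measurable; first exact: finite_finset.
by move=> i _; rewrite -[X in measurable X]setTI; exact: measurable_funPT.
Qed.

Let partial_sum_law k : exists m : probability 'rV[R]_p R,
  forall A, m A = P (partial_sum k @^-1` A).
Proof.
pose mx := isMeasurableFun.Build _ _ _ _ (partial_sum k) (@measurable_partial_sum k).
pose S : {RV P >-> 'rV[R]_p} := HB.pack (partial_sum k) mx.
by exists (distribution P S).
Qed.

(** Given the event, the normalized law of (S_k, X_k) agrees with a product measure on rectangles,
    hence on all measurable sets. This admits the set where S_k + phi(X_k) lies in A, which is not a
    rectangle. *)
Let rect_indep (k : 'I_n) (J : {set 'I_n}) (B : 'I_n -> set 'rV[R]_p) :
  (forall (A C : set 'rV[R]_p), measurable A -> measurable C ->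
    P (partial_sum k @^-1` A `&` X k @^-1` C `&` event J B) =
    P (partial_sum k @^-1` A) * P (X k @^-1` C) * \prod_(i in J) P (X i @^-1` B i)) ->
  (forall i, measurable (B i)) ->
  exists m : probability 'rV[R]_p R, (forall A, m A = P (partial_sum k @^-1` A)) /\
  forall Z, measurable Z ->
    P ((fun w => (partial_sum k w, X k w)) @^-1` Z `&` event J B) =
    (m \x distribution P (X k)) Z * \prod_(i in J) P (X i @^-1` B i).
Proof.
move=> rect mB; have [m mE] := partial_sum_law k.
exists m; split => // Z mZ.
have mE' := measurable_event J mB.
have prodE : \prod_(i in J) P (X i @^-1` B i) = P (event J B) by rewrite -indepX.
have mSX : measurable_fun setT (fun w => (partial_sum k w, X k w)).
  by apply: measurable_fun_pair => //; exact: measurable_partial_sum.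
have mW (W : set ('rV[R]_p * 'rV[R]_p)) : measurable W ->
    measurable ((fun w => (partial_sum k w, X k w)) @^-1` W).
  by move=> mW; rewrite -[X in measurable X]setTI; exact: mSX.
move: rect; rewrite prodE; set E := event J B => rect.
(* A null event cannot be normalized, but then both sides are 0. *)
have [E0|E0] := eqVneq (P E) 0.
  rewrite E0 mule0; apply/eqP; rewrite eq_le measure_ge0 andbT -E0.
  by apply: le_measure; rewrite ?inE//; apply: measurableI => //; exact: mW.
have Efin : P E \is a fin_num by exact: fin_num_measure.
have Egt0 : (0 < fine (P E))%R.
  by rewrite fine_gt0// lt0e E0 measure_ge0/= -ge0_fin_numE.
pose c := NngNum (ltW (eqbRL (invr_gt0 _) Egt0)).
have [nu [nuE _]] := pushforwardP (mrestr P mE') mSX.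
pose M : {measure set ('rV[R]_p * 'rV[R]_p) -> \bar R} := mscale c nu.
have ME W : M W = (fine (P E))^-1%:E * P ((fun w => (partial_sum k w, X k w)) @^-1` W `&` E).
  by rewrite -[LHS]/((fine (P E))^-1%:E * nu W) nuE.
have fPE : (fine (P E) != 0)%R by rewrite gt_eqF.
rewrite (@product_measure_unique _ _ _ _ _ m (distribution P (X k)) M)//.
  by rewrite ME -{2}(fineK Efin) muleAC -EFinM mulVf// mul1e.
move=> A C mA mC; rewrite ME.
rewrite -[(fun w => _) @^-1` _]/(partial_sum k @^-1` A `&` X k @^-1` C) rect//.
rewrite -{2}(fineK Efin) muleCA -EFinM mulVf// mule1.
congr (_ * _); exact: esym (mE A).
Qed.

(** Carrying arbitrary events of the variables of index at least k closes the induction: at each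
    step X_k leaves the events and enters the sum. *)
Let event_indep k (J : {set 'I_n}) (B : 'I_n -> set 'rV[R]_p) A :
  (forall i, i \in J -> (k <= i)%N) ->
  (forall i, measurable (B i)) -> measurable A ->
  P (partial_sum k @^-1` A `&` event J B) =
  P (partial_sum k @^-1` A) * \prod_(i in J) P (X i @^-1` B i).
Proof.
elim: k J B A => [|k IH] J B A kJ mB mA.
  rewrite -indepX// -/(event J B).
  have -> : partial_sum 0 = cst 0%R by apply/funext => w; rewrite partial_sum0.
  rewrite preimage_cst; case: ifPn => _; first by rewrite setTI probability_setT mul1e.
  by rewrite set0I measure0 mul0e.
(* Past n the partial sums are constant. *)
have [kn|nk] := ltnP k n; last first.
  have -> : partial_sum k.+1 = partial_sum k.
    apply/funext => w; apply: eq_bigl => i.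
    by rewrite !(leq_trans (ltn_ord i)) // leqW.
  by apply: IH => // i /kJ; exact: ltnW.
pose o := Ordinal kn.
have oJ : o \notin J by apply/negP => /kJ; rewrite /= ltnn.
have rect (J' : {set 'I_n}) B' : (forall i, i \in J' -> (k < i)%N) ->
    (forall i, measurable (B' i)) ->
    forall (A C : set 'rV[R]_p), measurable A -> measurable C ->
    P (partial_sum o @^-1` A `&` X o @^-1` C `&` event J' B') =
    P (partial_sum o @^-1` A) * P (X o @^-1` C) * \prod_(i in J') P (X i @^-1` B' i).
  move=> kJ' mB' A' C mA' mC.
  have oJ' : o \notin J' by apply/negP => /kJ'; rewrite /= ltnn.
  pose B1 i := if i == o then C else B' i.
  have B1E i : i \in J' -> B1 i = B' i.
    by rewrite /B1; case: eqVneq => // ->; rewrite (negbTE oJ').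
  have B1o : B1 o = C by rewrite /B1 eqxx.
  have := IH (o |: J') B1 A'.
  rewrite big_setU1//= B1o (eq_bigr (fun i => P (X i @^-1` B' i))); last first.
    by move=> i /B1E ->.
  rewrite -muleA => <-//.
  - congr (P _); rewrite -setIA; congr (_ `&` _); apply/seteqP; split => w.
      move=> [Xo XJ] i /=; rewrite !inE => /orP[/eqP ->|iJ]; first by rewrite B1o.
      by rewrite B1E//; exact: XJ.
    move=> XJ; split; first by rewrite -B1o; apply: (XJ o); rewrite /= !inE eqxx.
    by move=> i /= iJ; rewrite -B1E//; apply: XJ; rewrite /= !inE iJ orbT.
  - by move=> i; rewrite !inE => /orP[/eqP ->//|/kJ' /ltnW].
  - by move=> i; rewrite /B1; case: ifP.
have [m [mE mP]] := rect_indep (rect J B kJ mB) mB.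
have noset0 (i : 'I_n) : i \in finset.set0 -> (k < i)%N by rewrite finset.in_set0.
(* The same product formula without any event evaluates the probability that S_(k+1) lies in A. *)
have [m' [mE' mP']] := rect_indep (rect finset.set0 (fun=> setT) noset0 (fun=> measurableT))
  (fun=> measurableT).
pose Z := (fun z : 'rV[R]_p * 'rV[R]_p => (z.1 + phi z.2)%R) @^-1` A.
have mZ : measurable Z.
  rewrite -[X in measurable X]setTI; apply: measurable_funD_rV => //.
  by apply: measurableT_comp => //; exact: measurable_snd.
have SE : partial_sum k.+1 @^-1` A = (fun w => (partial_sum o w, X o w)) @^-1` Z.
  by apply/seteqP; split => w; rewrite /Z /= (partial_sumS o).
rewrite SE mP//; congr (_ * _).
have := mP' _ mZ; rewrite big_set0 mule1.
have -> : event finset.set0 (fun=> setT) = setT by apply/seteqP; split => // w _ i /=; rewrite inE.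
rewrite setIT => ->.
apply: product_measure_unique => // A' C mA' mC.
transitivity (m' A' * distribution P (X o) C); first exact: product_measure1E.
by congr (_ * _); rewrite mE'; exact: esym (mE A').
Qed.

(** Independence in the form required by the exchange: the new summand is integrated out with the
    partial sum frozen. *)
Lemma expectation_partial_sum (k : 'I_n) (F : 'rV[R]_p -> 'rV[R]_p -> \bar R) :
  measurable_fun setT (fun z : 'rV[R]_p * 'rV[R]_p => F z.1 z.2) ->
  (forall x y, 0 <= F x y) ->
  \int[P]_w F (partial_sum k w) (X k w) =
  \int[P]_w \int[P]_w' F (partial_sum k w) (X k w').
Proof.
move=> mF F0.
have mSX : measurable_fun setT (fun w => (partial_sum k w, X k w)).
  by apply: measurable_fun_pair => //; exact: measurable_partial_sum.
have [nu [nuE nuI]] := pushforwardP P mSX.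
rewrite -(nuI (fun z => F z.1 z.2))//.
have [m mE] := partial_sum_law k.
have [m' [m'E m'I]] := pushforwardP P (@measurable_partial_sum k).
transitivity (\int[m \x distribution P (X k)]_z F z.1 z.2).
  apply: eq_measure_integral => Z mZ _; apply/esym.
  apply: product_measure_unique => // A C mA mC.
  rewrite nuE; transitivity (P (partial_sum k @^-1` A) * P (X k @^-1` C)); last first.
    by congr (_ * _); exact: esym (mE A).
  pose B i := if i == k then C else setT.
  have := @event_indep k [set k] B A.
  rewrite big_set1 /B eqxx => <-//.
  - congr (P _); apply/seteqP; split => w /= [wA wC]; split => //.
      by move=> i /=; rewrite inE => /eqP ->; rewrite eqxx.
    by have := wC k; rewrite /= eqxx; apply; rewrite inE.
  - by move=> i; rewrite inE => /eqP ->.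
  - by move=> i; case: ifP.
rewrite (fubini_tonelli1 (fun z => F z.1 z.2))//.
pose G x := \int[P]_w' F x (X k w').
have GE x : \int[distribution P (X k)]_y F x y = G x.
  apply: ge0_integral_distribution => //.
  exact: (measurableT_comp mF (measurable_pair1 x)).
rewrite /fubini_F /=; under eq_integral do rewrite GE.
transitivity (\int[m']_x G x).
  by apply: eq_measure_integral => A mA _; rewrite m'E; exact: mE.
rewrite m'I//.
- have -> : G = fubini_F (distribution P (X k)) (fun z => F z.1 z.2).
    by apply/funext => x; rewrite /fubini_F /= GE.
  by apply: measurable_fun_fubini_tonelli_F => // z; exact: F0.
- by move=> x; exact: integral_ge0.
Qed.

End independence.

(** * Gaussian smoothing of the Laplace transform *)

Section taylor_bounds.
Context {R : realType}.

Lemma is_derive_expR_comp (g : R -> R) (x dg : R) : is_derive x 1 g dg ->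
  is_derive x 1 (fun t => expR (g t)) (expR (g x) * dg).
Proof.
move=> h; exact: (@is_derive1_comp R (@expR R) g x _ _ (is_derive_expR (g x)) h).
Qed.

Lemma le0_is_derive (r dr : R -> R) (v : R) :
  (forall t, 0 <= t <= v -> is_derive t 1 r (dr t)) ->
  (forall t, 0 <= t <= v -> dr t <= 0) -> r 0 <= 0 ->
  forall t, 0 <= t <= v -> r t <= 0.
Proof.
move=> hr dr0 r0 t /andP[t0 tv].
move: t0; rewrite le_eqVlt => /predU1P[<-//|t0].
have [z| |z] := @MVT _ r dr 0 t t0.
- rewrite in_itv/= => /andP[z0 zt]; apply: hr.
  by rewrite ltW//= (le_trans (ltW zt)).
- apply: continuous_in_subspaceT => z; rewrite inE/= in_itv/= => /andP[z0 zt].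
  have h : is_derive z 1 r (dr z) by apply: hr; rewrite z0 (le_trans zt).
  by apply: differentiable_continuous; exact/derivable1_diffP/ex_derive.
rewrite in_itv/= => /andP[z0 zt] E.
rewrite -(subrK (r 0) (r t)) E -[leRHS]addr0 lerD//.
rewrite mulr_le0_ge0//; last by rewrite subr0 ltW.
by apply: dr0; rewrite ltW//= (le_trans (ltW zt)).
Qed.

Lemma taylor2_bound (g g1 g2 : R -> R) (v C : R) : 0 <= v ->
  (forall t, 0 <= t <= v -> is_derive t 1 g (g1 t)) ->
  (forall t, 0 <= t <= v -> is_derive t 1 g1 (g2 t)) ->
  (forall t, 0 <= t <= v -> `|g2 t| <= C) ->
  `|g v - (g 0 + v * g1 0)| <= C * v ^+ 2.
Proof.
move=> v0.
suff h (g' g1' g2' : R -> R) : (forall t, 0 <= t <= v -> is_derive t 1 g' (g1' t)) ->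
  (forall t, 0 <= t <= v -> is_derive t 1 g1' (g2' t)) ->
  (forall t, 0 <= t <= v -> `|g2' t| <= C) ->
  g' v - (g' 0 + v * g1' 0) <= C * v ^+ 2.
  move=> hg hg1 hg2; rewrite ler_norml h// andbT lerNl.
  have := h (fun t => - g t) (fun t => - g1 t) (fun t => - g2 t).
  rewrite mulrN -opprD -opprD; apply => t tv.
  - by apply: is_deriveN; exact: hg.
  - by apply: is_deriveN; exact: hg1.
  - by rewrite normrN; exact: hg2.
move=> hg hg1 hg2; rewrite -subr_le0.
have C0 : 0 <= C by apply: le_trans (hg2 0 _) => //; rewrite lexx v0.
have vv : 0 <= v <= v by rewrite v0 lexx.
have h1 := @le0_is_derive (fun t => g1' t - g1' 0 - 2 * C * t) (fun t => g2' t - 2 * C) v.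
have {}h1 : forall t, 0 <= t <= v -> g1' t - g1' 0 - 2 * C * t <= 0.
  apply: h1.
  - by move=> t /hg1 h; apply: is_derive_eq; rewrite /GRing.scale /=; ring.
  - move=> t /hg2; rewrite ler_norml => /andP[_]; lra.
  - by rewrite mulr0 subrr subr0.
have := @le0_is_derive (fun t => g' t - (g' 0 + t * g1' 0) - C * t ^+ 2)
  (fun t => g1' t - g1' 0 - 2 * C * t) v _ h1 _ v vv; apply.
- by move=> t /hg h; apply: is_derive_eq; rewrite /GRing.scale /=; ring.
- by rewrite mul0r addr0 subrr expr0n/= mulr0 subr0.
Qed.

(** Signs are integrated three times: [6 * C], [6 * C * t] and [3 * C * t ^+ 2] are the derivatives
    of [C * t ^+ 3]. The sharp factor 1/6 is given up. *)
Lemma taylor3_bound (q q1 q2 q3 : R -> R) (C : R) :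
  (forall t : R, is_derive t 1 q (q1 t)) ->
  (forall t : R, is_derive t 1 q1 (q2 t)) ->
  (forall t : R, is_derive t 1 q2 (q3 t)) ->
  (forall t, `|q3 t| <= C) ->
  `|q 1 - (q 0 + q1 0 + q2 0 / 2)| <= C.
Proof.
suff h (p p1 p2 p3 : R -> R) : (forall t : R, is_derive t 1 p (p1 t)) ->
  (forall t : R, is_derive t 1 p1 (p2 t)) ->
  (forall t : R, is_derive t 1 p2 (p3 t)) ->
  (forall t, `|p3 t| <= C) ->
  p 1 - (p 0 + p1 0 + p2 0 / 2) <= C.
  move=> hq hq1 hq2 hq3; rewrite ler_norml (h _ q1 q2 q3)// andbT lerNl.
  have := h (fun t => - q t) (fun t => - q1 t) (fun t => - q2 t) (fun t => - q3 t).
  rewrite mulNr -!opprD; apply => t //.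
  by rewrite normrN.
move=> hp hp1 hp2 hp3; rewrite -subr_le0.
have C0 : 0 <= C by rewrite (le_trans _ (hp3 0)).
have v1 : 0 <= (1 : R) <= 1 by rewrite lexx ler01.
have h2 := @le0_is_derive (fun t => p2 t - p2 0 - 6 * C * t) (fun t => p3 t - 6 * C) 1.
have {}h2 : forall t, 0 <= t <= 1 -> p2 t - p2 0 - 6 * C * t <= 0.
  apply: h2.
  - by move=> t _; apply: is_derive_eq; rewrite /GRing.scale /=; ring.
  - move=> t _; have := hp3 t; rewrite ler_norml => /andP[_]; lra.
  - by rewrite mulr0 subrr subr0.
have h1 := @le0_is_derive (fun t => p1 t - p1 0 - p2 0 * t - 3 * C * t ^+ 2)
  (fun t => p2 t - p2 0 - 6 * C * t) 1 _ h2.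
have {}h1 : forall t, 0 <= t <= 1 -> p1 t - p1 0 - p2 0 * t - 3 * C * t ^+ 2 <= 0.
  apply: h1.
  - by move=> t _; apply: is_derive_eq; rewrite /GRing.scale /=; ring.
  - by rewrite expr0n/= !mulr0 !subr0 subrr.
have := @le0_is_derive (fun t => p t - (p 0 + p1 0 * t + p2 0 / 2 * t ^+ 2) - C * t ^+ 3)
  (fun t => p1 t - p1 0 - p2 0 * t - 3 * C * t ^+ 2) 1 _ h1 _ 1 v1.
rewrite !mulr1 !expr1n !mulr1; apply.
- by move=> t _; apply: is_derive_eq; rewrite /GRing.scale /=; field.
- by rewrite !expr0n/= !mulr0 !addr0 subrr subr0.
Qed.

Lemma mulr_expRN_le1 (u : R) : 0 <= u -> u * expR (- u) <= 1.
Proof.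
move=> u0; rewrite expRN ler_pdivrMr ?expR_gt0// mul1r.
have := expR_ge1Dx u; lra.
Qed.

Lemma sqr_expRN_le2 (u : R) : 0 <= u -> u ^+ 2 * expR (- u) <= 4.
Proof.
move=> u0; have u20 : 0 <= u / 2 by rewrite divr_ge0.
have := mulr_expRN_le1 u20 => h.
have -> : u ^+ 2 * expR (- u) = 4 * (u / 2 * expR (- (u / 2))) ^+ 2.
  rewrite exprMn (expr2 (expR _)) -expRD.
  have -> : - (u / 2) + - (u / 2) = - u by field.
  by field.
rewrite ler_piMr// exprn_ile1//.
by rewrite mulr_ge0 ?expR_ge0.
Qed.

Lemma expRN_le1 (u : R) : 0 <= u -> expR (- u) <= 1.
Proof. by move=> u0; rewrite -expR0 ler_expR oppr_le0. Qed.

(** Taylor expansion along t at [x + t *: y]. The remainder is uniform in x because the exponential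
    absorbs every power of the norm that comes with matching powers of a. The constants add up to 10
    a^2 + 22 a, rounded up. *)
Lemma gaussian_taylor p (a : R) (x y : 'rV[R]_p) : 0 <= a ->
  `|expR (- (a * enorm (x + y) ^+ 2)) -
    expR (- (a * enorm x ^+ 2)) *
      (1 - 2 * a * dotr x y + 2 * a ^+ 2 * dotr x y ^+ 2 - a * enorm y ^+ 2)|
  <= (22 * a ^+ 2 + 22 * a) * enorm y ^+ 3.
Proof.
move=> a0.
pose B := dotr x y; pose Y := enorm y ^+ 2; pose X := enorm x ^+ 2.
pose N (t : R) := X + 2 * t * B + t ^+ 2 * Y.
pose Z (t : R) := B + t * Y.
have NE t : N t = enorm (x + t *: y) ^+ 2.
  rewrite sqr_enorm dotrDl !dotrDr !dotrZl !dotrZr (dotrC y x) /N /X /Y !sqr_enorm /B.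
  ring.
have ZE t : Z t = dotr (x + t *: y) y.
  by rewrite dotrDl dotrZl /Z /Y sqr_enorm.
pose q (t : R) := expR (- (a * N t)).
pose q1 (t : R) := q t * (- 2 * a * Z t).
pose q2 (t : R) := q t * (4 * a ^+ 2 * Z t ^+ 2 - 2 * a * Y).
pose q3 (t : R) := q t * (- 8 * a ^+ 3 * Z t ^+ 3 + 12 * a ^+ 2 * Z t * Y).
have dq (t : R) : is_derive t 1 q (q1 t).
  have h : is_derive t 1 (fun t => - (a * N t)) (- 2 * a * Z t).
    by rewrite /N; apply: is_derive_eq; rewrite /GRing.scale /= /Z; ring.
  exact: is_derive_expR_comp.
have dZ (t : R) : is_derive t 1 Z Y.
  by rewrite /Z; apply: is_derive_eq; rewrite /GRing.scale /=; ring.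
have dq1 (t : R) : is_derive t 1 q1 (q2 t).
  by rewrite /q1; apply: is_derive_eq; rewrite /GRing.scale /= /q1 /q2; ring.
have dq2 (t : R) : is_derive t 1 q2 (q3 t).
  by rewrite /q2; apply: is_derive_eq; rewrite /GRing.scale /= /q1 /q3; ring.
have q3b t : `|q3 t| <= (22 * a ^+ 2 + 22 * a) * enorm y ^+ 3.
  set z := x + t *: y; pose rho := enorm z; pose e := enorm y.
  have e0 : 0 <= e by exact: enorm_ge0.
  have rho0 : 0 <= rho by exact: enorm_ge0.
  have Zb : `|Z t| <= rho * e by rewrite ZE ler_norm_dotr.
  have u0 : 0 <= a * rho ^+ 2 by rewrite mulr_ge0 ?sqr_ge0.
  have qt : q t = expR (- (a * rho ^+ 2)) by rewrite /q NE.
  have E0 := expR_ge0 (- (a * rho ^+ 2)).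
  have E1 := expRN_le1 u0.
  have E2 := mulr_expRN_le1 u0.
  have E3 := sqr_expRN_le2 u0.
  rewrite /q3 normrM qt (ger0_norm E0).
  set E := expR _ in E0 E1 E2 E3 *.
  have Zn : 0 <= `|Z t| by [].
  have b1 : `|- 8 * a ^+ 3 * Z t ^+ 3 + 12 * a ^+ 2 * Z t * Y| <=
      8 * a ^+ 3 * (rho * e) ^+ 3 + 12 * a ^+ 2 * (rho * e) * e ^+ 2.
    rewrite (le_trans (ler_normD _ _))// lerD//.
      have k8 : `|- 8 * a ^+ 3| = 8 * a ^+ 3.
        by rewrite mulNr normrN ger0_norm// mulr_ge0// exprn_ge0.
      rewrite normrM k8 normrX.
      apply: ler_wpM2l; first by rewrite mulr_ge0 ?exprn_ge0.
      by rewrite lerXn2r ?nnegrE ?mulr_ge0.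
    have k12 : 0 <= 12 * a ^+ 2 by rewrite mulr_ge0 ?sqr_ge0.
    have Y0 : 0 <= Y by exact: sqr_ge0.
    rewrite normrM (ger0_norm Y0) normrM (ger0_norm k12).
    by apply: ler_wpM2r => //; exact: ler_wpM2l.
  apply: (le_trans (ler_wpM2l E0 b1)).
  have -> : E * (8 * a ^+ 3 * (rho * e) ^+ 3 + 12 * a ^+ 2 * (rho * e) * e ^+ 2) =
    (E * (8 * a ^+ 3 * rho ^+ 3 + 12 * a ^+ 2 * rho)) * e ^+ 3 by ring.
  apply: ler_wpM2r; first exact: exprn_ge0.
  (* Odd powers of [rho] are replaced by even ones, which pair with a into powers of a rho^2. *)
  have rho1 : rho <= (1 + rho ^+ 2) / 2.
    have := sqr_ge0 (rho - 1); rewrite sqrrB1; lra.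
  have rho3 : rho ^+ 3 <= (rho ^+ 2 + rho ^+ 4) / 2.
    have -> : rho ^+ 3 = rho ^+ 2 * rho by ring.
    have -> : (rho ^+ 2 + rho ^+ 4) / 2 = rho ^+ 2 * ((1 + rho ^+ 2) / 2) by ring.
    by apply: ler_wpM2l; first exact: sqr_ge0.
  have a2 : 0 <= a ^+ 2 by exact: sqr_ge0.
  have a3 : 0 <= a ^+ 3 by exact: exprn_ge0.
  have c1 : E * (8 * a ^+ 3 * rho ^+ 3) <= 4 * a ^+ 2 + 16 * a.
    apply: (@le_trans _ _ (E * (8 * a ^+ 3 * ((rho ^+ 2 + rho ^+ 4) / 2)))).
      by apply: ler_wpM2l => //; apply: ler_wpM2l => //; rewrite mulr_ge0.
    have -> : E * (8 * a ^+ 3 * ((rho ^+ 2 + rho ^+ 4) / 2)) =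
       4 * a ^+ 2 * (a * rho ^+ 2 * E) + 4 * a * ((a * rho ^+ 2) ^+ 2 * E) by field.
    rewrite lerD//.
      by rewrite ler_piMr// mulr_ge0.
    have -> : 16 * a = 4 * a * 4 by ring.
    by apply: ler_wpM2l => //; rewrite mulr_ge0.
  have c2 : E * (12 * a ^+ 2 * rho) <= 6 * a ^+ 2 + 6 * a.
    apply: (@le_trans _ _ (E * (12 * a ^+ 2 * ((1 + rho ^+ 2) / 2)))).
      by apply: ler_wpM2l => //; apply: ler_wpM2l => //; rewrite mulr_ge0.
    have -> : E * (12 * a ^+ 2 * ((1 + rho ^+ 2) / 2)) =
       6 * a ^+ 2 * E + 6 * a * (a * rho ^+ 2 * E) by field.
    by rewrite lerD// ler_piMr// mulr_ge0.
  rewrite mulrDr (le_trans (lerD c1 c2))//; lra.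
have := taylor3_bound dq dq1 dq2 q3b.
have <- : q 1 = expR (- (a * enorm (x + y) ^+ 2)) by rewrite /q NE scale1r.
have q0 : q 0 = expR (- (a * enorm x ^+ 2)) by rewrite /q NE scale0r addr0.
rewrite /q1 /q2 q0 /Z mul0r addr0.
set E := expR _.
have -> : E + E * (- 2 * a * B) + E * (4 * a ^+ 2 * B ^+ 2 - 2 * a * Y) / 2 =
  E * (1 - 2 * a * B + 2 * a ^+ 2 * B ^+ 2 - a * Y) by field.
exact.
Qed.

(* With [a = lambda / (1 + 2 lambda s)], this is [E exp (- lambda |x + sqrt s Z|^2)]
   for [r = |x|^2] and a standard Gaussian vector Z of R^d; it solves the heat
   equation in [s]. *)
Definition heat_rate (lambda s : R) : R := lambda / (1 + 2 * lambda * s).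

Definition heat (d : nat) (lambda s r : R) : R :=
  (1 + 2 * lambda * s) `^ (- (d%:R / 2)) * expR (- (heat_rate lambda s * r)).

Lemma heat_rate_bound (lambda s : R) : 0 <= lambda -> 0 <= s ->
  0 <= heat_rate lambda s <= lambda.
Proof.
move=> l0 s0; have b1 : 1 <= 1 + 2 * lambda * s by rewrite lerDl !mulr_ge0.
have b0 : 0 < 1 + 2 * lambda * s by rewrite (lt_le_trans _ b1).
rewrite /heat_rate; apply/andP; split; first by rewrite divr_ge0// ltW.
by rewrite ler_pdivrMr// ler_peMr.
Qed.

Lemma heat_coef_bound (d : nat) (lambda s : R) : 0 <= lambda -> 0 <= s ->
  0 <= (1 + 2 * lambda * s) `^ (- (d%:R / 2)) <= 1.
Proof.
move=> l0 s0; rewrite powR_ge0/=.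
have b1 : 1 <= 1 + 2 * lambda * s by rewrite lerDl !mulr_ge0.
by rewrite -[leRHS](powRr0 (1 + 2 * lambda * s)) ler_powR// oppr_le0 divr_ge0.
Qed.

(** With u = A r, the second time derivative is [heat] times A^2 ((2 u - d)^2 - 8 u + 2 d). The
    bounds u e^(-u) <= 1 and u^2 e^(-u) <= 4 make it uniform in r: 24 is 4 * 4 + 8. *)
Lemma heat_taylor (d : nat) (lambda s v r : R) :
  0 <= lambda -> 0 <= s -> 0 <= v -> 0 <= r ->
  `|heat d lambda (s + v) r - heat d lambda s r *
     (1 + v * (2 * heat_rate lambda s ^+ 2 * r - d%:R * heat_rate lambda s))| <=
  lambda ^+ 2 * (d%:R ^+ 2 + 2 * d%:R + 24) * v ^+ 2.
Proof.
move=> l0 s0 v0 r0.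
pose b t := 1 + 2 * lambda * (s + t).
pose A t := heat_rate lambda (s + t).
have bgt0 t : 0 <= t <= v -> 0 < b t.
  by move=> /andP[t0 _]; rewrite ltr_pwDl// !mulr_ge0// addr_ge0.
pose g t := heat d lambda (s + t) r.
pose w t := 2 * A t ^+ 2 * r - d%:R * A t.
pose g1 t := g t * w t.
pose g2 t := g t * (w t ^+ 2 - 8 * A t ^+ 3 * r + 2 * d%:R * A t ^+ 2).
have db (t : R) : is_derive t 1 b (2 * lambda).
  by rewrite /b; apply: is_derive_eq; rewrite /GRing.scale /=; ring.
have dA t : 0 <= t <= v -> is_derive t 1 A (- 2 * A t ^+ 2).
  move=> /bgt0 bt; rewrite /A /heat_rate -[fun _ => _]/(fun t => lambda * (b t)^-1).
  have h : is_derive t 1 (fun t => (b t)^-1) (- (b t) ^- 2 *: (2 * lambda)).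
    by apply: is_deriveV => //; rewrite gt_eqF.
  apply: is_derive_eq; rewrite /GRing.scale /= -/(b t); field.
  by rewrite gt_eqF.
have dg t : 0 <= t <= v -> is_derive t 1 g (g1 t).
  move=> tv; have bt := bgt0 _ tv.
  have h1 : is_derive t 1 (fun t => b t `^ (- (d%:R / 2)))
      (- (d%:R / 2) * b t `^ (- (d%:R / 2) - 1) * (2 * lambda)).
    exact: (@is_derive1_comp R (fun z => z `^ (- (d%:R / 2))) b t _ _ (is_derive1_powR _ bt) (db t)).
  have h2 : is_derive t 1 (fun t => expR (- (A t * r))) (expR (- (A t * r)) * (2 * A t ^+ 2 * r)).
    apply: is_derive_expR_comp.
    have := dA t tv => h; apply: is_derive_eq; rewrite /GRing.scale /=; ring.
  rewrite /g /heat -[fun _ => _]/(fun t => b t `^ (- (d%:R / 2)) * expR (- (A t * r))).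
  apply: is_derive_eq; rewrite /GRing.scale /= /g1 /g /heat /w -/(b t) -/(A t).
  have -> : b t `^ (- (d%:R / 2) - 1) = b t `^ (- (d%:R / 2)) / b t.
    rewrite powRB ?powRr1 ?ltW//.
    by rewrite (gt_eqF bt) implybT.
  rewrite /A /heat_rate -/(b t); field.
  by rewrite gt_eqF.
have dg1 t : 0 <= t <= v -> is_derive t 1 g1 (g2 t).
  move=> tv; have h := dg t tv; have h' := dA t tv.
  by rewrite /g1 /w; apply: is_derive_eq; rewrite /GRing.scale /= /g2 /g1 /w; ring.
have g2b t : 0 <= t <= v -> `|g2 t| <= lambda ^+ 2 * (d%:R ^+ 2 + 2 * d%:R + 24).
  move=> /andP[t0 _]; have st0 : 0 <= s + t by rewrite addr_ge0.
  have /andP[A0 Al] := heat_rate_bound l0 st0.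
  have /andP[c0 c1] := heat_coef_bound d l0 st0.
  rewrite -/(A t) in A0 Al.
  pose u := A t * r; have u0 : 0 <= u by rewrite mulr_ge0.
  have E0 := expR_ge0 (- u).
  have E1 := expRN_le1 u0.
  have E2 := mulr_expRN_le1 u0.
  have E3 := sqr_expRN_le2 u0.
  rewrite /g2 /g /heat -/(A t) -/u.
  set c := _ `^ _ in c0 c1 *; set E := expR _ in E0 E1 E2 E3 *.
  have -> : w t ^+ 2 - 8 * A t ^+ 3 * r + 2 * d%:R * A t ^+ 2 =
    A t ^+ 2 * ((2 * u - d%:R) ^+ 2 - 8 * u + 2 * d%:R) by rewrite /w /u; ring.
  have d0 : 0 <= d%:R :> R by [].
  have du0 : 0 <= d%:R * u by rewrite mulr_ge0.
  have k1 : `|(2 * u - d%:R) ^+ 2 - 8 * u + 2 * d%:R| <=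
     4 * u ^+ 2 + d%:R ^+ 2 + 8 * u + 2 * d%:R.
    have Esq : (2 * u - d%:R) ^+ 2 = 4 * u ^+ 2 - 4 * (d%:R * u) + d%:R ^+ 2 by ring.
    have h := sqr_ge0 (2 * u - d%:R); rewrite Esq in h *.
    have u2 := sqr_ge0 u; have d2 := sqr_ge0 (d%:R : R).
    by rewrite ler_norml; apply/andP; split; lra.
  have A2 : 0 <= A t ^+ 2 by exact: sqr_ge0.
  rewrite normrM (ger0_norm (mulr_ge0 c0 E0)) normrM (ger0_norm A2).
  apply: (@le_trans _ _ (E * (A t ^+ 2 * (4 * u ^+ 2 + d%:R ^+ 2 + 8 * u + 2 * d%:R)))).
    apply: ler_pM.
    - by rewrite mulr_ge0.
    - by rewrite mulr_ge0.
    - by rewrite ler_piMl.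
    - exact: ler_wpM2l.
  have -> : E * (A t ^+ 2 * (4 * u ^+ 2 + d%:R ^+ 2 + 8 * u + 2 * d%:R)) =
    A t ^+ 2 * (4 * (u ^+ 2 * E) + d%:R ^+ 2 * E + 8 * (u * E) + 2 * d%:R * E) by ring.
  apply: ler_pM => //.
  - have h1 : 0 <= u ^+ 2 * E by rewrite mulr_ge0// sqr_ge0.
    have h2 : 0 <= d%:R ^+ 2 * E by rewrite mulr_ge0// sqr_ge0.
    have h3 : 0 <= u * E by rewrite mulr_ge0.
    have h4 : 0 <= d%:R * E by rewrite mulr_ge0.
    lra.
  - by rewrite lerXn2r.
  have e1 : d%:R ^+ 2 * E <= d%:R ^+ 2 by rewrite ler_piMr// sqr_ge0.
  have e2 : 2 * d%:R * E <= 2 * d%:R by rewrite ler_piMr// mulr_ge0.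
  lra.
have := taylor2_bound v0 dg dg1 g2b.
rewrite /g1 /g /w /A addr0 => h.
rewrite (_ : heat d lambda s r * (1 + _) = heat d lambda s r + v * (heat d lambda s r *
   (2 * heat_rate lambda s ^+ 2 * r - d%:R * heat_rate lambda s)))//; ring.
Qed.

End taylor_bounds.

(** * A quantitative central limit theorem *)

Section bounded_random_variables.
Context {R : realType} d (T : measurableType d) (P : probability T R).
Implicit Types g h : T -> R.

(** Vectors on the sphere and Laplace kernels are bounded, so this class, closed under ring
    operations, settles integrability. *)
Definition bounded_measurable g :=
  measurable_fun setT g /\ exists M, forall w, `|g w| <= M.

Lemma bounded_measurable_integrable g : bounded_measurable g ->
  P.-integrable setT (EFin \o g).
Proof.
move=> [mg [M gM]]; apply: (@le_integrable _ _ _ P setT measurableT _ (EFin \o cst M)) => //.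
- exact/measurable_EFinP.
- by move=> w _ /=; rewrite lee_fin (le_trans (gM w))// ler_norm.
- exact: finite_measure_integrable_cst.
Qed.

Lemma bounded_measurable_cst (c : R) : bounded_measurable (cst c).
Proof. by split => //; exists `|c|. Qed.

Lemma bounded_measurableD g h : bounded_measurable g -> bounded_measurable h ->
  bounded_measurable (fun w => g w + h w).
Proof.
move=> [mg [M gM]] [mh [N hN]]; split; first exact: measurable_funD.
by exists (M + N) => w; rewrite (le_trans (ler_normD _ _))// lerD.
Qed.

Lemma bounded_measurableM g h : bounded_measurable g -> bounded_measurable h ->
  bounded_measurable (fun w => g w * h w).
Proof.
move=> [mg [M gM]] [mh [N hN]]; split; first exact: measurable_funM.
by exists (M * N) => w; rewrite normrM ler_pM.
Qed.

Lemma bounded_measurableZ (c : R) g : bounded_measurable g ->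
  bounded_measurable (fun w => c * g w).
Proof. by move=> hg; apply: bounded_measurableM => //; exact: bounded_measurable_cst. Qed.

Lemma bounded_measurableB g h : bounded_measurable g -> bounded_measurable h ->
  bounded_measurable (fun w => g w - h w).
Proof.
move=> hg hh; under eq_fun do rewrite -mulN1r.
by apply: bounded_measurableD => //; exact: bounded_measurableZ.
Qed.

Lemma bounded_measurableX g k : bounded_measurable g ->
  bounded_measurable (fun w => g w ^+ k).
Proof.
move=> hg; elim: k => [|k IH]; first exact: bounded_measurable_cst.
by under eq_fun do rewrite exprS; exact: bounded_measurableM.
Qed.

Lemma expectation_cst (c : R) : \int[P]_w c = c.
Proof. by rewrite Rintegral_cst// -[X in fine X]/(P setT) probability_setT mulr1. Qed.

Lemma expectationD g h : bounded_measurable g -> bounded_measurable h ->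
  \int[P]_w (g w + h w) = \int[P]_w g w + \int[P]_w h w.
Proof. by move=> hg hh; rewrite RintegralD//; exact: bounded_measurable_integrable. Qed.

Lemma expectationB g h : bounded_measurable g -> bounded_measurable h ->
  \int[P]_w (g w - h w) = \int[P]_w g w - \int[P]_w h w.
Proof. by move=> hg hh; rewrite RintegralB//; exact: bounded_measurable_integrable. Qed.

Lemma expectationZ (c : R) g : bounded_measurable g ->
  \int[P]_w (c * g w) = c * \int[P]_w g w.
Proof. by move=> hg; rewrite RintegralZl//; exact: bounded_measurable_integrable. Qed.

Lemma le_expectation g h : bounded_measurable g -> bounded_measurable h ->
  (forall w, g w <= h w) -> \int[P]_w g w <= \int[P]_w h w.
Proof.
by move=> hg hh gh; apply: le_Rintegral => //; exact: bounded_measurable_integrable.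
Qed.

Lemma expectation_dist g h k : bounded_measurable g -> bounded_measurable h ->
  bounded_measurable k -> (forall w, `|g w - h w| <= k w) ->
  `|\int[P]_w g w - \int[P]_w h w| <= \int[P]_w k w.
Proof.
move=> hg hh hk ghk; rewrite -expectationB//.
apply: (le_trans (le_normr_Rintegral _ _)) => //.
  by apply: bounded_measurable_integrable; exact: bounded_measurableB.
apply: le_expectation => //.
have [mgh [M ghM]] := bounded_measurableB hg hh.
split; first exact: measurableT_comp.
by exists M => w; rewrite normr_id.
Qed.

Lemma EFin_expectation g : bounded_measurable g ->
  (\int[P]_w (g w)%:E)%E = (\int[P]_w g w)%:E.
Proof.
move=> hg; rewrite /Rintegral fineK//; apply: integrable_fin_num => //.
exact: bounded_measurable_integrable.
Qed.

Lemma bounded_measurable_expRN g : measurable_fun setT g -> (forall w, 0 <= g w) ->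
  bounded_measurable (fun w => expR (- g w)).
Proof.
move=> mg g0; split.
  by apply: measurableT_comp => //; exact: measurableT_comp.
by exists 1 => w; rewrite ger0_norm ?expR_ge0// expRN_le1.
Qed.

End bounded_random_variables.

Lemma ler_norm_telescope (R : realType) (n : nat) (u : nat -> R) (e : R) :
  (forall k : 'I_n, `|u k.+1 - u k| <= e) -> `|u n - u 0%N| <= n%:R * e.
Proof.
move=> ue; suff h k : (k <= n)%N -> `|u k - u 0%N| <= k%:R * e by exact: h.
elim: k => [_|k IH kn]; first by rewrite subrr normr0 mul0r.
rewrite -(subrK (u k) (u k.+1)) -addrA (le_trans (ler_normD _ _))//.
rewrite -natr1 mulrDl mul1r [leRHS]addrC lerD//; last exact: IH (ltnW kn).
exact: (ue (Ordinal kn)).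
Qed.

Section central_limit_bound.
Context {R : realType} d (T : measurableType d) (P : probability T R).
Variables (n p : nat) (X : 'I_n -> {RV P >-> 'rV[R]_p}) (theta : 'rV[R]_p).
Hypotheses (p2 : (1 < p)%N) (theta1 : enorm theta = 1).
Hypothesis indepX : mutually_independent X.
Hypothesis X1 : forall i w, enorm (X i w) = 1.
Variables (M2 M4 : R).
Hypothesis EX : forall i y, dotr y theta = 0 -> \int[P]_w dotr y (X i w) = 0.
Hypothesis EX2 : forall i y, dotr y theta = 0 ->
  p.-1%:R * \int[P]_w (dotr y (X i w) ^+ 2) = enorm y ^+ 2 * M2.
Hypothesis EM2 : forall i, \int[P]_w (1 - dotr (X i w) theta ^+ 2) = M2.
Hypothesis EM4 : forall i, \int[P]_w ((1 - dotr (X i w) theta ^+ 2) ^+ 2) = M4.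
Variables (c delta lambda : R).
Hypotheses (delta0 : 0 < delta) (lambda0 : 0 <= lambda).

Let dm : nat := p.-1.
Let phi (x : 'rV[R]_p) := c *: tangent theta x.
(** The variance of [phi (X i)] in each unit direction orthogonal to [theta]. *)
Let v := c ^+ 2 * M2 / dm%:R.
Let m3 := (delta * (c ^+ 2 * M2) + c ^+ 4 * M4 / delta) / 2.
Let K := 22 * lambda ^+ 2 + 22 * lambda.
Let C := lambda ^+ 2 * (dm%:R ^+ 2 + 2 * dm%:R + 24).
Let S := partial_sum X phi.

Let dm0 : 0 < dm%:R :> R.
Proof. by rewrite ltr0n /dm -subn1 subn_gt0. Qed.

Let measurable_phi : measurable_fun setT phi.
Proof.
apply: measurable_funZ_rV => //; rewrite /tangent.
under eq_fun do rewrite -scaleNr.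
apply: measurable_funD_rV => //; apply: measurable_funZ_rV => //.
by apply: measurableT_comp => //; exact: (@measurable_dotr R p _ _ id (cst theta)).
Qed.

Let S_orth k w : dotr (S k w) theta = 0.
Proof.
rewrite dotr_suml big1// => i _.
by rewrite dotrZl tangent_orth// mulr0.
Qed.

Let sqr_enorm_phi i w : enorm (phi (X i w)) ^+ 2 = c ^+ 2 * (1 - dotr (X i w) theta ^+ 2).
Proof.
by rewrite enormZ exprMn real_normK ?num_real// sqr_enorm_tangent// X1 expr1n.
Qed.

Let bdot (y : 'rV[R]_p) i : bounded_measurable (fun w => dotr y (X i w)).
Proof.
split; first exact: (@measurable_dotr R p _ _ (cst y) (X i)).
by exists (enorm y) => w; rewrite (le_trans (ler_norm_dotr _ _))// X1 mulr1.
Qed.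

Let bV i : bounded_measurable (fun w => 1 - dotr (X i w) theta ^+ 2).
Proof.
apply: bounded_measurableB; first exact: bounded_measurable_cst.
by apply: bounded_measurableX; under eq_fun do rewrite dotrC; exact: bdot.
Qed.

Let bphi2 i : bounded_measurable (fun w => enorm (phi (X i w)) ^+ 2).
Proof. by under eq_fun do rewrite sqr_enorm_phi; exact: bounded_measurableZ. Qed.

Let E_phi2 i : \int[P]_w (enorm (phi (X i w)) ^+ 2) = dm%:R * v.
Proof.
under eq_Rintegral do rewrite sqr_enorm_phi.
by rewrite expectationZ// EM2 /v; field; rewrite gt_eqF.
Qed.

Let mphiX i : measurable_fun setT (fun w => phi (X i w)).
Proof. exact: measurableT_comp. Qed.

Let bphi3 i : bounded_measurable (fun w => enorm (phi (X i w)) ^+ 3).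
Proof.
have [M2' [N hN]] := bphi2 i; apply: bounded_measurableX; split.
  exact: measurable_enorm.
exists (1 + N) => w; rewrite ger0_norm ?enorm_ge0//.
have := hN w; rewrite ger0_norm ?sqr_ge0// => h.
by have := sqr_ge0 (enorm (phi (X i w)) - 1); have := enorm_ge0 (phi (X i w)); rewrite sqrrB1; nra.
Qed.

(** From (e^2 - delta e)^2 >= 0 follows e^3 <= delta e^2 / 2 + e^4 / (2 delta): only even moments
    are required. *)
Let E_phi3 i : \int[P]_w (enorm (phi (X i w)) ^+ 3) <= m3.
Proof.
have b2 := bphi2 i.
have b4 : bounded_measurable (fun w => (enorm (phi (X i w)) ^+ 2) ^+ 2).
  exact: bounded_measurableX.
apply: (@le_trans _ _ (\int[P]_w ((delta / 2) * enorm (phi (X i w)) ^+ 2 +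
    (2 * delta)^-1 * (enorm (phi (X i w)) ^+ 2) ^+ 2))).
  apply: le_expectation => //.
    by apply: bounded_measurableD; exact: bounded_measurableZ.
  move=> w; set e := enorm _.
  have : 0 <= (2 * delta)^-1 * (e ^+ 2 - delta * e) ^+ 2.
    by rewrite mulr_ge0 ?sqr_ge0// invr_ge0 mulr_ge0// ltW.
  have -> : (2 * delta)^-1 * (e ^+ 2 - delta * e) ^+ 2 =
      delta / 2 * e ^+ 2 + (2 * delta)^-1 * (e ^+ 2) ^+ 2 - e ^+ 3.
    by field; rewrite gt_eqF.
  by rewrite subr_ge0.
rewrite expectationD; [|exact: bounded_measurableZ|exact: bounded_measurableZ].
rewrite expectationZ// expectationZ// E_phi2.
under [X in _ + _ * X]eq_Rintegral do rewrite sqr_enorm_phi exprMn.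
rewrite expectationZ; last exact: bounded_measurableX.
rewrite EM4 /m3 /v le_eqVlt; apply/orP; left; apply/eqP.
by field; rewrite !gt_eqF.
Qed.

Let M2_ge0 (i : 'I_n) : 0 <= M2.
Proof.
rewrite -(EM2 i); apply: Rintegral_ge0 => w _.
by rewrite -[1](expr1n _ 2) -(X1 i w) -sqr_enorm_tangent// sqr_ge0.
Qed.

Let v_ge0 (i : 'I_n) : 0 <= v.
Proof. by rewrite /v divr_ge0// mulr_ge0 ?sqr_ge0// (M2_ge0 i). Qed.

Let bheat (s : R) (g : T -> R) : 0 <= s -> measurable_fun setT g ->
  (forall w, 0 <= g w) -> bounded_measurable (fun w => heat dm lambda s (g w)).
Proof.
move=> s0 mg g0; apply: bounded_measurableZ; apply: bounded_measurable_expRN.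
  exact: measurable_funM.
by move=> w; rewrite mulr_ge0//; have /andP[] := heat_rate_bound lambda0 s0.
Qed.

(** On integrating [gaussian_taylor], centring removes the linear term, and the quadratic ones
    combine into the first-order time increment of [heat_taylor]. *)
Let gaussian_step (i : 'I_n) (a : R) (x : 'rV[R]_p) :
  0 <= a <= lambda -> dotr x theta = 0 ->
  `|\int[P]_w expR (- (a * enorm (x + phi (X i w)) ^+ 2)) -
    expR (- (a * enorm x ^+ 2)) *
      (1 + v * (2 * a ^+ 2 * enorm x ^+ 2 - dm%:R * a))| <= K * m3.
Proof.
move=> /andP[a0 al] xt.
have tx : tangent theta x = x by rewrite /tangent xt scale0r subr0.
have BE w : dotr x (phi (X i w)) = c * dotr x (X i w).
  by rewrite dotrZr -tangent_sym tx.
have bB : bounded_measurable (fun w => dotr x (phi (X i w))).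
  by under eq_fun do rewrite BE; exact: bounded_measurableZ.
have EB : \int[P]_w dotr x (phi (X i w)) = 0.
  by under eq_Rintegral do rewrite BE; rewrite expectationZ// EX// mulr0.
have EB2 : \int[P]_w (dotr x (phi (X i w)) ^+ 2) = enorm x ^+ 2 * v.
  under eq_Rintegral do rewrite BE exprMn.
  rewrite expectationZ; last exact: bounded_measurableX.
  apply: (mulfI (lt0r_neq0 dm0)); rewrite mulrCA EX2// /v; field.
  by rewrite gt_eqF.
have bB2 := bounded_measurableX 2 bB.
have -> : expR (- (a * enorm x ^+ 2)) *
      (1 + v * (2 * a ^+ 2 * enorm x ^+ 2 - dm%:R * a)) =
  \int[P]_w (expR (- (a * enorm x ^+ 2)) * (1 - 2 * a * dotr x (phi (X i w)) +
     2 * a ^+ 2 * dotr x (phi (X i w)) ^+ 2 - a * enorm (phi (X i w)) ^+ 2)).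
  have b1 := bounded_measurableB (bounded_measurable_cst T 1) (bounded_measurableZ (2 * a) bB).
  have b2 := bounded_measurableD b1 (bounded_measurableZ (2 * a ^+ 2) bB2).
  have b3 := bounded_measurableZ a (bphi2 i).
  rewrite expectationZ; last exact: bounded_measurableB.
  rewrite expectationB// expectationD//; last exact: bounded_measurableZ.
  rewrite expectationB//; [|exact: bounded_measurable_cst|exact: bounded_measurableZ].
  rewrite expectation_cst !expectationZ// EB EB2 E_phi2.
  congr (_ * _); ring.
apply: (@le_trans _ _ (\int[P]_w ((22 * a ^+ 2 + 22 * a) * enorm (phi (X i w)) ^+ 3))).
  apply: expectation_dist.
  - apply: bounded_measurable_expRN; last by move=> w; rewrite mulr_ge0 ?sqr_ge0.
    apply: measurable_funM => //; apply: measurable_funX.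
    by apply: measurable_enorm; exact: measurable_funD_rV.
  - apply: bounded_measurableZ; apply: bounded_measurableB; last exact: bounded_measurableZ.
    apply: bounded_measurableD; last exact: bounded_measurableZ.
    apply: bounded_measurableB; first exact: bounded_measurable_cst.
    exact: bounded_measurableZ.
  - exact: bounded_measurableZ.
  - by move=> w; exact: gaussian_taylor.
rewrite expectationZ//; apply: ler_pM => //.
- by rewrite addr_ge0// mulr_ge0// sqr_ge0.
- by apply: Rintegral_ge0 => w _; rewrite exprn_ge0 ?enorm_ge0.
- by rewrite /K lerD// ler_wpM2l// lerXn2r ?nnegrE.
Qed.

(** Adding one summand and advancing time by [v] share the same first-order expansion; the two
    remainders are added. *)
Let step_x (i : 'I_n) (s : R) (x : 'rV[R]_p) : 0 <= s -> dotr x theta = 0 ->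
  `|\int[P]_w heat dm lambda s (enorm (x + phi (X i w)) ^+ 2) -
    heat dm lambda (s + v) (enorm x ^+ 2)| <= K * m3 + C * v ^+ 2.
Proof.
move=> s0 xt.
have abound := heat_rate_bound lambda0 s0.
have /andP[b0 b1] := heat_coef_bound dm lambda0 s0.
have := gaussian_step i abound xt.
have := heat_taylor dm lambda0 s0 (v_ge0 i) (sqr_ge0 (enorm x)).
rewrite -/C {2 3}/heat.
set a := heat_rate lambda s in abound *; set b := _ `^ _ in b0 b1 *.
rewrite {2}/heat -/b -/a => h1 h2.
have -> : \int[P]_w heat dm lambda s (enorm (x + phi (X i w)) ^+ 2) =
    b * \int[P]_w expR (- (a * enorm (x + phi (X i w)) ^+ 2)).
  rewrite -expectationZ//; apply: bounded_measurable_expRN.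
    apply: measurable_funM => //; apply: measurable_funX.
    by apply: measurable_enorm; exact: measurable_funD_rV.
  by move=> w; rewrite mulr_ge0 ?sqr_ge0//; case/andP: abound.
set I := \int[P]_w _ in h2 *; set H := heat _ _ _ _ in h1 *.
set E := expR _ in h1 h2; set W := 1 + _ in h1 h2.
have -> : b * I - H = b * (I - E * W) + - (H - b * E * W) by ring.
rewrite (le_trans (ler_normD _ _))// normrN lerD//.
rewrite normrM (ger0_norm b0) (le_trans _ h2)//.
by rewrite ler_piMl.
Qed.

Lemma central_limit_bound :
  `|\int[P]_w expR (- (lambda * enorm (S n w) ^+ 2)) -
    (1 + 2 * lambda * (n%:R * v)) `^ (- (p.-1%:R / 2))| <= n%:R * (K * m3 + C * v ^+ 2).
Proof.
(* [U k] has k original summands and [n - k] Gaussian ones, the latter present only through the time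
   argument of [heat]. It interpolates between the two terms of the statement. *)
pose U k := \int[P]_w heat dm lambda ((n - k)%:R * v) (enorm (S k w) ^+ 2).
have Un : \int[P]_w expR (- (lambda * enorm (S n w) ^+ 2)) = U n.
  apply: eq_Rintegral => w _; rewrite subnn mul0r /heat /heat_rate mulr0 addr0 divr1.
  by rewrite powR1 mul1r.
have U0 : (1 + 2 * lambda * (n%:R * v)) `^ (- (p.-1%:R / 2)) = U 0%N.
  rewrite /U -[LHS](expectation_cst P); apply: eq_Rintegral => w _.
  rewrite subn0 /S partial_sum0 sqr_enorm dot0r /heat mulr0 oppr0 expR0 mulr1.
  by [].
rewrite Un U0.
have mS k : measurable_fun setT (fun w => enorm (S k w) ^+ 2).
  by apply: measurable_funX; apply: measurable_enorm; exact: measurable_partial_sum.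
have step (k : 'I_n) : `|U k.+1 - U k| <= K * m3 + C * v ^+ 2.
  have s0 : 0 <= (n - k.+1)%:R * v by rewrite mulr_ge0// (v_ge0 k).
  set s := (n - k.+1)%:R * v in s0.
  have sv : (n - k)%:R * v = s + v.
    by rewrite /s -(subSS k) subSn ?ltn_ord// -natr1 mulrDl mul1r.
  pose F (x z : 'rV[R]_p) : \bar R := (heat dm lambda s (enorm (x + phi z) ^+ 2))%:E.
  have F0 x z : (0 <= F x z)%E by rewrite lee_fin mulr_ge0 ?powR_ge0 ?expR_ge0.
  have mF : measurable_fun setT (fun z : 'rV[R]_p * 'rV[R]_p => F z.1 z.2).
    apply/measurable_EFinP; apply: measurable_funM => //.
    apply: measurableT_comp => //; apply: measurableT_comp => //.
    apply: measurable_funM => //; apply: measurable_funX; apply: measurable_enorm.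
    by apply: measurable_funD_rV => //; apply: measurableT_comp => //; exact: measurable_snd.
  pose h w := \int[P]_w' heat dm lambda s (enorm (S k w + phi (X k w')) ^+ 2).
  have bh' w : bounded_measurable (fun w' => heat dm lambda s (enorm (S k w + phi (X k w')) ^+ 2)).
    apply: bheat => //; last by move=> w'; rewrite sqr_ge0.
    by apply: measurable_funX; apply: measurable_enorm; exact: measurable_funD_rV.
  have hE w : (\int[P]_w' F (S k w) (X k w') = (h w)%:E)%E.
    by rewrite -EFin_expectation.
  have mSX : measurable_fun setT (fun z : T * T => (S k z.1, X k z.2)).
    apply: measurable_fun_pair => /=.
      exact: (measurableT_comp (measurable_partial_sum X measurable_phi k) (@measurable_fst _ _ T T)).
    exact: (measurableT_comp (measurable_funPT (X k)) (@measurable_snd _ _ T T)).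
  have mFS : measurable_fun setT (fun z : T * T => F (S k z.1) (X k z.2)).
    exact: (measurableT_comp mF mSX).
  have mh : measurable_fun setT h.
    apply/measurable_EFinP.
    have -> : EFin \o h = fubini_F P (fun z : T * T => F (S k z.1) (X k z.2)).
      by apply/funext => w; rewrite /fubini_F hE.
    by apply: measurable_fun_fubini_tonelli_F mFS _ => z; exact: F0.
  have bh : bounded_measurable h.
    split => //; exists 1 => w; rewrite ger0_norm; last first.
      by apply: Rintegral_ge0 => w' _; rewrite mulr_ge0 ?powR_ge0 ?expR_ge0.
    rewrite -[leRHS](expectation_cst P); apply: le_expectation => //.
      exact: bounded_measurable_cst.
    move=> w'; have /andP[b0 b1] := heat_coef_bound dm lambda0 s0.
    have /andP[a0 _] := heat_rate_bound lambda0 s0.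
    by rewrite mulr_ile1 ?expR_ge0// expRN_le1// mulr_ge0 ?sqr_ge0.
  have -> : U k.+1 = \int[P]_w h w.
    rewrite /U /Rintegral; congr fine.
    transitivity (\int[P]_w F (S k w) (X k w))%E.
      by apply: eq_integral => w _; rewrite /F -/s {1}/S partial_sumS.
    rewrite [LHS](expectation_partial_sum indepX measurable_phi k mF F0).
    by apply: eq_integral => w _; exact: hE.
  rewrite -[leRHS](expectation_cst P).
  apply: expectation_dist => //.
  - by apply: bheat => //; [rewrite sv addr_ge0// (v_ge0 k)|move=> w; rewrite sqr_ge0].
  - exact: bounded_measurable_cst.
  - by move=> w; rewrite sv /h; exact: step_x.
exact: ler_norm_telescope.
Qed.

End central_limit_bound.

(** * Laplace transforms and convergence in distribution *)

Section chi_square_laplace.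
Context {R : realType}.
Local Notation mu := (@lebesgue_measure R).

(** The integrand is s times the density of a centred normal law of standard deviation s = (1 + 2
    lambda)^(-1/2). *)
Lemma normal_laplace (lambda : R) : 0 <= lambda ->
  (\int[normal_prob 0 1]_a (expR (- (lambda * a ^+ 2)))%:E =
   ((1 + 2 * lambda) `^ (- 2^-1))%:E)%E.
Proof.
move=> l0; have b0 : 0 < 1 + 2 * lambda by rewrite ltr_pwDl// mulr_ge0.
have me : measurable_fun setT (fun a : R => (expR (- (lambda * a ^+ 2)))%:E).
  apply/measurable_EFinP; apply: measurableT_comp => //; apply: measurableT_comp => //.
  by apply: measurable_funM => //; exact: measurable_funX.
have mp (s : R) : measurable_fun [set: measurableTypeR R] (normal_pdf 0 s).
  exact: measurable_normal_pdf.
rewrite (@ge0_integral_density _ (measurableTypeR R) R mu (normal_pdf 0 1) (mp 1)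
  (normal_pdf_ge0 0 1) (normal_prob 0 1))//.
pose s := (1 + 2 * lambda) `^ (- 2^-1).
have s0 : 0 < s by exact: powR_gt0.
have s2 : s ^+ 2 = (1 + 2 * lambda)^-1.
  rewrite /s -powR_mulrn ?powR_ge0// -powRrM mulNr mulVf// powRN powRr1//.
  exact: ltW.
transitivity (\int[mu]_a (s%:E * (normal_pdf 0 s a)%:E))%E.
  apply: eq_integral => a _; rewrite -!EFinM; congr EFin.
  rewrite !normal_pdfE ?gt_eqF// /normal_peak /normal_fun subr0.
  rewrite -mulrA -expRD !expr1n mul1r s2.
  have -> : Num.sqrt ((1 + 2 * lambda)^-1 * pi *+ 2) = s * Num.sqrt (pi *+ 2).
    by rewrite -mulrnAr sqrtrM ?invr_ge0 1?ltW// -s2 sqrtr_sqr gtr0_norm.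
  rewrite invfM !mulrA mulfV ?gt_eqF// mul1r; congr (_ * expR _).
  by field; rewrite gt_eqF.
rewrite ge0_integralZl_EFin ?integral_normal_pdf ?mule1 ?ltW//.
- by move=> a _; rewrite lee_fin normal_pdf_ge0.
- by apply/measurable_EFinP; exact: mp.
Qed.

Lemma std_gaussian_laplace (k : nat) (lambda : R) : 0 <= lambda ->
  (\int[@std_gaussian_rV R k]_z (expR (- (lambda * sqnorm z)))%:E =
   ((1 + 2 * lambda) `^ (- (k%:R / 2)))%:E)%E.
Proof.
move=> l0; have b0 : 0 < 1 + 2 * lambda by rewrite ltr_pwDl// mulr_ge0.
have me n : measurable_fun setT (fun z : 'rV[R]_n => (expR (- (lambda * sqnorm z)))%:E).
  apply/measurable_EFinP; apply: measurableT_comp => //; apply: measurableT_comp => //.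
  by apply: measurable_funM => //; exact: measurable_sqnorm.
rewrite /std_gaussian_rV; elim: k => [|k IH].
  transitivity (\int[@std_gaussian_rV R 0]_z 1)%E; last first.
    by rewrite integral_cst// mul1e mul0r oppr0 powRr0; exact: probability_setT.
  apply: eq_integral => z _.
  have -> : z = 0 by apply/rowP => -[].
  by rewrite /sqnorm dot0r mulr0 oppr0 expR0.
rewrite ge0_integral_power_measureS//.
transitivity (\int[normal_prob 0 1]_a ((expR (- (lambda * a ^+ 2)))%:E *
  ((1 + 2 * lambda) `^ (- (k%:R / 2)))%:E))%E.
  apply: eq_integral => a _; rewrite -IH -ge0_integralZl_EFin ?expR_ge0//; last exact: me.
  apply: eq_integral => v _; rewrite -EFinM -expRD; congr (expR _)%:E.
  rewrite /sqnorm -!sqr_enorm enorm_rV_cons sqr_sqrtr ?addr_ge0 ?sqr_ge0//.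
  ring.
have me1 : measurable_fun setT (fun a : R => (expR (- (lambda * a ^+ 2)))%:E).
  apply/measurable_EFinP; apply: measurableT_comp => //; apply: measurableT_comp => //.
  by apply: measurable_funM => //; exact: measurable_funX.
rewrite ge0_integralZr ?lee_fin ?powR_ge0//.
rewrite normal_laplace// -EFinM; congr EFin.
rewrite -powRD; first by congr powR; rewrite -natr1; field.
by rewrite (gt_eqF b0) implybT.
Qed.

End chi_square_laplace.

Section laplace_continuity.
Context {R : realType}.

Lemma expectation_indic d (T : measurableType d) (P : probability T R) (A : set T) :
  measurable A -> fine (P A) = \int[P]_w \1_A w.
Proof. by move=> mA; rewrite /Rintegral integral_indicT. Qed.

Lemma bounded_measurable_indic d (T : measurableType d) (A : set T) : measurable A ->
  bounded_measurable (\1_A : T -> R).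
Proof.
move=> mA; split; first exact: measurable_indic.
by exists 1 => w; rewrite indicE; case: (_ \in _); rewrite ?normr0 ?normr1.
Qed.

Lemma bernoulli_ge (w : R) (m : nat) : 0 <= w <= 1 -> 1 - m%:R * w <= (1 - w) ^+ m.
Proof.
move=> /andP[w0 w1]; elim: m => [|m IH]; first by rewrite mul0r subr0 expr0.
rewrite exprSr (le_trans _ (ler_wpM2r _ IH)) ?subr_ge0//.
rewrite -natr1; have : 0 <= m%:R * w ^+ 2 by rewrite mulr_ge0 ?sqr_ge0.
lra.
Qed.

(** Bernoulli bounds m w by (1 + w)^m, and (1 - w^2)^m is at most 1. *)
Lemma bernoulli_le (w : R) (m : nat) : 0 <= w <= 1 ->
  (1 - w) ^+ m * (m%:R * w) <= 1.
Proof.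
move=> /andP[w0 w1].
have h : 1 + m%:R * w <= (1 + w) ^+ m.
  elim: m => [|m IH]; first by rewrite mul0r addr0 expr0.
  rewrite exprSr (le_trans _ (ler_wpM2r _ IH)) ?addr_ge0//.
  rewrite -natr1; have : 0 <= m%:R * w ^+ 2 by rewrite mulr_ge0 ?sqr_ge0.
  lra.
have ow : 0 <= (1 - w) ^+ m by rewrite exprn_ge0// subr_ge0.
apply: (@le_trans _ _ ((1 - w) ^+ m * (1 + w) ^+ m)).
  by rewrite ler_wpM2l// (le_trans _ h)// lerDr.
rewrite -exprMn exprn_ile1//.
  by rewrite mulr_ge0 ?subr_ge0// addr_ge0.
have := sqr_ge0 w; lra.
Qed.

(* With [y < t < z] and [l = ln 2 / t], the witness [(1 - e^(- m l u))^(2^m)] is close,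
   for large m, to the indicator of [u > t]. *)
Lemma exp_step_approx (y z eps : R) : 0 <= y -> y < z -> 0 < eps ->
  exists (a : R) (M : nat), 0 <= a /\ forall u, 0 <= u ->
    (u <= y -> (1 - expR (- (a * u))) ^+ M <= eps) /\
    (z <= u -> 1 - eps <= (1 - expR (- (a * u))) ^+ M).
Proof.
move=> y0 yz e0; pose t := (y + z) / 2.
have yt : y < t by rewrite /t; lra.
have tz : t < z by rewrite /t; lra.
have t0 : 0 < t by rewrite (le_lt_trans y0).
have l2 : 0 < ln 2 :> R by rewrite ln_gt0// ltr1n.
have [t0' l2'] := (ltW t0, ltW l2).
(* [m * c] bounds from below the size of the exponent in [Mw], both for u <= y and for u >= z; m is
   taken so that this is at least 1/eps. *)
pose c := ln 2 * Num.min (1 - y / t) (z / t - 1).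
have c0 : 0 < c.
  by rewrite mulr_gt0// lt_min !subr_gt0 ltr_pdivrMr// ltr_pdivlMr// !mul1r yt tz.
pose m := Num.bound (eps^-1 / c).
have mc : eps^-1 <= m%:R * c.
  rewrite -ler_pdivrMr// ltW//; apply: le_lt_trans (archi_boundP _) => //.
  by apply: divr_ge0; [rewrite invr_ge0 ltW|exact: ltW].
exists (m%:R * ln 2 / t), (2 ^ m)%N; split.
  by rewrite divr_ge0// mulr_ge0.
move=> u u0; set w := expR _.
have w01 : 0 <= w <= 1.
  by rewrite expR_ge0/= expRN_le1// mulr_ge0// divr_ge0// mulr_ge0.
(* This quantity is large for u < t and small for u > t; the two Bernoulli bounds turn these regimes
   into values near 0 and near 1. *)
have Mw : (2 ^ m)%:R * w = expR (m%:R * (ln 2 * (1 - u / t))).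
  rewrite natrX -[X in X ^+ m](@lnK _ 2) ?posrE// -expRM_natl -expRD; congr expR.
  by rewrite -mulr_natl; field; rewrite gt_eqF.
split => [uy|zu].
- have h : eps^-1 <= (2 ^ m)%:R * w.
    apply: (le_trans mc); rewrite Mw; apply: le_trans (expR_ge1Dx _).
    rewrite -[leLHS]add0r lerD// ler_wpM2l// /c ler_wpM2l//.
    by rewrite ge_min lerD2l lerN2 ler_pM2r ?invr_gt0 ?uy.
  have := bernoulli_le (2 ^ m) w01; rewrite -ler_pdivlMr; last first.
    by rewrite (lt_le_trans _ h)// invr_gt0.
  move=> /le_trans; apply; rewrite mul1r -[leRHS]invrK lef_pV2 ?posrE ?invr_gt0//.
  by rewrite (lt_le_trans _ h)// invr_gt0.
- apply: le_trans (bernoulli_ge _ w01); rewrite lerD2l lerN2.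
  rewrite Mw -[m%:R * _]opprK expRN -[leRHS]invrK lef_pV2 ?posrE ?invr_gt0 ?expR_gt0//.
  apply: (le_trans mc); apply: le_trans (expR_ge1Dx _).
  rewrite -[leLHS]add0r lerD// -[- (m%:R * _)]mulrN ler_wpM2l// /c -[- (ln 2 * _)]mulrN.
  rewrite ler_wpM2l// opprB.
  by rewrite ge_min lerD2r ler_pM2r ?invr_gt0 ?zu ?orbT.
Qed.

Lemma cvg_laplace_cdf (d : nat -> measure_display) (T : forall n, measurableType (d n))
    (P : forall n, probability (T n) R) (Z : forall n, T n -> R)
    (d' : measure_display) (T' : measurableType d') (Q : probability T' R) (U : T' -> R)
    (x : R) :
  (forall n, measurable_fun setT (Z n)) -> (forall n w, 0 <= Z n w) ->
  measurable_fun setT U -> (forall w, 0 <= U w) ->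
  (forall a, 0 <= a -> \int[P n]_w expR (- (a * Z n w)) @[n --> \oo] -->
     \int[Q]_w expR (- (a * U w))) ->
  {for x, continuous (fun y => fine (Q [set w | U w <= y]))} ->
  fine (P n [set w | Z n w <= x]) @[n --> \oo] --> fine (Q [set w | U w <= x]).
Proof.
move=> mZ Z0 mU U0 cvgL cF.
have mZx n y : measurable [set w | Z n w <= y].
  rewrite (_ : [set _ | _] = Z n @^-1` `]-oo, y]%classic).
    by rewrite -[X in measurable X]setTI; exact: mZ.
  by apply/seteqP; split => w; rewrite /= in_itv.
have mUx y : measurable [set w | U w <= y].
  rewrite (_ : [set _ | _] = U @^-1` `]-oo, y]%classic).
    by rewrite -[X in measurable X]setTI; exact: mU.
  by apply/seteqP; split => w; rewrite /= in_itv.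
pose F y := fine (Q [set w | U w <= y]).
pose p n y := fine (P n [set w | Z n w <= y]).
(* The extra factor e^(- b u) closes the induction on M: a further factor 1 - e^(- a u) yields the
   difference of the cases b and a + b. *)
pose r a M b u : R := (1 - expR (- (a * u))) ^+ M * expR (- (b * u)).
have br d1 (T1 : measurableType d1) (V : T1 -> R) a M b : measurable_fun setT V ->
    (forall w, 0 <= V w) -> 0 <= a -> 0 <= b -> bounded_measurable (fun w => r a M b (V w)).
  move=> mV V0 a0 b0; apply: bounded_measurableM.
    apply: bounded_measurableX; apply: bounded_measurableB.
      exact: bounded_measurable_cst.
    by apply: bounded_measurable_expRN; [exact: measurable_funM|move=> w; rewrite mulr_ge0].
  by apply: bounded_measurable_expRN; [exact: measurable_funM|move=> w; rewrite mulr_ge0].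
have cvgr a M : 0 <= a -> forall b, 0 <= b ->
    \int[P n]_w r a M b (Z n w) @[n --> \oo] --> \int[Q]_w r a M b (U w).
  move=> a0; elim: M => [|M IH] b b0.
    rewrite [X in _ --> X](_ : _ = \int[Q]_w expR (- (b * U w))); last first.
      by apply: eq_Rintegral => w _; rewrite /r expr0 mul1r.
    under eq_fun do under eq_Rintegral do rewrite /r expr0 mul1r.
    exact: cvgL.
  have ab0 : 0 <= a + b by rewrite addr_ge0.
  have rS u : r a M.+1 b u = r a M b u - r a M (a + b) u.
    by rewrite /r exprSr mulrDl opprD expRD; ring.
  rewrite [X in _ --> X](_ : _ = \int[Q]_w r a M b (U w) - \int[Q]_w r a M (a + b) (U w)).
    rewrite [X in X @ _ --> _](_ : _ = fun n => \int[P n]_w r a M b (Z n w) -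
        \int[P n]_w r a M (a + b) (Z n w)).
      by apply: cvgB; exact: IH.
    apply/funext => n; rewrite -expectationB; [|exact: br..].
    by apply: eq_Rintegral => w _.
  rewrite -expectationB; [|exact: br..].
  by apply: eq_Rintegral => w _.
have ind d1 (T1 : measurableType d1) (V : T1 -> R) y w : \1_[set w | V w <= y] w = (V w <= y)%R%:R :> R.
  by rewrite indicE; congr (nat_of_bool _)%:R; apply/idP/idP; rewrite inE.
(* The polynomial only separates u <= y from u >= z, so distribution functions are compared at two
   distinct points. *)
have key y z eps : y < z -> 0 < eps ->
    (\forall n \near \oo, p n y <= F z + eps) /\ (\forall n \near \oo, F y <= p n z + eps).
  move=> yz e0; have [y0|y0] := ltP y 0.
    split; near=> n.
    - rewrite /p (_ : [set _ | _] = set0) ?measure0/=.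
        by rewrite addr_ge0 ?(ltW e0)// fine_ge0.
      by apply/seteqP; split => w //=; rewrite leNgt (lt_le_trans y0).
    - rewrite /F (_ : [set _ | _] = set0) ?measure0/=.
        by rewrite addr_ge0 ?(ltW e0)// fine_ge0.
      by apply/seteqP; split => w //=; rewrite leNgt (lt_le_trans y0).
  have e30 : 0 < eps / 3 by rewrite divr_gt0.
  have [a [M [a0 aM]]] := exp_step_approx y0 yz e30.
  have rU u : 0 <= u -> (1 - expR (- (a * u))) ^+ M = r a M 0 u.
    by move=> _; rewrite /r mul0r oppr0 expR0 mulr1.
  have r01 u : 0 <= u -> 0 <= r a M 0 u <= 1.
    move=> u0; rewrite -rU// exprn_ge0 ?subr_ge0 ?expRN_le1 ?mulr_ge0//=.
    by rewrite exprn_ile1 ?subr_ge0 ?expRN_le1 ?mulr_ge0// gerBl expR_ge0.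
  have lo d1 (T1 : measurableType d1) (P1 : probability T1 R) (V : T1 -> R) :
      measurable_fun setT V -> (forall w, 0 <= V w) -> measurable [set w | V w <= y] ->
      fine (P1 [set w | V w <= y]) <= 1 - \int[P1]_w r a M 0 (V w) + eps / 3.
    move=> mV V0 mVy; rewrite expectation_indic//.
    have b1 := br _ _ V a M 0 mV V0 a0 (lexx 0).
    rewrite -[X in X - _](expectation_cst P1) -expectationB//; last exact: bounded_measurable_cst.
    rewrite -[X in _ + X](expectation_cst P1) -expectationD//; last 2 first.
      by apply: bounded_measurableB => //; exact: bounded_measurable_cst.
      exact: bounded_measurable_cst.
    apply: le_expectation.
    - exact: bounded_measurable_indic.
    - apply: bounded_measurableD; last exact: bounded_measurable_cst.
      by apply: bounded_measurableB => //; exact: bounded_measurable_cst.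
    - move=> w; rewrite ind; have [h _] := aM _ (V0 w).
      have /andP[_ r1] := r01 _ (V0 w).
      case: (boolP (V w <= y)) => [/h|_] /=; last by lra.
      by rewrite rU//; lra.
  have hi d1 (T1 : measurableType d1) (P1 : probability T1 R) (V : T1 -> R) :
      measurable_fun setT V -> (forall w, 0 <= V w) -> measurable [set w | V w <= z] ->
      1 - \int[P1]_w r a M 0 (V w) <= fine (P1 [set w | V w <= z]) + eps / 3.
    move=> mV V0 mVy; rewrite expectation_indic//.
    have b1 := br _ _ V a M 0 mV V0 a0 (lexx 0).
    have b2 := bounded_measurable_indic mVy.
    rewrite -[X in X - _](expectation_cst P1) -expectationB//; last exact: bounded_measurable_cst.
    rewrite -[X in _ + X](expectation_cst P1) -expectationD//; last exact: bounded_measurable_cst.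
    apply: le_expectation.
    - by apply: bounded_measurableB => //; exact: bounded_measurable_cst.
    - by apply: bounded_measurableD => //; exact: bounded_measurable_cst.
    - move=> w; rewrite ind; have [_ h] := aM _ (V0 w).
      have /andP[r0 _] := r01 _ (V0 w).
      case: (leP (V w) z) => [_|/ltW/h] /=; first by lra.
      by rewrite rU//; lra.
  have /cvgrPdist_le/(_ _ e30) c := cvgr a M a0 0 (lexx 0).
  split.
  - near=> n.
    have := lo _ _ (P n) (Z n) (mZ n) (Z0 n) (mZx n y).
    have := hi _ _ Q U mU U0 (mUx z).
    have : `|\int[Q]_w r a M 0 (U w) - \int[P n]_w r a M 0 (Z n w)| <= eps / 3 by near: n.
    by rewrite ler_norml -/(p n y) -/(F z) => /andP[]; lra.
  - near=> n.
    have := lo _ _ Q U mU U0 (mUx y).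
    have := hi _ _ (P n) (Z n) (mZ n) (Z0 n) (mZx n z).
    have : `|\int[Q]_w r a M 0 (U w) - \int[P n]_w r a M 0 (Z n w)| <= eps / 3 by near: n.
    by rewrite ler_norml -/(p n z) -/(F y) => /andP[]; lra.
apply/cvgrPdist_le => eps e0.
have e20 : 0 < eps / 2 by rewrite divr_gt0.
have /cvgrPdist_le/(_ _ e20) := cF.
rewrite -/F => /nbhs_ballP[del /= del0 hdel].
(* Continuity at x closes the gap between the two comparison points, on each side of x. *)
have xl : `|F x - F (x - del / 2)| <= eps / 2.
  apply: hdel; rewrite /ball /= opprB addrC subrK ger0_norm ?divr_ge0 ?ltW//; lra.
have xr : `|F x - F (x + del / 2)| <= eps / 2.
  apply: hdel; rewrite /ball /= opprD addrA subrr add0r normrN ger0_norm ?divr_ge0 ?ltW//; lra.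
have [k1 _] := key x (x + del / 2) (eps / 2) ltac:(lra) e20.
have [_ k2] := key (x - del / 2) x (eps / 2) ltac:(lra) e20.
near=> n; rewrite -/(F x) -/(p n x).
have : p n x <= F (x + del / 2) + eps / 2 by near: n.
have : F (x - del / 2) <= p n x + eps / 2 by near: n.
move: xl xr; rewrite !ler_norml => /andP[h1 h2] /andP[h3 h4] h5 h6.
by apply/andP; split; lra.
Unshelve. all: by end_near.
Qed.

End laplace_continuity.

(** * Concentration at the mode *)

Section beta_weight.
Context {R : realType}.
Local Notation mu := (@lebesgue_measure R).
Local Notation D := (`](- 1)%R, 1%R[%classic : set R).

Definition beta_weight (beta s : R) : R := (1 - s ^+ 2) `^ beta.

Lemma beta_weight_ge0 beta s : 0 <= beta_weight beta s.
Proof. exact: powR_ge0. Qed.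

Lemma measurable_beta_weight beta : measurable_fun setT (beta_weight beta).
Proof. exact: measurable_onem_sqr_powR. Qed.

Lemma in_D (s : R) : D s -> 0 < 1 - s ^+ 2.
Proof. by rewrite /= in_itv/= onem_sqr_gt0. Qed.

Lemma beta_weightD1 beta s : D s ->
  beta_weight (beta + 1) s = beta_weight beta s * (1 - s ^+ 2).
Proof.
move=> /in_D s1; rewrite /beta_weight powRD ?powRr1 ?ltW//.
by rewrite (gt_eqF s1) implybT.
Qed.

(** For p = 2 the weight is unbounded at both ends. Integrability is read off the geometry: a
    constant times its integral is the area of the sphere, which is positive and finite. *)
Lemma integrable_beta_weight (p : nat) : (1 < p)%N ->
  mu.-integrable D (EFin \o beta_weight ((p%:R - 3) / 2)).
Proof.
case: p => [//|n] n0.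
have [J J0 JE] := @surface_measure_dotr R n.+1 (first_basis n) n0 (@enorm_first_basis R n).
have := JE setT measurableT.
have -> : [set x : 'rV[R]_n.+1 | [set: R] (dotr x (first_basis n))] = setT by [].
set w := beta_weight _.
have mw : measurable_fun setT w by exact: measurable_beta_weight.
have iw0 : (0 <= \int[mu]_(s in D) (w s)%:E)%E.
  by apply: integral_ge0 => s _; rewrite lee_fin beta_weight_ge0.
have -> : (\int[mu]_(s in D) (J * ((1 - s ^+ 2) `^ ((n.+1%:R - 3) / 2) * \1_setT s))%:E =
    J%:E * \int[mu]_(s in D) (w s)%:E)%E.
  rewrite -ge0_integralZl_EFin//.
  - by apply: eq_integral => s _; rewrite indicT mulr1 EFinM.
  - by move=> s _; rewrite lee_fin beta_weight_ge0.
  - by apply/measurable_EFinP; exact: measurable_funTS.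
rewrite /surface_measure preimage_setT setTI.
have Bpos : (0 < @lebesgue_rV R n.+1 (punctured_ball n.+1))%E.
  have := @lebesgue_rV_unit_ball_gt0 R n.+1.
  have -> : @unit_ball R n.+1 = punctured_ball n.+1 `|` [set 0].
    apply/seteqP; split => x; rewrite /unit_ball /punctured_ball /=.
      move=> x1; have [->|x0] := eqVneq x 0; first by right.
      by left; rewrite enorm_gt0 x0.
    by move=> [/andP[]//|->]; rewrite /enorm dot0r sqrtr0.
  move=> h; rewrite lt0e measure_ge0 andbT; apply/eqP => B0.
  move: h; rewrite ltNge => /negP; apply.
  have m0 : measurable [set 0 : 'rV[R]_n.+1].
    rewrite (_ : [set 0%R] = @cube R n.+1 0); first exact: measurable_cube.
    apply/seteqP; split => x /=; first by move=> -> i; rewrite mxE normr0.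
    by move=> x0; apply/rowP => i; apply/eqP; rewrite mxE -normr_le0 x0.
  have := @measureU2 _ _ _ (@lebesgue_rV R n.+1) _ _ (@measurable_punctured_ball R n.+1) m0.
  move/le_trans; apply.
  rewrite le_eqVlt; apply/orP; left; apply/eqP.
  transitivity (0 + 0 : \bar R)%E; last by rewrite adde0.
  by congr (_ + _)%E; [exact: B0|exact: lebesgue_rV_set0].
have Blty : (@lebesgue_rV R n.+1 (punctured_ball n.+1) < +oo)%E.
  apply: le_lt_trans (@lebesgue_rV_unit_ball_lty R n.+1).
  apply: le_measure; rewrite ?inE.
  - exact: measurable_punctured_ball.
  - exact: measurable_unit_ball.
  - by move=> x /andP[].
move=> E; apply/integrableP; split.
  by apply/measurable_EFinP; exact: measurable_funTS.
under eq_integral do rewrite /= ger0_norm ?beta_weight_ge0//.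
rewrite ltNge leye_eq; apply/negP => /eqP Ioo.
have : (n.+1%:R%:E * @lebesgue_rV R n.+1 (punctured_ball n.+1) < +oo)%E.
  by rewrite lte_mul_pinfty ?lee_fin.
have : (0 < n.+1%:R%:E * @lebesgue_rV R n.+1 (punctured_ball n.+1))%E.
  by rewrite mule_gt0// lte_fin.
(* J = 0 would make a positive area vanish, J > 0 would make a finite one infinite. *)
rewrite E Ioo; move: J0; rewrite le_eqVlt => /predU1P[<-|J0].
  by rewrite mul0e ltxx.
by rewrite gt0_muley ?lte_fin// ltxx.
Qed.

Section weighted.
Variable beta : R.
Hypothesis ibeta : mu.-integrable D (EFin \o beta_weight beta).

Lemma integrable_weighted (g : R -> R) (M : R) : measurable_fun setT g ->
  (forall s, D s -> `|g s| <= M) ->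
  mu.-integrable D (EFin \o (fun s =>
    beta_weight beta s * g s)).
Proof.
move=> mg gM.
apply: (@le_integrable _ _ _ mu D _ _ (fun s => (M%:E * (beta_weight beta s)%:E)%E)).
- by [].
- apply/measurable_EFinP/measurable_funTS; apply: measurable_funM => //.
  exact: measurable_beta_weight.
- move=> s Ds; rewrite /= lee_fin !normrM (ger0_norm (beta_weight_ge0 _ _)).
  by rewrite mulrC ler_wpM2r ?beta_weight_ge0// (le_trans (gM s Ds))// ler_norm.
- by apply: integrableZl.
Qed.

(** Unnormalized moment of the exponentially tilted density; the shift by 1 keeps the exponential at
    most 1. *)
Definition exp_moment (tau : R) (g : R -> R) : R :=
  \int[mu]_(s in D) (beta_weight beta s * (g s * expR ((s - 1) * tau))).

Lemma exp_le1 (tau s : R) : 0 <= tau -> D s -> expR ((s - 1) * tau) <= 1.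
Proof.
move=> t0; rewrite /= in_itv/= => /andP[_ s1].
by rewrite -[leRHS]expR0 ler_expR mulr_le0_ge0// subr_le0 ltW.
Qed.

Lemma measurable_exp (tau : R) : measurable_fun setT (fun s : R => expR ((s - 1) * tau)).
Proof.
apply: measurableT_comp => //; apply: measurable_funM => //.
exact: measurable_funB.
Qed.

Lemma integrable_exp_moment (tau : R) (g : R -> R) (M : R) : 0 <= tau ->
  measurable_fun setT g -> (forall s, D s -> `|g s| <= M) ->
  mu.-integrable D (EFin \o (fun s =>
    beta_weight beta s * (g s * expR ((s - 1) * tau)))).
Proof.
move=> t0 mg gM; apply: (@integrable_weighted _ M).
  by apply: measurable_funM => //; exact: measurable_exp.
move=> s Ds; rewrite normrM (ger0_norm (expR_ge0 _)).
rewrite (le_trans _ (gM s Ds))// ler_piMr//.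
exact: exp_le1.
Qed.

Lemma is_derive_weight_exp (tau s : R) : D s ->
  is_derive s 1 (fun s => beta_weight (beta + 1) s * expR ((s - 1) * tau))
    (beta_weight beta s * ((tau * (1 - s ^+ 2) - 2 * (beta + 1) * s) * expR ((s - 1) * tau))).
Proof.
move=> Ds; have s1 := in_D Ds.
have h1 := is_derive_onem_sqr_powR (beta + 1) s1.
have h2 : is_derive s 1 (fun s => expR ((s - 1) * tau)) (expR ((s - 1) * tau) * tau).
  apply: is_derive_expR_comp; apply: is_derive_eq; rewrite /GRing.scale /=; ring.
rewrite /beta_weight; apply: is_derive_eq; rewrite /GRing.scale /=.
have -> : beta + 1 - 1 = beta by ring.
have := beta_weightD1 beta Ds; rewrite /beta_weight => ->; ring.
Qed.

(** The difference of the two sides is the integral of the derivative of (1 - s^2)^(beta + 1) e^((s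
    - 1) tau), a function that vanishes at both ends because beta > -1. *)
Lemma exp_moment_ibp (tau : R) : -1 < beta -> 0 <= tau ->
  tau * exp_moment tau (fun s => 1 - s ^+ 2) = 2 * (beta + 1) * exp_moment tau id.
Proof.
move=> b1 t0.
pose F s := beta_weight (beta + 1) s * expR ((s - 1) * tau).
pose k s := tau * (1 - s ^+ 2) - 2 * (beta + 1) * s.
pose h s := beta_weight beta s * (k s * expR ((s - 1) * tau)).
have mk : measurable_fun setT k.
  apply: measurable_funB; apply: measurable_funM => //.
  by apply: measurable_funB => //; exact: measurable_funX.
have abs1 s : D s -> `|s| <= 1.
  by rewrite /= in_itv/= => /andP[? ?]; rewrite ler_norml !ltW.
have sqr1 s : D s -> `|1 - s ^+ 2| <= 1.
  by move=> /in_D s1; rewrite (ger0_norm (ltW s1)) gerBl sqr_ge0.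
have kM s : D s -> `|k s| <= tau + 2 * (beta + 1).
  move=> Ds; have b2 : 0 <= 2 * (beta + 1) by lra.
  rewrite (le_trans (ler_normB _ _))// lerD//.
    by rewrite normrM (ger0_norm t0) ler_piMr// sqr1.
  by rewrite normrM (ger0_norm b2) ler_piMr// abs1.
have ih := integrable_exp_moment t0 mk kM.
have im1 : mu.-integrable D (EFin \o (fun s =>
    beta_weight beta s * ((1 - s ^+ 2) * expR ((s - 1) * tau)))).
  apply: (@integrable_exp_moment _ _ 1) => //.
  by apply: measurable_funB => //; exact: measurable_funX.
have im2 : mu.-integrable D (EFin \o (fun s =>
    beta_weight beta s * (s * expR ((s - 1) * tau)))).
  exact: (@integrable_exp_moment _ (fun s => s) 1).
suff : \int[mu]_(s in D) h s = 0.
  have -> : \int[mu]_(s in D) h s = \int[mu]_(s in D) (tau *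
      (beta_weight beta s * ((1 - s ^+ 2) * expR ((s - 1) * tau))) - 2 * (beta + 1) *
      (beta_weight beta s * (s * expR ((s - 1) * tau)))).
    by apply: eq_Rintegral => s _; rewrite /h /k; ring.
  rewrite RintegralB//; last 2 first.
  - by apply: (integrableZl _ _ im1).
  - by apply: (integrableZl _ _ im2).
  rewrite !RintegralZl// => /eqP; rewrite subr_eq0 => /eqP.
  by rewrite /exp_moment.
(* The derivative may be singular at the ends, so the integral is first taken over [- r m, r m] and
   then passed to the limit by domination. *)
pose t (m : nat) : R := m.+1%:R^-1.
pose r (m : nat) : R := 1 - t m / 2.
have t01 (m : nat) : 0 < t m <= 1.
  by rewrite /t invr_gt0 ltr0n/= invf_le1 ?ler1n// ltr0n.
have rD m s : `[- r m, r m]%classic s -> D s.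
  rewrite /= !in_itv/= => /andP[s1 s2]; have /andP[t1 _] := t01 m.
  by rewrite /r in s1 s2; apply/andP; split; lra.
have FTC m : (\int[mu]_(s in `[(- r m)%R, r m]) (h s)%:E = (F (r m) - F (- r m))%:E)%E.
  rewrite EFinB; apply: continuous_FTC2_is_derive.
  - by have /andP[t1 t2] := t01 m; rewrite /r; lra.
  - by move=> s sr; apply: is_derive_weight_exp; apply: (rD m); rewrite /= in_itv.
  - move=> s sr; have /in_D s1 : D s by apply: (rD m); rewrite /= in_itv.
    apply: cvgM; first exact: continuous_onem_sqr_powR.
    have dk : is_derive s 1 (fun s => k s * expR ((s - 1) * tau))
        ((- 2 * tau * s - 2 * (beta + 1)) * expR ((s - 1) * tau) +
         k s * (expR ((s - 1) * tau) * tau)).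
      have h2 : is_derive s 1 (fun s => expR ((s - 1) * tau)) (expR ((s - 1) * tau) * tau).
        apply: is_derive_expR_comp; apply: is_derive_eq; rewrite /GRing.scale /=; ring.
      rewrite /k; apply: is_derive_eq; rewrite /GRing.scale /= /k; ring.
    have cdk : {for s, continuous (fun s => k s * expR ((s - 1) * tau))}.
      by apply: differentiable_continuous; exact/derivable1_diffP/ex_derive.
    exact: cdk.
have F0 m : 0 <= F (r m) <= t m `^ (beta + 1) /\
            0 <= F (- r m) <= t m `^ (beta + 1).
  have /andP[t1 t2] := t01 m.
  have rm : D (r m) /\ D (- r m).
    by rewrite /= !in_itv/= /r; split; apply/andP; split; lra.
  have W : beta_weight (beta + 1) (r m) <= t m `^ (beta + 1).
    have [/in_D r1 _] := rm.
    rewrite /beta_weight ge0_ler_powR ?nnegrE ?(ltW r1) ?(ltW t1)//; first by lra.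
    (* Indeed 1 - (1 - t/2)^2 = t - t^2/4 <= t. *)
    have := sqr_ge0 (t m); rewrite /r; lra.
  have WN : beta_weight (beta + 1) (- r m) = beta_weight (beta + 1) (r m).
    by rewrite /beta_weight sqrrN.
  have [D1 D2] := rm.
  rewrite /F WN !mulr_ge0 ?powR_ge0 ?expR_ge0//=.
  by split; rewrite (le_trans _ W)// ler_piMr ?powR_ge0// exp_le1.
have cF : F (r m) - F (- r m) @[m --> \oo] --> 0.
  apply/cvgrPdist_le => e e0.
  have be0 : 0 < beta + 1 by lra.
  have q0 : 0 < e `^ (beta + 1)^-1 by exact: powR_gt0.
  have /cvgrPdist_le/(_ _ q0) := @cvg_harmonic R.
  apply: filterS => m; rewrite sub0r normrN => hm.
  have {}hm : t m `^ (beta + 1) <= e.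
    have -> : e = (e `^ (beta + 1)^-1) `^ (beta + 1).
      by rewrite -powRrM mulVf ?gt_eqF// powRr1// ltW.
    have /andP[t1 _] := t01 m.
    rewrite ge0_ler_powR ?nnegrE ?(ltW t1) ?(ltW q0)//; first exact: ltW.
    by rewrite (le_trans _ hm)// ger0_norm// ltW.
  have [/andP[a1 a2] /andP[a3 a4]] := F0 m.
  by rewrite sub0r normrN ler_norml; apply/andP; split; lra.
pose f_ (m : nat) : R -> \bar R := (EFin \o h) \_ `[(- r m), r m]%classic.
have mh : measurable_fun D (EFin \o h) by exact: measurable_int ih.
have mf_ m : measurable_fun D (f_ m).
  apply/(measurable_restrict _ _ _) => //.
  by apply: measurable_funS mh => // s [].
have := @dominated_convergence _ _ _ mu D _ f_ (EFin \o h) (fun s => `|(h s)%:E|%E) mf_ mh.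
case=> //.
- apply: aeW => s Ds.
  apply: cvg_near_cst.
  have Ds' : `|s| < 1 by move: Ds; rewrite /= in_itv/= -ltr_norml.
  have q0 : 0 < 1 - `|s| by rewrite subr_gt0.
  have /cvgrPdist_le/(_ _ q0) := @cvg_harmonic R.
  apply: filterS => m; rewrite sub0r normrN => hm.
  rewrite /f_ patchE mem_set//= in_itv/= -ler_norml /r.
  have /andP[t1 _] := t01 m.
  have {}hm : t m <= 1 - `|s| by move: hm; rewrite (ger0_norm (ltW t1)).
  lra.
- exact: integrable_abse.
- apply: aeW => s m Ds; rewrite /f_ patchE; case: ifPn => _ //.
  by rewrite abse0.
move=> _ _ c2.
have E0 : (\int[mu]_(x in D) (EFin \o h) x = 0)%E.
  apply: (cvg_unique _ c2) => //.
  rewrite (_ : (fun n => _) = EFin \o (fun m => F (r m) - F (- r m))); last first.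
    apply/funext => m; rewrite /f_ -integral_mkcondr /= -FTC; congr (integral _ _ _).
    by apply/seteqP; split => [s []//|s sr]; split => //; exact: (rD m).
  by apply: cvg_EFin; [exact: nearW | exact: cF].
by rewrite /Rintegral E0.
Qed.

Lemma powR_half_two (x b : R) : 2^-1 <= x <= 2 -> 2 `^ (- `|b|) <= x `^ b.
Proof.
move=> /andP[x1 x2]; have x0 : 0 < x by rewrite (lt_le_trans _ x1).
have [b0|b0] := leP 0 b.
  rewrite (ger0_norm b0).
  have -> : 2 `^ (- b) = 2^-1 `^ b by rewrite -(powR_inv1 (ler0n R 2)) -powRrM mulN1r.
  by rewrite ge0_ler_powR ?nnegrE// ltW.
rewrite (ltr0_norm b0); have : 0 <= - b by rewrite oppr_ge0 ltW.
rewrite -{3}[b]opprK; move: (- b) => c c0.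
rewrite !powRN lef_pV2 ?posrE ?powR_gt0//.
by rewrite ge0_ler_powR ?nnegrE ?(ltW x0).
Qed.

(** Only the s with 1/2 <= (1 - s) tau <= 1 are kept, an interval of length 1/(2 tau). There the
    exponential is at least e^(-1), and the factors ((1 - s) tau)^beta and (1 + s)^beta each cost at
    most 2^(-|beta|). *)
Lemma exp_moment_lower (tau : R) : 1 <= tau ->
  2 `^ (- `|beta|) ^+ 2 * expR (- 1) / 2 * (tau `^ (beta + 1))^-1 <= exp_moment tau (cst 1).
Proof.
move=> t1; have t0 : 0 < tau by rewrite (lt_le_trans _ t1).
have tV : 0 < tau^-1 <= 1 by rewrite invr_gt0 t0 invf_le1.
move: (tV) => /andP[tV0 tV1].
pose a := 1 - tau^-1; pose b := 1 - tau^-1 / 2.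
pose c := 2 `^ (- `|beta|) ^+ 2 * (tau `^ beta)^-1 * expR (- 1).
have c0 : 0 <= c by rewrite !mulr_ge0 ?invr_ge0 ?powR_ge0 ?expR_ge0 ?exprn_ge0 ?powR_ge0.
pose h s := beta_weight beta s * (cst 1 s * expR ((s - 1) * tau)).
have ih : mu.-integrable D (EFin \o h).
  by apply: (@integrable_exp_moment _ (cst 1) 1) => //; rewrite ?ltW// => s _ /=; rewrite normr1.
have abD s : `[a, b]%classic s -> D s.
  by rewrite /= !in_itv/= /a /b => /andP[? ?]; apply/andP; split; lra.
have ch s : `[a, b]%classic s -> c <= h s.
  move=> sab; move: (sab); rewrite /= in_itv/= => /andP[sa sb].
  have Ds := abD _ sab; rewrite /h /= mul1r /c.
  have s1 : 0 <= 1 + s by move: Ds; rewrite /= in_itv/= => /andP[? ?]; lra.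
  pose x := (1 - s) * tau.
  have x12 : 2^-1 <= x <= 1.
    have tt : tau^-1 * tau = 1 by rewrite mulVf// gt_eqF.
    rewrite /a in sa; rewrite /b in sb.
    have e1 : tau^-1 / 2 <= 1 - s by lra.
    have e2 : 1 - s <= tau^-1 by lra.
    have := ler_wpM2r (ltW t0) e1; have := ler_wpM2r (ltW t0) e2.
    by rewrite mulrAC tt mul1r -/x => -> ->.
  have xE : 1 - s ^+ 2 = x * (tau^-1 * (1 + s)) by rewrite /x; field; rewrite gt_eqF.
  have x0 : 0 <= x by case/andP: x12 => x1 _; rewrite (le_trans _ x1).
  have tb : tau^-1 `^ beta = (tau `^ beta)^-1.
    by rewrite -powR_inv1 ?(ltW t0)// -powRrM mulN1r powRN.
  have ts0 : 0 <= tau^-1 * (1 + s) by rewrite mulr_ge0// ltW.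
  have -> : beta_weight beta s = x `^ beta * ((tau `^ beta)^-1 * (1 + s) `^ beta).
    by rewrite /beta_weight xE (powRM _ x0 ts0) (powRM _ (ltW tV0) s1) tb.
  have k1 : 2 `^ (- `|beta|) <= x `^ beta by apply: powR_half_two; case/andP: x12 => -> /= x1; lra.
  have k2 : 2 `^ (- `|beta|) <= (1 + s) `^ beta.
    by apply: powR_half_two; move: sa sb; rewrite /a /b => ? ?; apply/andP; split; lra.
  have k3 : expR (- 1) <= expR ((s - 1) * tau).
    rewrite ler_expR; have -> : (s - 1) * tau = - x by rewrite /x; ring.
    by rewrite lerN2; case/andP: x12.
  apply: ler_pM => //.
    by rewrite mulr_ge0 ?invr_ge0 ?powR_ge0// exprn_ge0 ?powR_ge0.
  rewrite expr2 -mulrA ler_pM ?powR_ge0//.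
    by rewrite mulr_ge0 ?powR_ge0// invr_ge0 powR_ge0.
  by rewrite mulrC ler_wpM2l ?invr_ge0 ?powR_ge0.
have h0 s : 0 <= h s by rewrite !mulr_ge0 ?powR_ge0 ?expR_ge0.
have -> : 2 `^ (- `|beta|) ^+ 2 * expR (- 1) / 2 * (tau `^ (beta + 1))^-1 = c * (b - a).
  rewrite powRD; last by rewrite (gt_eqF t0) implybT.
  rewrite powRr1 ?(ltW t0)// /c /a /b; field.
  by rewrite !gt_eqF ?powR_gt0.
rewrite -lee_fin /exp_moment -/h.
have -> : ((\int[mu]_(s in D) h s)%:E = \int[mu]_(s in D) (h s)%:E)%E.
  by rewrite /Rintegral fineK//; exact: (integrable_fin_num _ ih).
have mh : measurable_fun D (EFin \o h) by exact: measurable_int ih.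
apply: (@le_trans _ _ (\int[mu]_(s in `[a, b]) (h s)%:E)%E); last first.
  by apply: ge0_subset_integral => //; move=> s _; rewrite lee_fin.
have -> : ((c * (b - a))%:E = \int[mu]_(s in `[a, b]) c%:E)%E.
  rewrite integral_cst//= -[X in (_ * X)%E]/(@lebesgue_measure R `[a, b]%classic).
  rewrite lebesgue_measure_itv/= lte_fin ifT ?EFinM//.
  by rewrite /a /b; lra.
apply: ge0_le_integral => //.
exact: measurable_funS mh.
Qed.

End weighted.
End beta_weight.

Lemma near_cvg_seq (R : realType) (u v : nat -> R) (l : R) :
  (\forall n \near \oo, u n = v n) -> v n @[n --> \oo] --> l -> u n @[n --> \oo] --> l.
Proof.
move=> uv vl; apply: cvg_trans vl; apply: near_eq_cvg.
by apply: filterS uv => n ->.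
Qed.

(** * Moments of the projection on theta for densities in the class F *)

Section class_F_theory.
Context {R : realType}.
Local Notation mu := (@lebesgue_measure R).
Local Notation D := (`](- 1)%R, 1%R[%classic : set R).
Variable f : R -> R.
Hypothesis hf : class_F f.

Lemma class_F_nondecreasing_fun : {homo f : x y / x <= y}.
Proof.
move=> x y xy; have incr (a b : R) : 0 <= a -> a <= b -> f a <= f b.
  move=> a0; rewrite le_eqVlt => /predU1P[->//|ab].
  by rewrite ltW// (class_F_increasing hf)// in_itv/= andbT// (le_trans a0)// ltW.
have [x0|x0] := leP 0 x; first exact: incr.
have [y0|y0] := leP y 0.
  by rewrite (class_F_nondecreasing hf)// in_itv/= ?(ltW x0)// y0.
apply: (@le_trans _ _ (f 0)); last by apply: incr => //; exact: ltW.
by rewrite (class_F_nondecreasing hf)// ?in_itv/= ?lexx// ltW.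
Qed.

Lemma class_F_measurable : measurable_fun setT f.
Proof. by apply: nondecreasing_measurable => //; exact: class_F_nondecreasing_fun. Qed.

Lemma class_F_gt0 x : 0 < x -> 0 < f x.
Proof.
move=> x0; apply: (le_lt_trans (class_F_ge0 hf 0)).
by rewrite (class_F_increasing hf)// in_itv/= ?lexx ?(ltW x0).
Qed.

Lemma expratioE k s : 0 < k -> expratio f k s = f (k * s) / f k.
Proof.
move=> /class_F_gt0 fk; rewrite /expratio (lne_EFin fk) /lne.
(* Where f vanishes, the convention log 0 = -oo makes [expratio] equal to 0, as required. *)
have := class_F_ge0 hf (k * s); rewrite le_eqVlt => /predU1P[<-|fks].
  by rewrite lexx /= mul0r.
by rewrite leNgt fks/= expRB !lnK ?posrE.
Qed.

Lemma ratio_bound k s : 0 < k -> D s -> 0 <= f (k * s) / f k <= 1.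
Proof.
move=> k0; rewrite /= in_itv/= => /andP[_ s1]; have fk := class_F_gt0 k0.
rewrite divr_ge0 ?(class_F_ge0 hf)//= ler_pdivrMr// mul1r.
by apply: class_F_nondecreasing_fun; rewrite ger_pMr// ltW.
Qed.

Variable p : nat.
Hypothesis p2 : (1 < p)%N.
Let alpha : R := (p%:R - 3) / 2.

Let alpha1 : -1 < alpha.
Proof.
have : 2 <= p%:R :> R by rewrite ler_nat.
by rewrite /alpha ltr_pdivlMr//; lra.
Qed.

Let ialpha : mu.-integrable D (EFin \o beta_weight alpha).
Proof. exact: integrable_beta_weight. Qed.

(** Counterpart of [exp_moment] for the actual density; division by [f k] bounds the ratio by 1 and
    gives the form compared in condition (iv). *)
Definition ratio_moment (k : R) (g : R -> R) : R :=
  \int[mu]_(s in D) (beta_weight alpha s * (g s * (f (k * s) / f k))).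

Lemma measurable_ratio k : measurable_fun setT (fun s : R => f (k * s) / f k).
Proof.
apply: measurable_funM => //; apply: measurableT_comp; first exact: class_F_measurable.
exact: measurable_funM.
Qed.

Lemma integrable_ratio_moment (k : R) (g : R -> R) (M : R) : 0 < k ->
  measurable_fun setT g -> (forall s, D s -> `|g s| <= M) ->
  mu.-integrable D (EFin \o (fun s => beta_weight alpha s * (g s * (f (k * s) / f k)))).
Proof.
move=> k0 mg gM; apply: (integrable_weighted ialpha (M := M)).
  by apply: measurable_funM => //; exact: measurable_ratio.
move=> s Ds; have /andP[r0 r1] := ratio_bound k0 Ds.
by rewrite normrM (ger0_norm r0) (le_trans _ (gM s Ds))// ler_piMr.
Qed.

Lemma expectation_ratio_moment (theta : 'rV[R]_p) (kappa : R)
    d (T : measurableType d) (P : probability T R) (X : {RV P >-> 'rV[R]_p})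
    (g : R -> R) (M : R) :
  enorm theta = 1 -> 0 < kappa ->
  (forall B, measurable B -> distribution P X B =
    (\int[surface_measure (p:=p)]_(x in B) (sphere_density theta kappa f x)%:E)%E) ->
  measurable_fun setT g -> (forall s, 0 <= g s) -> (forall s, D s -> `|g s| <= M) ->
  \int[P]_w g (dotr (X w) theta) = ratio_moment kappa g / ratio_moment kappa (cst 1).
Proof.
move=> theta1 k0 lawX mg g0 gM.
have [C CE] := expectation_dotr_theta p2 theta1 (class_F_ge0 hf) class_F_measurable lawX.
have fk := class_F_gt0 k0.
have EE (h : R -> R) N : measurable_fun setT h -> (forall s, 0 <= h s) ->
    (forall s, D s -> `|h s| <= N) ->
    \int[P]_w h (dotr (X w) theta) = C * f kappa * ratio_moment kappa h.
  move=> mh h0 hN; rewrite {1}/Rintegral CE//.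
  rewrite integral_itv_bndoo; last first.
    apply/measurable_EFinP/measurable_funTS; apply: measurable_funM => //.
    apply: measurable_funM => //; apply: measurable_funM.
      exact: measurable_onem_sqr_powR.
    by apply: measurableT_comp; [exact: class_F_measurable|exact: measurable_funM].
  rewrite /ratio_moment -RintegralZl//; last exact: integrable_ratio_moment hN.
  congr fine; apply: eq_integral => s _; congr EFin.
  by rewrite /beta_weight /alpha; field; rewrite gt_eqF.
(* The case g = 1 has expectation 1 and thereby determines the constant. *)
have := EE (cst 1) 1 (@measurable_cst _ _ _ _ _ _) (fun=> ler01)
  (fun s _ => ltac:(by rewrite /= normr1)).
rewrite expectation_cst => E1; rewrite (EE g M)//.
have I0 : ratio_moment kappa (cst 1) != 0.
  apply/eqP => I0; move: E1; rewrite I0 mulr0 => /eqP; by rewrite oner_eq0.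
by apply/(mulIf I0); rewrite mulfVK// mulrAC -E1 mul1r.
Qed.

Section asymptotics.
Variable kappa : nat -> R.
Hypotheses (kappa0 : forall n, 0 < kappa n) (kappay : kappa n @[n --> \oo] --> +oo).

Let tau n := kappa n * phi f (kappa n).
Let J n g := exp_moment alpha (tau n) g.
Let I n g := ratio_moment (kappa n) g.

Lemma class_F_tau_dvg : tau n @[n --> \oo] --> +oo.
Proof. exact: (cvg_comp _ _ kappay (class_F_dvg hf)). Qed.

Lemma near_ge_tau (M : R) : \forall n \near \oo, M <= tau n.
Proof. by have /cvgryPge := class_F_tau_dvg; exact. Qed.

Lemma cvg_tauV : (tau n)^-1 @[n --> \oo] --> 0.
Proof.
apply/cvgrPdist_le => e e0; near=> n.
have te : e^-1 <= tau n by near: n; exact: near_ge_tau.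
have t0 : 0 < tau n by rewrite (lt_le_trans _ te)// invr_gt0.
by rewrite sub0r normrN ger0_norm ?invr_ge0 ?(ltW t0)// -[leRHS]invrK lef_pV2 ?posrE ?invr_gt0.
Unshelve. all: by end_near.
Qed.

Let c : R := 2 `^ (- `|alpha|) ^+ 2 * expR (- 1) / 2.

Let c0 : 0 < c.
Proof. by rewrite !mulr_gt0 ?expR_gt0 ?exprn_gt0 ?powR_gt0 ?invr_gt0. Qed.

Let J1_lower n : 1 <= tau n -> c * (tau n `^ (alpha + 1))^-1 <= J n (cst 1).
Proof. exact: exp_moment_lower. Qed.

Let J1_gt0 n : 1 <= tau n -> 0 < J n (cst 1).
Proof.
move=> t1; apply: lt_le_trans (J1_lower t1).
by rewrite mulr_gt0// invr_gt0 powR_gt0// (lt_le_trans _ t1).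
Qed.

(** Condition (iv) with xi = alpha + j makes the error o(tau^(-(alpha + j + 1))); dividing by a mass
    of at least c tau^(-(alpha + 1)) leaves o(tau^(-j)). *)
Let relative_error (j : nat) (zeta M : R) (g : R -> R) : -1 < zeta ->
  measurable_fun setT g -> (forall s, D s -> 0 <= g s <= M) ->
  (forall s, D s -> beta_weight alpha s * g s =
     (1 - s) `^ (alpha + j%:R) * (1 + s) `^ zeta) ->
  tau n ^+ j * ((I n g - J n g) / J n (cst 1)) @[n --> \oo] --> 0.
Proof.
move=> z1 mg g0M gE.
have gM s : D s -> `|g s| <= M by move=> /g0M/andP[g0 gM]; rewrite ger0_norm.
have x1 : -1 < alpha + j%:R by rewrite (lt_le_trans alpha1)// lerDl.
have /eqoP o := class_F_laplace hf x1 z1.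
apply/cvgrPdist_le => e e0.
have ce0 : 0 < c * e by rewrite mulr_gt0.
have near_o := kappay (o _ ce0).
near=> n.
have t1 : 1 <= tau n by near: n; exact: near_ge_tau.
have t0 : 0 < tau n by rewrite (lt_le_trans _ t1).
have J0 := J1_gt0 t1.
have err : `|I n g - J n g| <= c * e * (tau n `^ (alpha + j%:R + 1))^-1.
  have : `|\int[mu]_(s in `[-1, 1]) ((1 - s) `^ (alpha + j%:R) * (1 + s) `^ zeta *
        `|expratio f (kappa n) s - expR ((s - 1) * (kappa n * phi f (kappa n)))|)| <=
      c * e * `|(tau n `^ (alpha + j%:R + 1))^-1| by near: n; exact: near_o.
  have v0 : 0 <= (tau n `^ (alpha + j%:R + 1))^-1 by rewrite invr_ge0 powR_ge0.
  rewrite (ger0_norm v0); apply: le_trans.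
  have mr : measurable_fun setT (fun s => `|f (kappa n * s) / f (kappa n) - expR ((s - 1) * tau n)|).
    apply: measurableT_comp => //; apply: measurable_funB; first exact: measurable_ratio.
    exact: measurable_exp.
  have i1 := integrable_ratio_moment (kappa0 n) mg gM.
  have i2 := integrable_exp_moment ialpha (ltW t0) mg gM.
  rewrite /I /J /ratio_moment /exp_moment -RintegralB//.
  apply: (le_trans (le_normr_Rintegral _ _)) => //; first exact: (integrableB _ i1 i2).
  rewrite ger0_norm; last first.
    by apply: Rintegral_ge0 => s _; rewrite !mulr_ge0 ?powR_ge0.
  rewrite le_eqVlt; apply/orP; left; apply/eqP; rewrite /Rintegral; congr fine.
  rewrite [RHS]integral_itv_bndoo; last first.
    apply/measurable_EFinP/measurable_funTS; apply: measurable_funM; last first.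
      by under eq_fun do rewrite (expratioE _ (kappa0 n)); exact: mr.
    apply: measurable_funM.
      apply: (@measurableT_comp _ _ _ _ _ _ (fun z : R => z `^ (alpha + j%:R)) _ (fun s : R => 1 - s)) => //.
      exact: measurable_funB.
    apply: (@measurableT_comp _ _ _ _ _ _ (fun z : R => z `^ zeta) _ (fun s : R => 1 + s)) => //.
    exact: measurable_funD.
  apply: eq_integral => s; rewrite inE => Ds; congr EFin.
  rewrite -gE// (expratioE _ (kappa0 n)) -mulrBr -mulrBr !normrM.
  rewrite (ger0_norm (beta_weight_ge0 _ _)) mulrA; congr (_ * _ * _).
  by have /andP[g0 _] := g0M _ Ds; rewrite ger0_norm.
rewrite sub0r normrN normrM normrX (gtr0_norm t0) normrM normfV (gtr0_norm J0).
rewrite mulrA ler_pdivrMr//.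
apply: (@le_trans _ _ (tau n ^+ j * (c * e * (tau n `^ (alpha + j%:R + 1))^-1))).
  by rewrite ler_wpM2l// exprn_ge0// ltW.
apply: le_trans (ler_wpM2l (ltW e0) (J1_lower t1)).
rewrite le_eqVlt; apply/orP; left; apply/eqP.
have -> : tau n `^ (alpha + j%:R + 1) = tau n `^ (alpha + 1) * tau n ^+ j.
  rewrite -powR_mulrn ?(ltW t0)// -powRD; first by congr powR; ring.
  by rewrite (gt_eqF t0) implybT.
by field; rewrite !gt_eqF ?exprn_gt0 ?powR_gt0.
Unshelve. all: by end_near.
Qed.

Let Gv (s : R) := 1 - s.
Let G2 (s : R) := 1 - s ^+ 2.
Let G4 (s : R) := (1 - s ^+ 2) ^+ 2.

Let mGv : measurable_fun setT Gv. Proof. exact: measurable_funB. Qed.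

Let mG2 : measurable_fun setT G2.
Proof. by apply: measurable_funB => //; exact: measurable_funX. Qed.

Let mG4 : measurable_fun setT G4. Proof. exact: measurable_funX. Qed.

Let GvD s : D s -> 0 <= Gv s <= 2.
Proof. by rewrite /= in_itv/= /Gv => /andP[? ?]; apply/andP; split; lra. Qed.

Let G2D s : D s -> 0 <= G2 s <= 1.
Proof. by move=> /in_D s1; rewrite /G2 ltW//= gerBl sqr_ge0. Qed.

Let G4D s : D s -> 0 <= G4 s <= 1.
Proof.
by move=> /G2D/andP[a b]; rewrite /G4 exprn_ge0//= exprn_ile1.
Qed.

Let factor s b : D s -> beta_weight b s = (1 - s) `^ b * (1 + s) `^ b.
Proof.
rewrite /= in_itv/= => /andP[? ?]; rewrite -powRM; [|lra|lra].
by rewrite /beta_weight; congr (_ `^ b); ring.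
Qed.

Let powR_succ (x b : R) : 0 < x -> x `^ (b + 1) = x `^ b * x.
Proof.
by move=> x0; rewrite powRD ?powRr1 ?(ltW x0)// (gt_eqF x0) implybT.
Qed.

Let bound1 s : D s -> 0 <= (cst 1 s : R) <= 1.
Proof. by rewrite ler01 lexx. Qed.

Let e0_cvg : (I n (cst 1) - J n (cst 1)) / J n (cst 1) @[n --> \oo] --> 0.
Proof.
have hE s : D s -> beta_weight alpha s * cst 1 s = (1 - s) `^ (alpha + 0%:R) * (1 + s) `^ alpha.
  by move=> Ds; rewrite mulr1 addr0 factor.
have := @relative_error 0 alpha 1 (cst 1) alpha1 (@measurable_cst _ _ _ _ _ _) bound1 hE.
by under eq_fun do rewrite expr0 mul1r.
Qed.

Let eV_cvg : (I n Gv - J n Gv) / J n (cst 1) @[n --> \oo] --> 0.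
Proof.
have := @relative_error 1 alpha 2 Gv alpha1 mGv GvD.
have h s : D s -> beta_weight alpha s * Gv s = (1 - s) `^ (alpha + 1%:R) * (1 + s) `^ alpha.
  move=> Ds; rewrite factor// powR_succ; first by rewrite /Gv; ring.
  by move: Ds; rewrite /= in_itv/= => /andP[? ?]; lra.
move=> /(_ h) h1.
(* The case j = 1 controls tau times this error, which is stronger than the claim. *)
have h2 : (tau n)^-1 * (tau n ^+ 1 * ((I n Gv - J n Gv) / J n (cst 1))) @[n --> \oo] --> 0.
  by rewrite -[X in _ --> X](mul0r (0 : R)); apply: cvgM; [exact: cvg_tauV|exact: h1].
apply: near_cvg_seq h2; near=> n.
have t1 : 1 <= tau n by near: n; exact: near_ge_tau.
by rewrite /= expr1 mulKf// gt_eqF// (lt_le_trans _ t1).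
Unshelve. all: by end_near.
Qed.

Let e2_cvg : tau n * ((I n G2 - J n G2) / J n (cst 1)) @[n --> \oo] --> 0.
Proof.
have a2 : -1 < alpha + 1 by have := alpha1; lra.
have := @relative_error 1 (alpha + 1) 1 G2 a2 mG2 G2D; apply => s Ds.
by rewrite -beta_weightD1// factor.
Qed.

Let e4_cvg : tau n ^+ 2 * ((I n G4 - J n G4) / J n (cst 1)) @[n --> \oo] --> 0.
Proof.
have a2 : -1 < alpha + 2 by have := alpha1; lra.
have := @relative_error 2 (alpha + 2) 1 G4 a2 mG4 G4D; apply => s Ds.
rewrite -factor// (_ : alpha + 2 = alpha + 1 + 1); last by ring.
by rewrite !beta_weightD1// -mulrA -expr2.
Qed.

Let norm_le (g : R -> R) M : (forall s, D s -> 0 <= g s <= M) ->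
  forall s, D s -> `|g s| <= M.
Proof. by move=> h s /h/andP[g0 gM]; rewrite ger0_norm. Qed.

Let J_id n : 1 <= tau n -> J n id = J n (cst 1) - J n Gv.
Proof.
move=> t1; have t0 : 0 <= tau n by rewrite (le_trans _ t1).
rewrite /J /exp_moment -RintegralB//; last 2 first.
- exact: (integrable_exp_moment ialpha t0 (@measurable_cst _ _ _ _ _ _) (norm_le bound1)).
- exact: (integrable_exp_moment ialpha t0 mGv (norm_le GvD)).
by apply: eq_Rintegral => s _; rewrite /Gv /=; ring.
Qed.

Let J2E n : 1 <= tau n -> tau n * J n G2 = 2 * (alpha + 1) * J n id.
Proof. by move=> t1; apply: exp_moment_ibp => //; rewrite (le_trans _ t1). Qed.

Let J_ge0 n g : (forall s, D s -> 0 <= g s) -> 0 <= J n g.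
Proof.
move=> g0; apply: Rintegral_ge0 => s Ds.
by rewrite mulr_ge0 ?powR_ge0// mulr_ge0 ?expR_ge0// g0.
Qed.

(** A factor 1 - s^2 raises the exponent of the weight by one, so the integration by parts is
    applied at alpha + 1 and then at alpha, with s <= 1 in between. *)
Let J4_bound n : 1 <= tau n ->
  tau n ^+ 2 * J n G4 <= (2 * (alpha + 1 + 1)) * (2 * (alpha + 1) * J n (cst 1)).
Proof.
move=> t1; have t0 : 0 <= tau n by rewrite (le_trans _ t1).
have i1 : mu.-integrable D (EFin \o beta_weight (alpha + 1)).
  have := integrable_weighted ialpha mG2 (norm_le G2D).
  by apply: eq_integrable => // s; rewrite inE => Ds; rewrite /= beta_weightD1.
have a2 : -1 < alpha + 1 by have := alpha1; lra.
have E : J n G4 = exp_moment (alpha + 1) (tau n) (fun s => 1 - s ^+ 2).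
  apply: eq_Rintegral => s; rewrite inE => Ds; rewrite beta_weightD1//.
  by rewrite /G4; ring.
rewrite expr2 -mulrA E exp_moment_ibp// mulrCA; apply: ler_wpM2l; first by lra.
have a1 : 0 <= 2 * (alpha + 1) by have := alpha1; lra.
apply: (@le_trans _ _ (tau n * J n G2)).
  apply: ler_wpM2l => //; apply: le_Rintegral => //.
  - apply: (integrable_exp_moment (M := 1) i1 t0) => // s.
    by rewrite /= in_itv/= => /andP[? ?]; rewrite ler_norml; apply/andP; split; lra.
  - exact: (integrable_exp_moment ialpha t0 mG2 (norm_le G2D)).
  - move=> s Ds; rewrite beta_weightD1// -mulrA ler_wpM2l ?powR_ge0// mulrCA mulrC.
    have /andP[g0 _] := G2D Ds.
    rewrite -/(G2 s) [leRHS]mulrC -mulrA mulrC -mulrA ler_wpM2l ?expR_ge0//.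
    rewrite mulrC ler_piMr//.
    by move: Ds; rewrite /= in_itv/= => /andP[_ /ltW].
rewrite J2E// ler_wpM2l// J_id// gerBl J_ge0// => s /GvD/andP[].
by [].
Qed.

Let B : R := \int[mu]_(s in D) beta_weight alpha s.

(** For s >= 0, 1 - s <= 1 - s^2. For s < 0 the factor is at most 2 and the exponential at most e^(-
    tau). *)
Let JV_bound n : 1 <= tau n ->
  J n Gv <= (tau n)^-1 * (2 * (alpha + 1) * J n (cst 1)) + 2 * B * expR (- tau n).
Proof.
move=> t1; have t0 : 0 < tau n by rewrite (lt_le_trans _ t1).
have a1 : 0 <= 2 * (alpha + 1) by have := alpha1; lra.
have iG2 := integrable_exp_moment ialpha (ltW t0) mG2 (norm_le G2D).
have le2 : J n G2 <= (tau n)^-1 * (2 * (alpha + 1) * J n (cst 1)).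
  rewrite -(mulKf (lt0r_neq0 t0) (J n G2)) ler_wpM2l ?invr_ge0 ?(ltW t0)//.
  rewrite J2E// ler_wpM2l// J_id// gerBl J_ge0// => s /GvD/andP[].
  by [].
apply: le_trans (lerD le2 (lexx _)).
have -> : 2 * B * expR (- tau n) = \int[mu]_(s in D) (2 * expR (- tau n) * beta_weight alpha s).
  by rewrite RintegralZl//; rewrite /B; ring.
have iB : mu.-integrable D (EFin \o (fun s => 2 * expR (- tau n) * beta_weight alpha s)).
  by apply: (integrableZl _ (2 * expR (- tau n)) ialpha).
rewrite /J /exp_moment -RintegralD//; apply: le_Rintegral => //.
- exact: (integrable_exp_moment ialpha (ltW t0) mGv (norm_le GvD)).
- exact: (integrableD _ iG2 iB).
- move=> s Ds; rewrite [_ * beta_weight _ _]mulrC -mulrDr ler_wpM2l ?powR_ge0//.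
  have := Ds; rewrite /= in_itv/= => /andP[s1 s2].
  have E0 := expR_ge0 ((s - 1) * tau n); have E1 := expR_ge0 (- tau n).
  have [s0|s0] := leP 0 s.
    have : Gv s <= G2 s by rewrite /Gv /G2; nra.
    move=> /(ler_wpM2r E0); lra.
  have : expR ((s - 1) * tau n) <= expR (- tau n) by rewrite ler_expR; nra.
  have /andP[v0 v2] := GvD Ds; have /andP[g0 _] := G2D Ds.
  have := mulr_ge0 g0 E0; nra.
Qed.

(** The exponent alpha + 1 = (p - 1)/2 is below p, and e^tau dominates tau^(p + 1) / (p + 1)!. *)
Let exp_decay : expR (- tau n) / (tau n `^ (alpha + 1))^-1 @[n --> \oo] --> 0.
Proof.
have h : p.+1`!%:R * (tau n)^-1 @[n --> \oo] --> 0.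
  by rewrite -[X in _ --> X](mulr0 (p.+1`!%:R : R)); apply: cvgM; [exact: cvg_cst|exact: cvg_tauV].
apply: (@squeeze_cvgr _ _ _ _ (cst 0) (fun n => p.+1`!%:R * (tau n)^-1)) => //; last exact: cvg_cst.
near=> n.
have t1 : 1 <= tau n by near: n; exact: near_ge_tau.
have t0 : 0 < tau n by rewrite (lt_le_trans _ t1).
rewrite /= divr_ge0 ?expR_ge0 ?invr_ge0 ?powR_ge0//= invrK.
apply: (@le_trans _ _ (expR (- tau n) * tau n ^+ p)).
  rewrite ler_wpM2l ?expR_ge0// -powR_mulrn ?(ltW t0)// ler_powR// /alpha.
  have : 2 <= p%:R :> R by rewrite ler_nat.
  lra.
have := expR_ge1Dxn p (ltW t0) => h1.
have {}h1 : tau n ^+ p.+1 / p.+1`!%:R <= expR (tau n) by rewrite (le_trans _ h1)// lerDr.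
have F0 : 0 < p.+1`!%:R :> R by rewrite ltr0n fact_gt0.
rewrite expRN mulrC ler_pdivrMr ?expR_gt0//.
apply: le_trans (ler_wpM2l _ h1); last by rewrite mulr_ge0 ?invr_ge0 ?(ltW t0)// ltW.
rewrite exprS le_eqVlt; apply/orP; left; apply/eqP; field.
by rewrite !gt_eqF.
Unshelve. all: by end_near.
Qed.

Let aV_cvg : J n Gv / J n (cst 1) @[n --> \oo] --> 0.
Proof.
have a1 : 0 <= 2 * (alpha + 1) by have := alpha1; lra.
have B0 : 0 <= B by apply: Rintegral_ge0 => s _; exact: beta_weight_ge0.
pose u n := (tau n)^-1 * (2 * (alpha + 1)) +
  2 * B / c * (expR (- tau n) / (tau n `^ (alpha + 1))^-1).
have hu : u n @[n --> \oo] --> 0.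
  rewrite -[X in _ --> X](addr0 (0 : R)); apply: cvgD.
    by rewrite -[X in _ --> X](mul0r (2 * (alpha + 1))); apply: cvgM; [exact: cvg_tauV|exact: cvg_cst].
  by rewrite -[X in _ --> X](mulr0 (2 * B / c)); apply: cvgM; [exact: cvg_cst|exact: exp_decay].
apply: (@squeeze_cvgr _ _ _ _ (cst 0) u) => //; last exact: cvg_cst.
near=> n.
have t1 : 1 <= tau n by near: n; exact: near_ge_tau.
have t0 : 0 < tau n by rewrite (lt_le_trans _ t1).
have J0 := J1_gt0 t1.
rewrite /= divr_ge0 ?(ltW J0)//=; last by apply: J_ge0 => s /GvD/andP[].
rewrite ler_pdivrMr//; apply: (le_trans (JV_bound t1)).
rewrite /u [leRHS]mulrDl lerD//; first by rewrite mulrA.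
set E := expR _; set L := (tau n `^ _)^-1.
have L0 : 0 < L by rewrite invr_gt0 powR_gt0.
have -> : 2 * B * E = 2 * B / c * (E / L) * (c * L).
  by field; rewrite !gt_eqF.
apply: ler_wpM2l; last exact: J1_lower.
have c0' := ltW c0; have L0' := ltW L0.
by apply: mulr_ge0; apply: divr_ge0 => //; [exact: mulr_ge0|exact: expR_ge0].
Unshelve. all: by end_near.
Qed.

(** With V = theta'X_i, these three are the expectations of 1 - V, of 1 - V^2 and of (1 - V^2)^2. *)
Definition mean_gap n := I n Gv / I n (cst 1).
Definition mean_sin2 n := I n G2 / I n (cst 1).
Definition mean_sin4 n := I n G4 / I n (cst 1).

Let rho_cvg : (1 + (I n (cst 1) - J n (cst 1)) / J n (cst 1))^-1 @[n --> \oo] --> (1 : R).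
Proof.
rewrite -[X in _ --> X]invr1; apply: cvgV; first exact: oner_neq0.
rewrite -[X in _ --> X](addr0 (1 : R)); apply: cvgD; [exact: cvg_cst|exact: e0_cvg].
Qed.

(** Writes a true expectation as the tilted one plus a relative error, corrected by the error on the
    total mass; all limits below are taken in this form. *)
Let ratioE n (t : R) g : 1 <= tau n -> t * (I n g / I n (cst 1)) =
  (t * (J n g / J n (cst 1)) + t * ((I n g - J n g) / J n (cst 1))) *
  (1 + (I n (cst 1) - J n (cst 1)) / J n (cst 1))^-1.
Proof.
move=> t1; have J0 := lt0r_neq0 (J1_gt0 t1).
have -> : 1 + (I n (cst 1) - J n (cst 1)) / J n (cst 1) = I n (cst 1) / J n (cst 1).
  by field.
rewrite invfM invrK -mulrDr -mulrDl addrC subrK.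
by rewrite mulrA mulrA mulrACA mulVf// mulr1 -mulrA.
Qed.

Lemma mean_gap_cvg : mean_gap n @[n --> \oo] --> 0.
Proof.
have h : (J n Gv / J n (cst 1) + (I n Gv - J n Gv) / J n (cst 1)) *
  (1 + (I n (cst 1) - J n (cst 1)) / J n (cst 1))^-1 @[n --> \oo] --> 0.
  rewrite -[X in _ --> X](mul0r (1 : R)); apply: cvgM; last exact: rho_cvg.
  by rewrite -[X in _ --> X](addr0 (0 : R)); apply: cvgD; [exact: aV_cvg|exact: eV_cvg].
apply: near_cvg_seq h; near=> n.
have t1 : 1 <= tau n by near: n; exact: near_ge_tau.
by have := ratioE 1 Gv t1; rewrite !mul1r /mean_gap => ->.
Unshelve. all: by end_near.
Qed.

(** The integration by parts gives 2 (alpha + 1) times the tilted mean of s. That mean tends to 1,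
    and 2 (alpha + 1) = p - 1. *)
Lemma mean_sin2_cvg : tau n * mean_sin2 n @[n --> \oo] --> (p.-1%:R : R).
Proof.
have p1 : p.-1%:R = 2 * (alpha + 1) * (1 - 0) :> R.
  have -> : p.-1%:R = p%:R - 1 :> R by rewrite -subn1 natrB// ltnW.
  by rewrite /alpha; field.
have h : (2 * (alpha + 1) * (1 - J n Gv / J n (cst 1)) +
  tau n * ((I n G2 - J n G2) / J n (cst 1))) *
  (1 + (I n (cst 1) - J n (cst 1)) / J n (cst 1))^-1 @[n --> \oo] --> (p.-1%:R : R).
  rewrite -[X in _ --> X]mulr1; apply: cvgM; last exact: rho_cvg.
  rewrite -[X in _ --> X]addr0; apply: cvgD; last exact: e2_cvg.
  rewrite p1; apply: cvgM; first exact: cvg_cst.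
  by apply: cvgB; [exact: cvg_cst|exact: aV_cvg].
apply: near_cvg_seq h; near=> n.
have t1 : 1 <= tau n by near: n; exact: near_ge_tau.
have J0 := lt0r_neq0 (J1_gt0 t1).
rewrite /mean_sin2 ratioE// [tau n * (J n G2 / _)]mulrA J2E// J_id//.
by congr ((_ + _) * _); field.
Unshelve. all: by end_near.
Qed.

Lemma mean_sin4_bounded : exists M : R, \forall n \near \oo, tau n ^+ 2 * mean_sin4 n <= M.
Proof.
pose K := (2 * (alpha + 1 + 1)) * (2 * (alpha + 1)).
have h : (K + tau n ^+ 2 * ((I n G4 - J n G4) / J n (cst 1))) *
  (1 + (I n (cst 1) - J n (cst 1)) / J n (cst 1))^-1 @[n --> \oo] --> (K + 0) * 1.
  apply: cvgM; last exact: rho_cvg.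
  by apply: cvgD; [exact: cvg_cst|exact: e4_cvg].
exists ((K + 0) * 1 + 1); near=> n.
have t1 : 1 <= tau n by near: n; exact: near_ge_tau.
have J0 := J1_gt0 t1.
have r0 : 0 < (1 + (I n (cst 1) - J n (cst 1)) / J n (cst 1))^-1.
  by near: n; apply: (cvgr_gt _ rho_cvg); exact: ltr01.
apply: (@le_trans _ _ ((K + tau n ^+ 2 * ((I n G4 - J n G4) / J n (cst 1))) *
  (1 + (I n (cst 1) - J n (cst 1)) / J n (cst 1))^-1)).
  rewrite /mean_sin4 ratioE// ler_wpM2r ?(ltW r0)// lerD2r mulrA ler_pdivrMr//.
  by apply: (le_trans (J4_bound t1)); rewrite /K !mulrA.
by near: n; apply: (cvgr_le _ h); rewrite ltrDl.
Unshelve. all: by end_near.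
Qed.

End asymptotics.
End class_F_theory.

(** * The spherical mean *)

Section mean_direction.
Context {R : realType}.

(* The statistic [2 N (1 - theta' x / |x|)] differs from [N |x - (theta' x) theta|^2]
   by at most a factor [1 + 8 (1 - theta' x)] once [theta' x >= 1/2]. *)
Lemma mean_direction_laplace_bound p (theta x : 'rV[R]_p) (N lambda K : R) :
  enorm theta = 1 -> enorm x <= 1 -> 0 <= N -> 0 <= lambda -> 0 < K ->
  let D := 2 * N * (1 - dotr theta (normalize x)) in
  let Q := N * enorm (tangent theta x) ^+ 2 in
  0 <= D /\ `|expR (- (lambda * D)) - expR (- (lambda * Q))| <=
    2 * (1 - expR (- (K^-1 * Q))) + (8 * lambda * K + 2) * (1 - dotr x theta).
Proof.
move=> theta1 x1 N0 l0 K0 /=.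
pose a := dotr x theta; pose m := enorm x.
have m0 : 0 <= m by exact: enorm_ge0.
have am : a <= m by rewrite (le_trans (ler_dotr_enorm _ _))// theta1 mulr1.
have normE : dotr theta (normalize x) = m^-1 * a by rewrite dotrZr dotrC.
have dot1 : dotr theta (normalize x) <= 1.
  rewrite normE; have [->|mn0] := eqVneq m 0; first by rewrite invr0 mul0r.
  by rewrite mulrC ler_pdivrMr ?mul1r// lt0r mn0.
rewrite sqr_enorm_tangent// -/a -/m normE; rewrite normE in dot1.
set D := 2 * N * _; set Q := N * _.
have D0 : 0 <= D by rewrite mulr_ge0 ?mulr_ge0// subr_ge0.
have Q0 : 0 <= Q.
  rewrite mulr_ge0// subr_ge0 -[leLHS]real_normK ?num_real//.
  rewrite lerXn2r ?nnegrE// (le_trans (ler_norm_dotr _ _))//.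
  by rewrite theta1 mulr1.
split => //.
have a1 : 0 <= 1 - a by rewrite subr_ge0 (le_trans am).
have lK : 0 <= lambda * K by rewrite mulr_ge0// ltW.
have eD0 := expR_ge0 (- (lambda * D)).
have eD1 : expR (- (lambda * D)) <= 1 by rewrite expRN_le1// mulr_ge0.
have eQ0 := expR_ge0 (- (lambda * Q)).
have eQ1 : expR (- (lambda * Q)) <= 1 by rewrite expRN_le1// mulr_ge0.
have eK1 : expR (- (K^-1 * Q)) <= 1 by rewrite expRN_le1// mulr_ge0// invr_ge0 ltW.
have t1 := mulr_ge0 lK a1.
(* Below 1/2 the difference of exponentials, at most 1, is covered by 2 (1 - a). *)
have [ah|ah] := ltP a 2^-1.
  by rewrite ler_norml; apply/andP; split; lra.
have m2 : 2^-1 <= m by rewrite (le_trans ah).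
have mp : 0 < m by lra.
have DQ : D - Q = N * (m - a) * (2 - m ^+ 2 - m * a) / m.
  by rewrite /D /Q; field; rewrite gt_eqF.
have ma0 : 0 <= N * (m - a) by rewrite mulr_ge0// subr_ge0.
have x1' : m <= 1 := x1.
have mm1 : m * m <= 1 by rewrite mulr_ile1.
have mam : m * a <= m * m by rewrite ler_wpM2l.
have aam : a * a <= m * a by rewrite ler_wpM2r//; lra.
have aa : 2^-1 * 2^-1 <= a * a by rewrite ler_pM// invr_ge0.
have m2a : 0 <= 2 - m ^+ 2 - m * a by rewrite expr2; lra.
have DQ0 : 0 <= D - Q by rewrite DQ divr_ge0// mulr_ge0.
(* Since a <= m, the factor 2 - m^2 - m a is at most 2 (1 - a^2) <= 4 (1 - a); as a and m are at
   least 1/2, (m + a) m >= 1/2, whence the 8. *)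
have DQ8 : D - Q <= 8 * Q * (1 - a).
  rewrite DQ /Q ler_pdivrMr//.
  have -> : 8 * (N * (m ^+ 2 - a ^+ 2)) * (1 - a) * m =
    N * (m - a) * (8 * (m + a) * (1 - a) * m) by ring.
  rewrite ler_wpM2l//.
  have h1 : 2 - m ^+ 2 - m * a <= 2 * (1 - a) * (1 + a) by rewrite expr2; lra.
  have h2 : 2 * (1 - a) * (1 + a) <= 4 * (1 - a).
    by have := mulr_ge0 a1 a1; lra.
  have h3 : 0 <= (m + a) * m * 2 - 1 by lra.
  have h4 : 4 * (1 - a) <= 8 * (m + a) * (1 - a) * m.
    by have := mulr_ge0 a1 h3; lra.
  lra.
have lDQ : 0 <= lambda * (D - Q) by rewrite mulr_ge0.
have E : expR (- (lambda * D)) = expR (- (lambda * Q)) * expR (- (lambda * (D - Q))).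
  by rewrite -expRD; congr expR; ring.
have e0 := expR_ge0 (- (lambda * (D - Q))).
have e1 : expR (- (lambda * (D - Q))) <= 1 by rewrite expRN_le1.
have e2 := expR_ge1Dx (- (lambda * (D - Q))).
have le : expR (- (lambda * D)) <= expR (- (lambda * Q)) by rewrite E ler_piMr.
rewrite distrC ger0_norm ?subr_ge0//.
(* For Q <= K the exponential is Lipschitz. For Q > K, e^(- Q / K) <= 1/2, so the term 2 (1 - e^(- Q
   / K)) alone exceeds the difference. *)
have [QK|QK] := leP Q K.
  have h : expR (- (lambda * Q)) - expR (- (lambda * D)) <= lambda * (D - Q).
    rewrite E; set eQ := expR _ in eQ0 eQ1 *; set e := expR _ in e0 e1 e2 *.
    have -> : eQ - eQ * e = eQ * (1 - e) by ring.
    have e3 : 0 <= 1 - e by rewrite subr_ge0.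
    by apply: (le_trans (ler_piMl e3 eQ1)); lra.
  have h2 : lambda * (D - Q) <= 8 * (lambda * K) * (1 - a).
    apply: (@le_trans _ _ (lambda * (8 * Q * (1 - a)))); first by rewrite ler_wpM2l.
    have -> : lambda * (8 * Q * (1 - a)) = 8 * lambda * (1 - a) * Q by ring.
    have -> : 8 * (lambda * K) * (1 - a) = 8 * lambda * (1 - a) * K by ring.
    by rewrite ler_wpM2l// mulr_ge0// mulr_ge0.
  lra.
have : expR (- (K^-1 * Q)) <= 2^-1.
  apply: (@le_trans _ _ (expR (- 1))).
    by rewrite ler_expR lerN2 mulrC ler_pdivlMr// mul1r ltW.
  rewrite expRN lef_pV2 ?posrE ?expR_gt0//.
  by have := expR_ge1Dx (1 : R); lra.
lra.
Qed.

End mean_direction.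

Section spherical_sample.
Context {R : realType}.
Variables (p : nat) (theta : 'rV[R]_p) (f : R -> R) (kappa : R).
Hypotheses (p2 : (1 < p)%N) (theta1 : enorm theta = 1) (hf : class_F f) (kappa0 : 0 < kappa).
Context d (T : measurableType d) (P : probability T R) (n : nat).
Variable X : 'I_n -> {RV P >-> 'rV[R]_p}.
Hypothesis hX : sphere_sample theta kappa f X.

Let X1 i w : enorm (X i w) = 1 := sphere_sample_sphere hX i w.

Lemma dotr_sample_bound i w : -1 <= dotr (X i w) theta <= 1.
Proof.
by rewrite -ler_norml (le_trans (ler_norm_dotr _ _))// X1 theta1 mulr1.
Qed.

(** Functions such as 1 - s are nonnegative only on the range of the projection; passing to the
    absolute value meets the sign condition on the whole line without changing either side. *)
Lemma expectation_sample (g : R -> R) (M : R) (i : 'I_n) :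
  measurable_fun setT g -> (forall s, -1 <= s <= 1 -> 0 <= g s <= M) ->
  \int[P]_w g (dotr (X i w) theta) = ratio_moment f p kappa g / ratio_moment f p kappa (cst 1).
Proof.
move=> mg gM.
have Dcc (s : R) : `](- 1)%R, 1%R[%classic s -> -1 <= s <= 1.
  by rewrite /= in_itv/= => /andP[? ?]; rewrite !ltW.
have -> : \int[P]_w g (dotr (X i w) theta) = \int[P]_w `|g (dotr (X i w) theta)|.
  apply: eq_Rintegral => w _.
  by have /gM/andP[g0 _] := dotr_sample_bound i w; rewrite ger0_norm.
rewrite (@expectation_ratio_moment _ f hf p p2 theta kappa d T P (X i) (fun s => `|g s|) M)//.
- congr (_ / _); apply: eq_Rintegral => s; rewrite inE => /Dcc/gM/andP[g0 _].
  by rewrite ger0_norm.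
- exact: (sphere_sample_density hX i).
- exact: measurableT_comp.
- by move=> s /Dcc/gM/andP[g0 ?]; rewrite normr_id ger0_norm.
Qed.

Let bdot (y : 'rV[R]_p) i : bounded_measurable (fun w => dotr y (X i w)).
Proof.
split; first exact: (@measurable_dotr R p _ _ (cst y) (X i)).
by exists (enorm y) => w; rewrite (le_trans (ler_norm_dotr _ _))// X1 mulr1.
Qed.

Let bV i : bounded_measurable (fun w => 1 - dotr (X i w) theta ^+ 2).
Proof.
apply: bounded_measurableB; first exact: bounded_measurable_cst.
by apply: bounded_measurableX; under eq_fun do rewrite dotrC; exact: bdot.
Qed.

Lemma expectation_dotr_sqr_sample i (y : 'rV[R]_p) : dotr y theta = 0 ->
  p.-1%:R * \int[P]_w (dotr y (X i w) ^+ 2) =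
  enorm y ^+ 2 * \int[P]_w (1 - dotr (X i w) theta ^+ 2).
Proof.
move=> yt; have := expectation_dotr_sqr p2 theta1 (class_F_ge0 hf) (class_F_measurable hf)
  (X1 i) (sphere_sample_density hX i) yt.
rewrite (EFin_expectation P (bV i)) (EFin_expectation P (bounded_measurableX 2 (bdot y i))).
by rewrite -!EFinM => -[].
Qed.

(** The constant sequence [fun=> kappa], read at index 0, specializes the moments indexed by n to a
    single concentration. *)
Lemma central_limit_bound_sample (c delta lambda : R) : 0 < delta -> 0 <= lambda ->
  let m2 := mean_sin2 f p (fun=> kappa) 0 in
  let m4 := mean_sin4 f p (fun=> kappa) 0 in
  let v := c ^+ 2 * m2 / p.-1%:R in
  `|\int[P]_w expR (- (lambda *
       enorm (partial_sum X (fun x => c *: tangent theta x) n w) ^+ 2)) -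
    (1 + 2 * lambda * (n%:R * v)) `^ (- (p.-1%:R / 2))| <=
  n%:R * ((22 * lambda ^+ 2 + 22 * lambda) *
            ((delta * (c ^+ 2 * m2) + c ^+ 4 * m4 / delta) / 2) +
          lambda ^+ 2 * (p.-1%:R ^+ 2 + 2 * p.-1%:R + 24) * v ^+ 2).
Proof.
move=> delta0 lambda0.
pose m2 := mean_sin2 f p (fun=> kappa) 0; pose m4 := mean_sin4 f p (fun=> kappa) 0.
have m2x : measurable_fun setT (fun s : R => 1 - s ^+ 2).
  by apply: measurable_funB => //; exact: measurable_funX.
have sq (s : R) : -1 <= s <= 1 -> 0 <= 1 - s ^+ 2 <= 1.
  by move=> /andP[? ?]; apply/andP; split; nra.
have EM2 i : \int[P]_w (1 - dotr (X i w) theta ^+ 2) = m2.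
  exact: (@expectation_sample (fun s => 1 - s ^+ 2) 1).
have EM4 i : \int[P]_w ((1 - dotr (X i w) theta ^+ 2) ^+ 2) = m4.
  apply: (@expectation_sample (fun s => (1 - s ^+ 2) ^+ 2) 1).
    exact: measurable_funX.
  by move=> s /sq/andP[? ?]; rewrite exprn_ge0//= exprn_ile1.
have EX i y : dotr y theta = 0 -> \int[P]_w dotr y (X i w) = 0.
  move=> yt; exact: (expectation_dotr_eq0 (class_F_ge0 hf) (class_F_measurable hf)
    (sphere_sample_density hX i) yt).
have EX2 i y : dotr y theta = 0 ->
    p.-1%:R * \int[P]_w (dotr y (X i w) ^+ 2) = enorm y ^+ 2 * m2.
  by move=> yt; rewrite expectation_dotr_sqr_sample// EM2.
exact: (central_limit_bound p2 theta1 (sphere_sample_independent hX) X1 EX EX2 EM2 EM4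
  c delta0 lambda0).
Qed.

End spherical_sample.

Section convergence_facts.
Context {R : realType}.

Lemma near_squeeze_cvg0 (u v : nat -> R) :
  (\forall n \near \oo, `|u n| <= v n) -> v n @[n --> \oo] --> 0 -> u n @[n --> \oo] --> 0.
Proof.
move=> uv v0; apply: norm_cvg0; apply: (squeeze_cvgr _ (cvg_cst (0 : R)) v0).
by apply: filterS uv => n ->; rewrite normr_ge0.
Qed.

Lemma continuous_powR_base (a x : R) : 0 < x -> {for x, continuous (fun t : R => t `^ a)}.
Proof.
move=> x0; apply: differentiable_continuous; apply/derivable1_diffP.
by have [] := is_derive1_powR a x0.
Qed.

Lemma sqrt_invn_cvg0 : Num.sqrt (n%:R^-1 : R) @[n --> \oo] --> (0 : R).
Proof.
rewrite -[X in _ --> X](@sqrtr0 R); apply: (@cvg_comp _ _ _ (fun n : nat => n%:R^-1 : R)).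
  apply/gtr0_cvgV0; last exact: cvgr_idn.
  by exists 1%N => // n /= n0; rewrite ltr0n.
exact: sqrt_continuous.
Qed.

End convergence_facts.

Lemma expectation_sum (R : realType) d (T : measurableType d) (P : probability T R)
    (I : Type) (r : seq I) (F : I -> T -> R) : (forall i, bounded_measurable (F i)) ->
  \int[P]_w (\sum_(i <- r) F i w) = \sum_(i <- r) \int[P]_w F i w.
Proof.
move=> hF; suff [_ ->] : bounded_measurable (fun w => \sum_(i <- r) F i w) /\
    \int[P]_w (\sum_(i <- r) F i w) = \sum_(i <- r) \int[P]_w F i w by [].
elim: r => [|i r [hr IH]].
  under eq_fun do rewrite big_nil.
  by rewrite big_nil expectation_cst; split => //; exact: bounded_measurable_cst.
under eq_fun do rewrite big_cons.
by rewrite big_cons expectationD// IH; split => //; exact: bounded_measurableD.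
Qed.

Lemma tangentZ (R : realType) p (theta x : 'rV[R]_p) (a : R) :
  tangent theta (a *: x) = a *: tangent theta x.
Proof. by rewrite /tangent dotrZl scalerBr scalerA. Qed.

Lemma tangent_sum (R : realType) p (theta : 'rV[R]_p) n (x : 'I_n -> 'rV[R]_p) :
  tangent theta (\sum_(i < n) x i) = \sum_(i < n) tangent theta (x i).
Proof. by rewrite /tangent dotr_suml scaler_suml sumrB. Qed.

(** * Passage to the limit for the spherical mean *)

Section mean_direction_limit.
Local Unset Implicit Arguments.
Context {R : realType} (p : nat) (theta : 'rV[R]_p) (f : R -> R) (kappa : nat -> R).
Hypotheses (p2 : (1 < p)%N) (theta1 : enorm theta = 1) (hf : class_F f).
Hypothesis kappa0 : forall n, 0 < kappa n.
Hypothesis kappay : kappa n @[n --> \oo] --> +oo.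
Context (d : nat -> measure_display) (T : forall n, measurableType (d n)).
Context (P : forall n, probability (T n) R) (X : forall n, 'I_n -> {RV (P n) >-> 'rV[R]_p}).
Hypothesis hX : forall n, sphere_sample theta (kappa n) f (X n).

Let tau n := kappa n * phi f (kappa n).
Let k := p.-1.
Let Xbar n := sample_mean (X n).
Let Q n w := n%:R * tau n * enorm (tangent theta (Xbar n w)) ^+ 2.
Let D n w := mean_direction_stat theta (kappa n) f (X n) w.
(** The value given to [delta], the interpolation parameter of the third moment. *)
Let s n : R := Num.sqrt (n%:R^-1).

Let tau1 : \forall n \near \oo, 1 <= tau n.
Proof. exact: near_ge_tau. Qed.

Let n1 : \forall n \near \oo, (0 < n)%N.
Proof. by exists 1%N. Qed.

Let X1 n (i : 'I_n) w : enorm (X n i w) = 1 := sphere_sample_sphere (hX n) i w.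

Let Xbar1 n w : enorm (Xbar n w) <= 1.
Proof.
rewrite /Xbar /sample_mean enormZ ger0_norm ?invr_ge0//.
apply: (@le_trans _ _ (n%:R^-1 * n%:R)).
  rewrite ler_wpM2l ?invr_ge0// (le_trans (enorm_sum _ _ _))//.
  rewrite (eq_bigr (fun=> 1)) => [|i _]; last exact: X1.
  by rewrite sumr_const card_ord.
by case: n w => [|n] w; rewrite ?mulr0// mulVf.
Qed.

Let partial_sumE n w : (0 < n)%N -> 0 <= tau n ->
  enorm (partial_sum (X n) (fun x => Num.sqrt (tau n / n%:R) *: tangent theta x) n w) ^+ 2 =
  Q n w.
Proof.
move=> n0 t0; rewrite /partial_sum (eq_bigl predT) => [|i]; last by rewrite ltn_ord.
rewrite -scaler_sumr -tangent_sum enormZ exprMn real_normK ?num_real//.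
rewrite sqr_sqrtr ?divr_ge0// /Q /Xbar /sample_mean tangentZ enormZ exprMn real_normK ?num_real//.
by field; rewrite pnatr_eq0 -lt0n.
Qed.

Let mXbar n : measurable_fun setT (Xbar n). Proof. exact: measurable_sample_mean. Qed.

Let mtangent n : measurable_fun setT (fun w => enorm (tangent theta (Xbar n w)) ^+ 2).
Proof.
apply: measurable_funX; apply: measurable_enorm.
apply/measurable_fun_coordP => j; rewrite /tangent.
rewrite (_ : (fun _ => _) = fun w => Xbar n w 0 j - dotr (Xbar n w) theta * theta 0 j).
  apply: measurable_funB; first by move/measurable_fun_coordP : (mXbar n); exact.
  by apply: measurable_funM => //; exact: measurable_dotr.
by apply/funext => w; rewrite !mxE.
Qed.

Let mQ n : measurable_fun setT (Q n).
Proof. exact: measurable_funM. Qed.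

Let mD n : measurable_fun setT (D n).
Proof. exact: measurable_mean_direction_stat. Qed.

Lemma tangent_mean_laplace_cvg (lambda : R) : 0 <= lambda ->
  \int[P n]_w expR (- (lambda * Q n w)) @[n --> \oo] --> (1 + 2 * lambda) `^ (- (k%:R / 2)).
Proof.
move=> l0.
have [M hM] := mean_sin4_bounded hf p2 kappa0 kappay.
have h2 := mean_sin2_cvg hf p2 kappa0 kappay.
have kn0 : (k%:R : R) != 0 by rewrite pnatr_eq0 -lt0n /k -subn1 subn_gt0.
pose a n := tau n * mean_sin2 f p kappa n.
have ha : a n @[n --> \oo] --> (k%:R : R) := h2.
have hak : a n / k%:R @[n --> \oo] --> (1 : R).
  rewrite -[X in _ --> X](@divff R k%:R)//; apply: cvgM; [exact: ha|exact: cvg_cst].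
pose A := 22 * lambda ^+ 2 + 22 * lambda.
pose C := lambda ^+ 2 * (k%:R ^+ 2 + 2 * k%:R + 24).
(* The central limit bound for c^2 = tau / n and delta = n^(-1/2), after cancelling n and replacing
   tau^2 times the fourth moment by its bound M. *)
pose err n := A * (s n * (a n + M) / 2) + C * (s n ^+ 2 * (a n / k%:R) ^+ 2).
have A0 : 0 <= A by rewrite /A addr_ge0 ?mulr_ge0 ?exprn_ge0.
have herr : err n @[n --> \oo] --> 0.
  rewrite -[X in _ --> X](_ : A * (0 * (k%:R + M) / 2) + C * (0 ^+ 2 * 1 ^+ 2) = 0); last first.
    by rewrite mul0r mul0r mulr0 expr0n/= mul0r mulr0 addr0.
  have hs := @sqrt_invn_cvg0 R.
  apply: cvgD; apply: cvgM; [exact: cvg_cst| |exact: cvg_cst|].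
    apply: cvgM; [|exact: cvg_cst]; apply: cvgM; [exact: hs|].
    by apply: cvgD; [exact: ha|exact: cvg_cst].
  rewrite !expr2; apply: cvgM; apply: cvgM; [exact: hs|exact: hs|exact: hak|exact: hak].
(* The total variance [a n / k%:R] is not exactly 1 for finite n; the comparison is made with that
   variance, and continuity of the power finishes. *)
apply: (@cvg_sub0 _ _ _ _ _ _ (fun n => (1 + 2 * lambda * (a n / k%:R)) `^ (- (k%:R / 2)))).
  apply: near_squeeze_cvg0 herr; near=> n.
  have n0 : (0 < n)%N by near: n; exact: n1.
  have t0 : 0 <= tau n by rewrite (@le_trans _ _ 1)//; near: n; exact: tau1.
  have nM : tau n ^+ 2 * mean_sin4 f p kappa n <= M by near: n; exact: hM.
  have nn0 : (n%:R : R) != 0 by rewrite pnatr_eq0 -lt0n.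
  have s2 : s n ^+ 2 = n%:R^-1 by rewrite sqr_sqrtr// invr_ge0.
  have s0 : 0 < s n by rewrite sqrtr_gt0 invr_gt0 ltr0n.
  have c2 : Num.sqrt (tau n / n%:R) ^+ 2 = tau n * s n ^+ 2 by rewrite sqr_sqrtr ?divr_ge0// s2.
  have := central_limit_bound_sample p2 theta1 hf (kappa0 n) (hX n)
    (Num.sqrt (tau n / n%:R)) s0 l0; cbv zeta.
  rewrite -[mean_sin2 _ _ _ 0]/(mean_sin2 f p kappa n) -[mean_sin4 _ _ _ 0]/(mean_sin4 f p kappa n).
  under eq_Rintegral do rewrite partial_sumE//.
  have -> : Num.sqrt (tau n / n%:R) ^+ 4 = (tau n * s n ^+ 2) ^+ 2 by rewrite -c2 -exprM.
  rewrite c2 -/k.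
  have nE : n%:R = (s n ^+ 2)^-1 by rewrite s2 invrK.
  have -> : n%:R * (tau n * s n ^+ 2 * mean_sin2 f p kappa n / k%:R) = a n / k%:R.
    by rewrite nE /a; field; rewrite kn0 gt_eqF.
  move=> /le_trans; apply.
  rewrite /err -/A -/C.
  have -> : n%:R * (A * ((s n * (tau n * s n ^+ 2 * mean_sin2 f p kappa n) +
      (tau n * s n ^+ 2) ^+ 2 * mean_sin4 f p kappa n / s n) / 2) +
      C * (tau n * s n ^+ 2 * mean_sin2 f p kappa n / k%:R) ^+ 2) =
    A * (s n * (a n + tau n ^+ 2 * mean_sin4 f p kappa n) / 2) +
    C * (s n ^+ 2 * (a n / k%:R) ^+ 2).
    by rewrite nE /a; field; rewrite kn0 gt_eqF.
  rewrite lerD2r ler_wpM2l// ler_wpM2r ?invr_ge0// ler_wpM2l ?(ltW s0)//.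
  by rewrite lerD2l.
apply: (@cvg_comp _ _ _ (fun n => 1 + 2 * lambda * (a n / k%:R))
    (fun t : R => t `^ (- (k%:R / 2))) _ (nbhs (1 + 2 * lambda))).
  have h : 1 + 2 * lambda * (a n / k%:R) @[n --> \oo] --> (1 + 2 * lambda * 1 : R).
    apply: cvgD; [exact: cvg_cst|].
    by apply: cvgM; [exact: cvg_cst|exact: hak].
  by rewrite mulr1 in h.
by apply: continuous_powR_base; rewrite ltr_wpDr// mulr_ge0.
Unshelve. all: by end_near.
Qed.

Let bounded_gap n : bounded_measurable (fun w => 1 - dotr (Xbar n w) theta).
Proof.
apply: bounded_measurableB; first exact: bounded_measurable_cst.
split; first exact: (measurable_dotr (mXbar n) (measurable_cst theta)).
exists 1 => w; rewrite (le_trans (ler_norm_dotr _ _))// theta1 mulr1; exact: Xbar1.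
Qed.

Let expectation_gap n : (0 < n)%N ->
  \int[P n]_w (1 - dotr (Xbar n w) theta) = mean_gap f p kappa n.
Proof.
move=> n0; have nn0 : (n%:R : R) != 0 by rewrite pnatr_eq0 -lt0n.
have hb i : bounded_measurable (fun w => 1 - dotr (X n i w) theta).
  apply: bounded_measurableB; first exact: bounded_measurable_cst.
  split; first exact: (@measurable_dotr R p _ _ (X n i) (cst theta)).
  by exists 1 => w; rewrite (le_trans (ler_norm_dotr _ _))// theta1 X1 mulr1.
have E i : \int[P n]_w (1 - dotr (X n i w) theta) = mean_gap f p kappa n.
  apply: (@expectation_sample _ _ theta f (kappa n) p2 theta1 hf (kappa0 n) _ _ _ _ _ (hX n)
    (fun s => 1 - s) 2).
    exact: measurable_funB.
  by move=> t /andP[? ?]; apply/andP; split; lra.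
transitivity (\int[P n]_w (n%:R^-1 * \sum_(i < n) (1 - dotr (X n i w) theta))).
  apply: eq_Rintegral => w _; rewrite sumrB sumr_const card_ord mulrBr mulVf//.
  by rewrite -dotr_suml -dotrZl.
rewrite expectationZ; last first.
  suff /(_ (index_enum 'I_n)) : forall r : seq 'I_n,
      bounded_measurable (fun w => \sum_(i <- r) (1 - dotr (X n i w) theta)) by [].
  elim=> [|i r IH]; first by under eq_fun do rewrite big_nil; exact: bounded_measurable_cst.
  by under eq_fun do rewrite big_cons; exact: bounded_measurableD.
rewrite expectation_sum// (eq_bigr (fun=> mean_gap f p kappa n))//.
by rewrite sumr_const card_ord -[X in _ * X]mulr_natl mulKf.
Qed.

Let DE n w : D n w = 2 * (n%:R * tau n) * (1 - dotr theta (normalize (Xbar n w))).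
Proof. by rewrite /D /mean_direction_stat /spherical_mean -/(Xbar n w) /tau; ring. Qed.

Lemma mean_direction_stat_ge0 n w : 0 <= tau n -> 0 <= D n w.
Proof.
move=> t0; rewrite DE.
by have [] := mean_direction_laplace_bound theta1 (Xbar1 n w) (mulr_ge0 (ler0n R n) t0)
  (lexx 0) (@ltr01 R).
Qed.

Let laplace_compare n (lambda K : R) : (0 < n)%N -> 0 <= tau n -> 0 <= lambda -> 0 < K ->
  `|\int[P n]_w expR (- (lambda * D n w)) - \int[P n]_w expR (- (lambda * Q n w))| <=
  2 * (1 - \int[P n]_w expR (- (K^-1 * Q n w))) + (8 * lambda * K + 2) * mean_gap f p kappa n.
Proof.
move=> n0 t0 l0 K0.
have N0 := mulr_ge0 (ler0n R n) t0.
have Q0 w : 0 <= Q n w by rewrite mulr_ge0// exprn_ge0// enorm_ge0.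
have bQ (c : R) : 0 <= c -> bounded_measurable (fun w => expR (- (c * Q n w))).
  move=> c0; apply: bounded_measurable_expRN; first exact: measurable_funM.
  by move=> w; rewrite mulr_ge0.
have bD : bounded_measurable (fun w => expR (- (lambda * D n w))).
  apply: bounded_measurable_expRN; first exact: measurable_funM.
  by move=> w; rewrite mulr_ge0// mean_direction_stat_ge0.
have bK : bounded_measurable (fun w => expR (- (K^-1 * Q n w))).
  by apply: bQ; rewrite invr_ge0 ltW.
have bc : bounded_measurable (cst 1 : T n -> R) by exact: bounded_measurable_cst.
have b0 := bounded_measurableB bc bK.
have b1 := bounded_measurableZ 2 b0.
have b2 := bounded_measurableZ (8 * lambda * K + 2) (bounded_gap n).
apply: (le_trans (expectation_dist (P n) bD (bQ _ l0) (bounded_measurableD b1 b2) _)).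
  move=> w; rewrite DE.
  by have [] := mean_direction_laplace_bound theta1 (Xbar1 n w) N0 l0 K0.
by rewrite expectationD// (expectationZ _ _ b0) (expectationZ _ _ (bounded_gap n))
  (expectationB _ bc bK) expectation_cst expectation_gap.
Qed.

Lemma mean_direction_stat_laplace_cvg (lambda : R) : 0 <= lambda ->
  \int[P n]_w expR (- (lambda * D n w)) @[n --> \oo] --> (1 + 2 * lambda) `^ (- (k%:R / 2)).
Proof.
move=> l0; apply: cvg_sub0 (tangent_mean_laplace_cvg lambda l0).
apply/cvgr0Pnorm_lt => e e0.
(* The limit in n of the comparison bound for K = 1/t. It vanishes as t tends to 0, so t is fixed
   before n grows. *)
pose G (t : R) := 2 * (1 - (1 + 2 * t) `^ (- (k%:R / 2))).
have [t t0 Gt] : exists2 t : R, 0 < t & G t < e.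
  have GC : G t @[t --> (0 : R)^'+] --> (0 : R).
    apply: cvg_at_right_filter; rewrite -[X in _ --> X](_ : 2 * (1 - 1) = 0); last first.
      by rewrite subrr mulr0.
    apply: cvgM; [exact: cvg_cst|apply: cvgB; [exact: cvg_cst|]].
    have h : 1 + 2 * t @[t --> (0 : R)] --> (1 + 2 * 0 : R).
      by apply: cvgD; [exact: cvg_cst|apply: cvgM; [exact: cvg_cst|exact: cvg_id]].
    rewrite mulr0 addr0 in h; rewrite -[X in _ --> X](_ : 1 `^ (- (k%:R / 2)) = 1);
      last by rewrite powR1.
    apply: (@cvg_comp _ _ _ (fun t : R => 1 + 2 * t) (fun t => t `^ (- (k%:R / 2))) _ _ _ h).
    exact: continuous_powR_base.
  near (0 : R)^'+ => t; exists t; first by [].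
  by near: t; move/cvgr_lt : GC; exact.
pose u n := 2 * (1 - \int[P n]_w expR (- (t * Q n w))) +
  (8 * lambda * t^-1 + 2) * mean_gap f p kappa n.
have hu : u n @[n --> \oo] --> G t.
  rewrite -[X in _ --> X]addr0 -[X in _ --> _ + X](mulr0 (8 * lambda * t^-1 + 2)).
  apply: cvgD; apply: cvgM; [exact: cvg_cst| |exact: cvg_cst|exact: mean_gap_cvg].
  by apply: cvgB; [exact: cvg_cst|exact: tangent_mean_laplace_cvg (ltW t0)].
near=> n.
have n0 : (0 < n)%N by near: n; exact: n1.
have t0' : 0 <= tau n by rewrite (@le_trans _ _ 1)//; near: n; exact: tau1.
have tV : 0 < t^-1 by rewrite invr_gt0.
have := laplace_compare n lambda t^-1 n0 t0' l0 tV; rewrite invrK => /le_lt_trans; apply.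
by near: n; move/cvgr_lt : hu; exact.
Unshelve. all: by end_near.
Qed.

Lemma mean_direction_stat_cvg (x : R) :
  {for x, continuous (fun y => fine (@std_gaussian_rV R p.-1 [set z | sqnorm z <= y]))} ->
  fine (P n [set w | D n w <= x]) @[n --> \oo] -->
    fine (@std_gaussian_rV R p.-1 [set z : 'rV[R]_p.-1 | sqnorm z <= x]).
Proof.
move=> cx.
(* The statistic is only known to be nonnegative once tau is; truncation at 0 makes it so for every
   n and changes nothing for large n. *)
apply: (@near_cvg_seq _ _ (fun n => fine (P n [set w | Num.max (D n w) 0 <= x]))).
  near=> n; congr (fine (P n _)); apply/seteqP; split => w /=;
  rewrite max_l// mean_direction_stat_ge0// (@le_trans _ _ 1)//; near: n; exact: tau1.
apply: (@cvg_laplace_cdf _ _ _ P (fun n w => Num.max (D n w) 0) _ _ (@std_gaussian_rV R p.-1)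
  (@sqnorm R p.-1) x) => //.
- by move=> n; exact: measurable_maxr.
- by move=> n w; rewrite le_max lexx orbT.
- by move=> w; exact: dotr_ge0.
move=> a a0.
rewrite [X in _ --> X](_ : _ = (1 + 2 * a) `^ (- (k%:R / 2))); last first.
  by rewrite /Rintegral std_gaussian_laplace.
apply: near_cvg_seq (mean_direction_stat_laplace_cvg a a0).
near=> n; apply: eq_Rintegral => w _; rewrite max_l// mean_direction_stat_ge0//.
by rewrite (@le_trans _ _ 1)//; near: n; exact: tau1.
Unshelve. all: by end_near.
Qed.

End mean_direction_limit.

Theorem theorem3p2 (R : realType) (p : nat) (hp : (2 <= p)%N)
    (theta : 'rV[R]_p) (htheta : unit_sphere p theta)
    (f : R -> R) (hf : class_F f)
    (kappa : nat -> R) (kappa_gt0 : forall n, 0 < kappa n)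
    (kappa_dvg : kappa n @[n --> \oo] --> +oo)
    (d : nat -> measure_display) (T : forall n, measurableType (d n))
    (P : forall n, probability (T n) R)
    (X : forall n, 'I_n -> {RV (P n) >-> 'rV[R]_p})
    (hX : forall n, sphere_sample theta (kappa n) f (X n)) :
  cvg_in_distribution
    (fun n => (mean_direction_stat theta (kappa n) f (X n) : {RV (P n) >-> R}))
    (chi_square p.-1).
Proof.
move=> x cx.
have chiE y : chi_square p.-1 `]-oo, y]%classic =
    (fine (@std_gaussian_rV R p.-1 [set z | sqnorm z <= y]))%:E.
  rewrite fineK ?fin_num_measure//.
  rewrite (_ : [set _ | _] = @sqnorm R p.-1 @^-1` `]-oo, y]%classic).
    by rewrite -[X in measurable X]setTI; exact: measurable_sqnorm.
  by apply/seteqP; split => z; rewrite /= in_itv.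
have cdfE n : cdf (mean_direction_stat theta (kappa n) f (X n) : {RV (P n) >-> R}) x =
    (fine (P n [set w | mean_direction_stat theta (kappa n) f (X n) w <= x]))%:E.
  rewrite /cdf /distribution /pushforward.
  rewrite (_ : _ @^-1` _ = [set w | mean_direction_stat theta (kappa n) f (X n) w <= x]).
    rewrite fineK// fin_num_measure//.
    rewrite (_ : [set _ | _] = mean_direction_stat theta (kappa n) f (X n) @^-1` `]-oo, x]%classic).
      by rewrite -[X in measurable X]setTI; exact: measurable_mean_direction_stat.
    by apply/seteqP; split => w; rewrite /= in_itv.
  by apply/seteqP; split => w; rewrite /= in_itv.
rewrite chiE; under eq_fun do rewrite cdfE.
apply: cvg_EFin; first exact: nearW.
apply: mean_direction_stat_cvg => //.
(* Continuity is assumed for extended real values; finiteness transfers it to real ones. *)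
have : chi_square p.-1 `]-oo, y]%classic @[y --> x] --> chi_square p.-1 `]-oo, x]%classic := cx.
rewrite chiE => {}cx.
by apply: fine_cvg; exact: cx.
Qed.
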